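(* Let $\mathcal{I}=\{f\in QC: f^{-1}\in QC\}$ and let $\mathcal{F}$ be the set of Fredholm operators on $H^2$ that belong to $\mathfrak{I}(QC)$. Then $$\mathcal{F}=\{T_f+K: f\in\mathcal{I},\ K\in\mathfrak{LC}(H^2)\}.$$
   Context: $\mathbb{T}$ is the unit circle with Lebesgue measure (functions equal a.e. are identified), $\chi_n(t)=e^{int}$ for $n\in\mathbb{Z}$, and $C(\mathbb{T})$ is the set of continuous functions on $\mathbb{T}$. For $p=2,\infty$, $H^p=\{f\in L^p(\mathbb{T}):\int_0^{2\pi}f(t)\chi_n(t)\,dt=0\text{ for all }n>0\}$. $QC=[H^\infty+C(\mathbb{T})]\cap\overline{[H^\infty+C(\mathbb{T})]}$, where the bar denotes the set of complex conjugates; $QC$ is a commutative Banach subalgebra of $L^\infty(\mathbb{T})$. $P$ is the orthogonal projection of $L^2(\mathbb{T})$ onto $H^2$, and for $f\in L^\infty(\mathbb{T})$ the Toeplitz operator $T_f$ on $H^2$ is $T_f(g)=P(fg)$. $\mathfrak{LC}(H^2)$ is the set of compact operators on $H^2$. $\mathfrak{I}(QC)$ is the $C^*$-algebra of bounded operators on $H^2$ generated by $\{T_\phi:\phi\in QC\}$. *)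

(* Defs.v *)
From HB Require Import structures.
From mathcomp Require Import all_boot all_order all_algebra.
From mathcomp Require Import all_classical all_reals all_analysis.
From mathcomp Require Import measurable_realfun ess_sup_inf.

Set Implicit Arguments.
Unset Strict Implicit.
Unset Printing Implicit Defensive.
Import Order.TTheory GRing.Theory Num.Theory.
Import numFieldNormedType.Exports.
From mathcomp Require Import complex.
Local Open Scope classical_set_scope.
Local Open Scope ring_scope.
Local Open Scope complex_scope.
Local Open Scope quotient_scope.

HB.instance Definition _ (R : realType) := isPointed.Build R[i] 0.

(* The sigma-algebra of [R * R] transported along (x, y) |-> x + iy. *)
Section complex_measurable.
Variable R : realType.

Let cpair (p : R * R) : R[i] := p.1 +i* p.2.
Let cmeasurable : set (set R[i]) := [set A | measurable (cpair @^-1` A)].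

Let cmeasurable0 : cmeasurable set0.
Proof. by rewrite /cmeasurable/= preimage_set0; exact: measurable0. Qed.

Let cmeasurableC A : cmeasurable A -> cmeasurable (~` A).
Proof. by rewrite /cmeasurable/= preimage_setC; exact: measurableC. Qed.

Let cmeasurable_bigcup (F : (set R[i])^nat) :
  (forall i, cmeasurable (F i)) -> cmeasurable (\bigcup_i F i).
Proof. by rewrite /cmeasurable/= preimage_bigcup => mF; exact: bigcupT_measurable. Qed.

HB.instance Definition _ := isMeasurable.Build default_measure_display R[i]
  cmeasurable0 cmeasurableC cmeasurable_bigcup.

End complex_measurable.

Section measurable_complex.
Context d (T : measurableType d) (R : realType).
Implicit Types f : T -> R[i].

Lemma measurable_Re : measurable_fun setT (@Re R).
Proof.
move=> _ Y mY; rewrite setTI.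
have := @measurable_fst _ _ R R measurableT _ mY.
by rewrite setTI.
Qed.

Lemma measurable_Im : measurable_fun setT (@Im R).
Proof.
move=> _ Y mY; rewrite setTI.
have := @measurable_snd _ _ R R measurableT _ mY.
by rewrite setTI.
Qed.

Lemma measurable_Complex (u v : T -> R) : measurable_fun setT u ->
  measurable_fun setT v -> measurable_fun setT (fun x => u x +i* v x).
Proof.
move=> mu mv _ Y mY.
exact: (measurable_fun_pair mu mv measurableT mY).
Qed.

Lemma measurable_ReP f : measurable_fun setT f -> measurable_fun setT (fun x => Re (f x)).
Proof. by move=> mf; exact: (measurableT_comp measurable_Re mf). Qed.

Lemma measurable_ImP f : measurable_fun setT f -> measurable_fun setT (fun x => Im (f x)).
Proof. by move=> mf; exact: (measurableT_comp measurable_Im mf). Qed.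

Lemma measurable_cD f g : measurable_fun setT f -> measurable_fun setT g ->
  measurable_fun setT (fun x => f x + g x).
Proof.
move=> mf mg.
rewrite [X in measurable_fun _ X](_ : _ =
  fun x => (Re (f x) + Re (g x)) +i* (Im (f x) + Im (g x))).
  by apply: measurable_Complex; apply: measurable_funD;
    [exact: measurable_ReP mf|exact: measurable_ReP mg
    |exact: measurable_ImP mf|exact: measurable_ImP mg].
by apply/funext => x; case: (f x) => a b; case: (g x).
Qed.

Lemma measurable_cN f : measurable_fun setT f ->
  measurable_fun setT (fun x => - f x).
Proof.
move=> mf; rewrite [X in measurable_fun _ X](_ : _ =
  fun x => (- Re (f x)) +i* (- Im (f x))).
  apply: measurable_Complex; apply: measurableT_comp => //.
    exact: measurable_ReP mf.
  exact: measurable_ImP mf.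
by apply/funext => x; case: (f x).
Qed.

Lemma measurable_cM f g : measurable_fun setT f -> measurable_fun setT g ->
  measurable_fun setT (fun x => f x * g x).
Proof.
move=> mf mg.
have [mrf mif] := (measurable_ReP mf, measurable_ImP mf).
have [mrg mig] := (measurable_ReP mg, measurable_ImP mg).
rewrite [X in measurable_fun _ X](_ : _ = fun x =>
  (Re (f x) * Re (g x) - Im (f x) * Im (g x)) +i*
  (Re (f x) * Im (g x) + Im (f x) * Re (g x))).
  apply: measurable_Complex.
    by apply: measurable_funB; apply: measurable_funM.
  by apply: measurable_funD; apply: measurable_funM.
by apply/funext => x; case: (f x) => a b; case: (g x).
Qed.

Lemma measurable_conj f : measurable_fun setT f ->
  measurable_fun setT (fun x => (f x)^*).
Proof.
move=> mf; rewrite [X in measurable_fun _ X](_ : _ =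
  fun x => Re (f x) +i* (- Im (f x))).
  apply: measurable_Complex; first exact: measurable_ReP mf.
  by apply: measurableT_comp => //; exact: measurable_ImP mf.
by apply/funext => x; case: (f x).
Qed.

Lemma measurable_cnorm f : measurable_fun setT f ->
  measurable_fun setT (fun x => Re `|f x|).
Proof.
move=> mf.
rewrite [X in measurable_fun _ X](_ : _ = fun x =>
  Num.sqrt (Re (f x) ^+ 2 + Im (f x) ^+ 2)); last first.
  by apply/funext => x; rewrite normc_def.
apply: (measurableT_comp (continuous_measurable_fun (@sqrt_continuous R))).
by apply: measurable_funD; apply: measurable_funX;
  [exact: measurable_ReP mf|exact: measurable_ImP mf].
Qed.

End measurable_complex.

(* The circle is parametrized by [0, 2pi]: a function on it is a function of
   the angle t : R, and the measure ignores everything outside [0, 2pi]. *)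
Definition circle_measure (R : realType) : {measure set (measurableTypeR R) -> \bar R} :=
  mrestr (@lebesgue_measure R) (@measurable_itv R `[0, pi *+ 2]).

Arguments circle_measure R : simpl never.

Definition L0 (R : realType) : Type := {mfun_ circle_measure R, measurableTypeR R >-> R[i]}.

HB.instance Definition _ (R : realType) := Choice.on (L0 R).
HB.instance Definition _ (R : realType) := EqQuotient.on (L0 R).

Section L0_ring.
Variable R : realType.
Local Notation mu := (circle_measure R).
Implicit Types (f g h : L0 R) (u v : measurableTypeR R -> R[i]).

Definition L0fun f : measurableTypeR R -> R[i] := repr f.
Local Coercion L0fun : L0 >-> Funclass.

Definition L0class u (mu_u : measurable_fun setT u) : L0 R :=
  \pi_(L0 R) (mfun_Sub (mem_set mu_u)).

Lemma L0fun_measurable f : measurable_fun setT f.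
Proof. exact: (@measurable_funPT _ _ _ _ (repr f)). Qed.

Lemma L0_eq f g : (\forall t \ae mu, f t = g t) <-> f = g.
Proof.
split=> [fg|->]; last exact: aeW.
rewrite -[f]reprK -[g]reprK; apply/eqmodP/asboolP.
by apply: filterS fg.
Qed.

Lemma L0classE u (mu_u : measurable_fun setT u) :
  \forall t \ae mu, L0class mu_u t = u t.
Proof.
have /eqmodP/asboolP : repr (L0class mu_u) = mfun_Sub (mem_set mu_u) %[mod L0 R].
  by rewrite reprK.
by apply: filterS => t; exact.
Qed.

Definition L0cst (c : R[i]) : L0 R := L0class (measurable_cst c).
Definition L0add f g : L0 R :=
  L0class (measurable_cD (L0fun_measurable f) (L0fun_measurable g)).
Definition L0opp f : L0 R := L0class (measurable_cN (L0fun_measurable f)).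
Definition L0mul f g : L0 R :=
  L0class (measurable_cM (L0fun_measurable f) (L0fun_measurable g)).
Definition L0scale (c : R[i]) f : L0 R :=
  L0class (measurable_cM (measurable_cst c) (L0fun_measurable f)).
Definition L0conj f : L0 R := L0class (measurable_conj (L0fun_measurable f)).

Lemma L0cstE c : \forall t \ae mu, L0cst c t = c.
Proof. exact: L0classE. Qed.

Let addE f g : \forall t \ae mu, L0add f g t = f t + g t.
Proof. exact: L0classE. Qed.

Let oppE f : \forall t \ae mu, L0opp f t = - f t.
Proof. exact: L0classE. Qed.

Let mulE f g : \forall t \ae mu, L0mul f g t = f t * g t.
Proof. exact: L0classE. Qed.

Let scaleE c f : \forall t \ae mu, L0scale c f t = c * f t.
Proof. exact: L0classE. Qed.

Lemma L0conjE f : \forall t \ae mu, L0conj f t = (f t)^*.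
Proof. exact: L0classE. Qed.

Let addA : associative L0add.
Proof.
move=> f g h; apply/L0_eq.
apply: filterS (filterI (filterI (addE f (L0add g h)) (addE (L0add f g) h))
  (filterI (addE g h) (addE f g))) => t [[-> ->] [-> ->]].
by rewrite addrA.
Qed.

Let addC : commutative L0add.
Proof.
move=> f g; apply/L0_eq.
by apply: filterS2 (addE f g) (addE g f) => t -> ->; rewrite addrC.
Qed.

Let add0 : left_id (L0cst 0) L0add.
Proof.
move=> f; apply/L0_eq.
by apply: filterS2 (addE (L0cst 0) f) (L0cstE 0) => t -> ->; rewrite add0r.
Qed.

Let addN : left_inverse (L0cst 0) L0opp L0add.
Proof.
move=> f; apply/L0_eq.
apply: filterS3 (addE (L0opp f) f) (oppE f) (L0cstE 0) => t -> -> ->.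
by rewrite addNr.
Qed.

HB.instance Definition _ := GRing.isZmodule.Build (L0 R) addA addC add0 addN.

Let mulA : associative L0mul.
Proof.
move=> f g h; apply/L0_eq.
apply: filterS (filterI (filterI (mulE f (L0mul g h)) (mulE (L0mul f g) h))
  (filterI (mulE g h) (mulE f g))) => t [[-> ->] [-> ->]].
by rewrite mulrA.
Qed.

Let mulC : commutative L0mul.
Proof.
move=> f g; apply/L0_eq.
by apply: filterS2 (mulE f g) (mulE g f) => t -> ->; rewrite mulrC.
Qed.

Let mul1 : left_id (L0cst 1) L0mul.
Proof.
move=> f; apply/L0_eq.
by apply: filterS2 (mulE (L0cst 1) f) (L0cstE 1) => t -> ->; rewrite mul1r.
Qed.

Let mulDl : left_distributive L0mul L0add.
Proof.
move=> f g h; apply/L0_eq.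
apply: filterS (filterI (filterI (mulE (L0add f g) h) (addE f g))
  (filterI (addE (L0mul f h) (L0mul g h)) (filterI (mulE f h) (mulE g h))))
  => t [[-> ->] [-> [-> ->]]].
by rewrite mulrDl.
Qed.

HB.instance Definition _ :=
  GRing.Zmodule_isComPzRing.Build (L0 R) mulA mulC mul1 mulDl.

Let scaleA a b f : L0scale a (L0scale b f) = L0scale (a * b) f.
Proof.
apply/L0_eq.
apply: filterS3 (scaleE a (L0scale b f)) (scaleE b f) (scaleE (a * b) f)
  => t -> -> ->.
by rewrite mulrA.
Qed.

Let scale1 : left_id 1 L0scale.
Proof.
move=> f; apply/L0_eq.
by apply: filterS (scaleE 1 f) => t ->; rewrite mul1r.
Qed.

Let scaleDr : right_distributive L0scale +%R.
Proof.
move=> a f g; apply/L0_eq.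
apply: filterS (filterI (filterI (scaleE a (f + g)) (addE f g))
  (filterI (addE (L0scale a f) (L0scale a g))
           (filterI (scaleE a f) (scaleE a g)))) => t [[-> ->] [-> [-> ->]]].
by rewrite mulrDr.
Qed.

Let scaleDl f : {morph L0scale^~ f : a b / a + b}.
Proof.
move=> a b; apply/L0_eq.
apply: filterS (filterI (filterI (scaleE (a + b) f) (scaleE a f))
  (filterI (addE (L0scale a f) (L0scale b f)) (scaleE b f)))
  => t [[-> e1] [-> e2]].
by rewrite e1 e2 mulrDl.
Qed.

HB.instance Definition _ := GRing.Zmodule_isLmodule.Build R[i] (L0 R)
  scaleA scale1 scaleDr scaleDl.

Lemma L0_0E : \forall t \ae mu, (0 : L0 R) t = 0.
Proof. exact: L0cstE. Qed.

Lemma L0_1E : \forall t \ae mu, (1 : L0 R) t = 1.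
Proof. exact: L0cstE. Qed.

Lemma L0_addE f g : \forall t \ae mu, (f + g : L0 R) t = f t + g t.
Proof. exact: addE. Qed.

Lemma L0_oppE f : \forall t \ae mu, (- f : L0 R) t = - f t.
Proof. exact: oppE. Qed.

Lemma L0_mulE f g : \forall t \ae mu, (f * g : L0 R) t = f t * g t.
Proof. exact: mulE. Qed.

Lemma L0_scaleE c f : \forall t \ae mu, (c *: f : L0 R) t = c * f t.
Proof. exact: scaleE. Qed.

End L0_ring.
Coercion L0fun : L0 >-> Funclass.

Section hardy.
Variable R : realType.
Local Notation mu := (circle_measure R).
Local Notation T := (measurableTypeR R).
Implicit Types (f g : L0 R) (u v : T -> R[i]).

Definition cintegral u : R[i] :=
  (\int[mu]_t Re (u t)) +i* (\int[mu]_t Im (u t)).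

Definition cexp (x : R) : R[i] := cos x +i* sin x.

Lemma measurable_chi (n : int) :
  measurable_fun [set: T] (fun t : T => cexp (n%:~R * (t : R))).
Proof.
have mn : measurable_fun [set: T] (fun t : T => n%:~R * (t : R)).
  by apply: measurable_funM.
apply: measurable_Complex; apply: measurableT_comp mn;
  apply: continuous_measurable_fun.
  exact: continuous_cos.
exact: continuous_sin.
Qed.

Definition chi (n : int) : L0 R := L0class (measurable_chi n).

(* The norm of R[i] takes its values in R[i], whence the [Re]. *)
Definition L0abs f : T -> R := fun t => Re `|f t|.

Definition Lp (p : \bar R) : set (L0 R) :=
  [set f | finite_norm mu p (L0abs f)].

Definition Hardy (p : \bar R) : set (L0 R) :=
  [set f | Lp p f /\
           forall n : int, 0 < n -> cintegral (f * chi n : L0 R) = 0].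

Definition Hardy2_pred : {pred L0 R} := mem (Hardy 2%:E).

Definition L2norm f : R := fine ('N[mu]_2%:E[EFin \o L0abs f])%E.

Lemma circle_measure_fin : mu setT \is a fin_num.
Proof.
rewrite /circle_measure/= /mrestr/= setTI lebesgue_measure_itv/=.
by case: ifP.
Qed.

Lemma Re_norm_ge0 (z : R[i]) : 0 <= Re `|z|.
Proof. by rewrite normc_def/= sqrtr_ge0. Qed.

Lemma L0abs_ge0 f t : 0 <= L0abs f t.
Proof. exact: Re_norm_ge0. Qed.

Lemma measurable_L0abs f : measurable_fun setT (L0abs f).
Proof. exact: measurable_cnorm (L0fun_measurable f). Qed.

Lemma Lnorm2_le (a b : T -> R) : measurable_fun setT a -> measurable_fun setT b ->
  (forall t, 0 <= a t) -> (forall t, 0 <= b t) ->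
  (\forall t \ae mu, a t <= b t) ->
  ('N[mu]_2%:E[EFin \o a] <= 'N[mu]_2%:E[EFin \o b])%E.
Proof.
move=> ma mb a0 b0 ab; rewrite unlock gt0_ler_poweR ?in_itv//=.
- by rewrite leey andbT; apply: integral_ge0 => t _; rewrite lee_fin powR_ge0.
- by rewrite leey andbT; apply: integral_ge0 => t _; rewrite lee_fin powR_ge0.
have mpow (c : T -> R) : measurable_fun setT c ->
    measurable_fun setT (fun t => (`|c t| `^ 2)%:E).
  move=> mc; apply/measurable_EFinP.
  apply: (@measurableT_comp _ _ _ _ _ _ (@powR R ^~ 2)) => //.
  exact: measurableT_comp.
apply: (ae_ge0_le_integral measurableT _ (mpow _ ma) _ (mpow _ mb)).
- by move=> t _; rewrite lee_fin powR_ge0.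
- by move=> t _; rewrite lee_fin powR_ge0.
apply: filterS ab => t abt _ /=.
by rewrite lee_fin ge0_ler_powR ?nnegrE ?normr_ge0// !ger0_norm.
Qed.

Lemma Lp2_Lfun f : Lp 2%:E f <-> L0abs f \in Lfun mu 2%:E.
Proof.
split=> [ff|/andP[_]]; last by rewrite inE.
apply/andP; split; rewrite inE //=.
exact: measurable_L0abs.
Qed.

Lemma Lnorm2Z (c : R[i]) (a : T -> R) : a \in Lfun mu 2%:E ->
  ('N[mu]_2%:E[EFin \o (fun t => Re `|c| * a t)%R] =
   (Re `|c|)%:E * 'N[mu]_2%:E[EFin \o a])%E.
Proof.
move=> fa; have := LnormZ (Lfun_Sub (lee1n 2) fa) (Re `|c|).
by rewrite (ger0_norm (Re_norm_ge0 c)).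
Qed.

Lemma ReM (z w : R[i]) : Re `|z * w| = Re `|z| * Re `|w|.
Proof. by rewrite normrM !normc_def/= mul0r subr0. Qed.

Lemma ReD (z w : R[i]) : Re `|z + w| <= Re `|z| + Re `|w|.
Proof. by have := ler_normD z w; rewrite !normc_def lecE/= => /andP[]. Qed.

Lemma L0absZ c f : \forall t \ae mu, L0abs (c *: f) t = Re `|c| * L0abs f t.
Proof. by apply: filterS (L0_scaleE c f) => t; rewrite /L0abs => ->; rewrite ReM. Qed.

Lemma L0absD f g : \forall t \ae mu, L0abs (f + g) t <= L0abs f t + L0abs g t.
Proof. by apply: filterS (L0_addE f g) => t; rewrite /L0abs => ->; exact: ReD. Qed.

Lemma Lnorm2_L0absZ c f : Lp 2%:E f ->
  ('N[mu]_2%:E[EFin \o L0abs (c *: f)] =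
   (Re `|c|)%:E * 'N[mu]_2%:E[EFin \o L0abs f])%E.
Proof.
move=> /Lp2_Lfun Lf; rewrite -Lnorm2Z//.
have c0 := Re_norm_ge0 c.
have mcf : measurable_fun setT (fun t => Re `|c| * L0abs f t).
  by apply: measurable_funM => //; exact: measurable_L0abs.
have cf0 t : 0 <= Re `|c| * L0abs f t by apply: mulr_ge0 => //; exact: L0abs_ge0.
have mLcf := measurable_L0abs (c *: f).
apply/eqP; rewrite eq_le; apply/andP; split.
  by apply: Lnorm2_le => //; [exact: L0abs_ge0|apply: filterS (L0absZ c f) => t ->].
by apply: Lnorm2_le => //; [exact: L0abs_ge0|apply: filterS (L0absZ c f) => t ->].
Qed.

Lemma Lnorm2_L0absD f g :
  ('N[mu]_2%:E[EFin \o L0abs (f + g)%R] <=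
   'N[mu]_2%:E[EFin \o L0abs f] + 'N[mu]_2%:E[EFin \o L0abs g])%E.
Proof.
have m12 : (1 : R) <= 2 by rewrite ler1n.
apply: le_trans (minkowski_EFin mu (measurable_L0abs f) (measurable_L0abs g) m12).
apply: Lnorm2_le => //.
- exact: measurable_L0abs.
- by apply: measurable_funD; exact: measurable_L0abs.
- exact: L0abs_ge0.
- by move=> t; apply: addr_ge0; exact: L0abs_ge0.
- exact: L0absD.
Qed.

Lemma Lp2_lin c f g : Lp 2%:E f -> Lp 2%:E g -> Lp 2%:E (c *: f + g).
Proof.
move=> Lf Lg; rewrite /Lp/= /finite_norm.
apply: le_lt_trans (Lnorm2_L0absD _ _) _.
rewrite Lnorm2_L0absZ//; apply: lte_add_pinfty => //.
by apply: lte_mul_pinfty => //; rewrite lee_fin Re_norm_ge0.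
Qed.

Definition cintegrable u := mu.-integrable setT (EFin \o (fun t => Re (u t))) /\
                     mu.-integrable setT (EFin \o (fun t => Im (u t))).

Lemma cintegral_ae u v : measurable_fun setT u -> measurable_fun setT v ->
  (\forall t \ae mu, u t = v t) -> cintegral u = cintegral v.
Proof.
move=> m_u m_v uv; rewrite /cintegral /Rintegral.
congr (fine _ +i* fine _); apply: ae_eq_integral => //.
- by apply/measurable_EFinP; exact: measurable_ReP.
- by apply/measurable_EFinP; exact: measurable_ReP.
- by apply: filterS uv => t -> _.
- by apply/measurable_EFinP; exact: measurable_ImP.
- by apply/measurable_EFinP; exact: measurable_ImP.
- by apply: filterS uv => t -> _.
Qed.

Lemma cintegral_lin c u v : cintegrable u -> cintegrable v ->
  cintegral (fun t => c * u t + v t) = c * cintegral u + cintegral v.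
Proof.
move=> [iru iiu] [irv iiv]; case: c => a b.
have Z k (w : T -> R) : mu.-integrable setT (EFin \o w) ->
    mu.-integrable setT (EFin \o (fun t => k * w t)).
  by move=> iw; exact: (integrableZl measurableT k iw).
have D (w w' : T -> R) : mu.-integrable setT (EFin \o w) ->
    mu.-integrable setT (EFin \o w') ->
    mu.-integrable setT (EFin \o (fun t => w t + w' t)).
  by move=> iw iw'; exact: (integrableD measurableT iw iw').
have L (k l : R) (w w' w'' : T -> R) : mu.-integrable setT (EFin \o w) ->
    mu.-integrable setT (EFin \o w') -> mu.-integrable setT (EFin \o w'') ->
    (\int[mu]_t (k * w t + l * w' t + w'' t) =
     k * \int[mu]_t w t + l * \int[mu]_t w' t + \int[mu]_t w'' t)%R.
  move=> iw iw' iw''.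
  rewrite RintegralD//; last by apply: D; exact: Z.
  by rewrite RintegralD ?RintegralZl//; exact: Z.
have -> : cintegral (fun t => (a +i* b) * u t + v t) =
    (\int[mu]_t (a * Re (u t) + (- b) * Im (u t) + Re (v t))) +i*
    (\int[mu]_t (a * Im (u t) + b * Re (u t) + Im (v t))).
  rewrite /cintegral; congr (_ +i* _); apply: eq_Rintegral => t _;
    by case: (u t) => ? ?; case: (v t) => ? ?; rewrite /= ?mulNr.
by rewrite !L// mulNr.
Qed.

Lemma measurable_chiM n f :
  measurable_fun setT (fun t : T => f t * cexp (n%:~R * (t : R))).
Proof.
by apply: measurable_cM; [exact: L0fun_measurable|exact: measurable_chi].
Qed.

Lemma cintegrable_chi n f : Lp 2%:E f ->
  cintegrable (fun t : T => f t * cexp (n%:~R * (t : R))).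
Proof.
move=> /Lp2_Lfun /(Lfun_subset12 circle_measure_fin)/Lfun1_integrable fi.
have mfc := measurable_chiM n f.
have cexp1 (x : R) : Re `|cexp x| = 1.
  by rewrite normc_def/= cos2Dsin2 sqrtr1.
have le1 (z : R[i]) : `|Re z| <= Re `|z|.
  by rewrite normc_def/= -sqrtr_sqr ler_wsqrtr// lerDl sqr_ge0.
have le2 (z : R[i]) : `|Im z| <= Re `|z|.
  by rewrite normc_def/= -sqrtr_sqr ler_wsqrtr// lerDr sqr_ge0.
split; apply: (le_integrable measurableT _ _ fi).
- by apply/measurable_EFinP; exact: measurable_ReP mfc.
- move=> t _ /=; rewrite lee_fin (ger0_norm (L0abs_ge0 _ _)).
  by apply: le_trans (le1 _) _; rewrite ReM cexp1 mulr1.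
- by apply/measurable_EFinP; exact: measurable_ImP mfc.
- move=> t _ /=; rewrite lee_fin (ger0_norm (L0abs_ge0 _ _)).
  by apply: le_trans (le2 _) _; rewrite ReM cexp1 mulr1.
Qed.

Lemma cintegral_chi n f : cintegral (f * chi n : L0 R) =
  cintegral (fun t : T => f t * cexp (n%:~R * (t : R))).
Proof.
apply: cintegral_ae; [exact: L0fun_measurable|exact: measurable_chiM|].
apply: filterS2 (L0_mulE f (chi n)) (L0classE (measurable_chi n)) => t -> e.
by congr (_ * _).
Qed.

Lemma Lp2_0 : Lp 2%:E 0.
Proof.
rewrite /Lp/= /finite_norm.
apply: (@le_lt_trans _ _ ('N[mu]_2%:E[cst 0])%E).
  apply: (@Lnorm2_le (L0abs 0) (cst 0)) => //.
  - exact: measurable_L0abs.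
  - exact: L0abs_ge0.
  - by apply: filterS (L0_0E R) => t; rewrite /L0abs => ->; rewrite normr0.
by rewrite Lnorm0// ltry.
Qed.

Lemma Hardy2_0 : Hardy 2%:E 0.
Proof.
split; first exact: Lp2_0.
move=> n n0; rewrite mul0r (@cintegral_ae _ (cst 0)) ?measurable_cst//.
- by rewrite /cintegral /Rintegral !integral0.
- exact: L0_0E.
Qed.

Lemma Hardy2_lin c f g :
  Hardy 2%:E f -> Hardy 2%:E g -> Hardy 2%:E (c *: f + g).
Proof.
move=> [Lf f0] [Lg g0]; split; first exact: Lp2_lin.
move=> n n0; have := f0 _ n0; have := g0 _ n0; rewrite !cintegral_chi => gn fn.
transitivity (cintegral (fun t : T => c * (f t * cexp (n%:~R * (t : R))) +
                                       g t * cexp (n%:~R * (t : R)))).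
  apply: cintegral_ae; first exact: measurable_chiM.
  - apply: measurable_cD; last exact: measurable_chiM.
    by apply: measurable_cM; [exact: measurable_cst|exact: measurable_chiM].
  - apply: filterS2 (L0_addE (c *: f) g) (L0_scaleE c f) => t -> ->.
    by rewrite mulrDl mulrA.
rewrite (@cintegral_lin c (fun t : T => f t * cexp (n%:~R * (t : R)))
  (fun t : T => g t * cexp (n%:~R * (t : R)))); [|exact: cintegrable_chi..].
by rewrite fn gn mulr0 addr0.
Qed.

Lemma Hardy2_submod_closed : submod_closed Hardy2_pred.
Proof.
split=> [|c f g]; rewrite !inE; first exact: Hardy2_0.
exact: Hardy2_lin.
Qed.

HB.instance Definition _ := GRing.isSubmodClosed.Build R[i] (L0 R) Hardy2_pred
  Hardy2_submod_closed.

Record H2 := MkH2 { H2val : L0 R; _ : H2val \in Hardy2_pred }.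

HB.instance Definition _ := [isSub for H2val].
HB.instance Definition _ := [Choice of H2 by <:].
HB.instance Definition _ := [SubChoice_isSubLmodule of H2 by <:].

Lemma H2valP (x : H2) : Hardy 2%:E (H2val x).
Proof. by case: x => f /=; rewrite inE. Qed.

(* [normedModType R[i]] wants a norm with values in R[i]. *)
Definition H2norm (x : H2) : R[i] := (L2norm (H2val x))%:C.

Lemma H2norm_fin (x : H2) :
  ('N[mu]_2%:E[EFin \o L0abs (H2val x)] \is a fin_num)%E.
Proof. by rewrite ge0_fin_numE ?Lnorm_ge0//; exact: (H2valP x).1. Qed.

Lemma ler_H2normD x y : H2norm (x + y) <= H2norm x + H2norm y.
Proof.
rewrite /H2norm -rmorphD/= lecR -lee_fin EFinD !fineK ?H2norm_fin//.
  exact: Lnorm2_L0absD.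
exact: (H2norm_fin (x + y)).
Qed.

Lemma H2normZ c x : H2norm (c *: x) = `|c| * H2norm x.
Proof.
have -> : `|c| = (Re `|c|)%:C by rewrite normc_def.
rewrite /H2norm -rmorphM/=; congr (_%:C).
apply/EFin_inj; rewrite EFinM !fineK ?H2norm_fin//.
  exact: Lnorm2_L0absZ (H2valP x).1.
exact: (H2norm_fin (c *: x)).
Qed.

Lemma H2norm_eq0 x : H2norm x = 0 -> x = 0.
Proof.
move=> /complexI x0; apply/val_inj/L0_eq => /=.
have /Lnorm_eq0_eq0 : ('N[mu]_2%:E[EFin \o L0abs (H2val x)] = 0)%E.
  by rewrite -(fineK (H2norm_fin x)) -[fine _]/(L2norm _) x0.
have mx : measurable_fun setT (EFin \o L0abs (H2val x)).
  by apply/measurable_EFinP; exact: measurable_L0abs.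
have p2 : (0 < 2%:E :> \bar R)%E by rewrite lte_fin.
move=> /(_ mx p2) xe.
apply: filterS2 xe (L0_0E R) => t /(_ I) [xt] ->.
move: xt; rewrite /L0abs normc_def => /= h.
by apply/normr0_eq0; rewrite normc_def h.
Qed.

HB.instance Definition _ :=
  Lmodule_isNormed.Build R[i] H2 ler_H2normD H2normZ H2norm_eq0.

End hardy.

Section operators.
Context (K : numFieldType) (V : normedModType K).
Implicit Types A B : V -> V.

Definition bounded_operator A : Prop :=
  linear A /\ exists M : K, forall x, `|A x| <= M * `|x|.

Definition compact_operator A : Prop :=
  linear A /\ precompact (A @` [set x | `|x| <= 1]).

Definition finite_dimensional (W : set V) : Prop :=
  exists n (e : 'I_n -> V), forall x, W x ->
    exists c : 'I_n -> K, x = \sum_i c i *: e i.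

Definition finite_codimensional (W : set V) : Prop :=
  exists n (e : 'I_n -> V), forall x,
    exists w (c : 'I_n -> K), W w /\ x = w + \sum_i c i *: e i.

(* Closedness of the range is part of the usual definition, although it follows
   from the other clauses on a Banach space. *)
Definition fredholm A : Prop :=
  [/\ bounded_operator A, finite_dimensional (A @^-1` [set 0]),
      closed (range A) & finite_codimensional (range A)].

(* [A] is in the closure of [S] for the operator norm. *)
Definition operator_closure (S : set (V -> V)) : set (V -> V) :=
  [set A | bounded_operator A /\
           forall e : K, 0 < e ->
             exists2 B, S B & forall x, `|A x - B x| <= e * `|x|].

End operators.

Section toeplitz.
Variable R : realType.
Local Notation mu := (circle_measure R).
Implicit Types (f g : L0 R) (A B : H2 R -> H2 R).

Definition L2inner f g : R[i] := cintegral (f * L0conj g : L0 R).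

(* The orthogonal projection of L^2 onto H^2; the value is junk off L^2. *)
Definition H2proj (f : L0 R) : H2 R :=
  xget 0 [set y : H2 R | forall z : H2 R, L2inner (f - H2val y) (H2val z) = 0].

Definition toeplitz f : H2 R -> H2 R := fun x => H2proj (f * H2val x).

Definition CT : set (L0 R) :=
  [set f | exists g : R -> R[i]^o,
     [/\ continuous g, periodic g (pi *+ 2) & \forall t \ae mu, f t = g t]].

Definition HinfC : set (L0 R) := [set h + c | h in Hardy +oo%E & c in CT].

Definition QC : set (L0 R) := HinfC `&` (@L0conj R @` HinfC).

Definition invertibleQC : set (L0 R) :=
  [set f | QC f /\ exists2 g, QC g & f * g = 1].

(* [B] is the Hilbert space adjoint of [A]. *)
Definition adjoint_operators A B : Prop :=
  forall x y : H2 R,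
    L2inner (H2val (A x)) (H2val y) = L2inner (H2val x) (H2val (B y)).

Definition cstar_algebra (S : set (H2 R -> H2 R)) : Prop :=
  [/\ S `<=` @bounded_operator _ (H2 R),
      S (cst 0) /\
      (forall (c : R[i]) A B, S A -> S B -> S (fun x => c *: A x + B x)),
      forall A B, S A -> S B -> S (A \o B),
      forall A B, S A -> bounded_operator B -> adjoint_operators A B -> S B &
      operator_closure S `<=` S].

Definition toeplitzQC_algebra : set (H2 R -> H2 R) :=
  smallest cstar_algebra (toeplitz @` QC).

End toeplitz.

(* Main.v *)
(* Modulo the compact operators, f |-> T_f is multiplicative on QC: the
   semicommutator T_f T_g - T_fg vanishes for g in H^infty, has finite rank for
   g = chi_n and hence, by norm approximation, is compact for g in H^infty + C.
   Testing T_f + K on chi_n p, with p a trigonometric polynomial and n large,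
   makes K negligible; this bounds |f| by the norm of T_f + K, so that
   {T_f + K} is norm closed and therefore is the C*-algebra of the statement.
   The same test functions, together with the uniform boundedness principle,
   show that |f| is bounded below as soon as the range of T_f + K has finite
   codimension; QC being a closed self-adjoint algebra, 1/f is then a Neumann
   series in QC.  Conversely, if f is invertible in QC, T_{1/f} inverts T_f + K
   modulo compact operators.  Compact operators belong to the algebra because
   the rank one operators x |-> <x, chi_j> chi_i are multiples of
   T_{chi_i} (1 - T_{chi_1} T_{chi_{-1}}) T_{chi_{-j}}. *)
Require Import Defs.
From HB Require Import structures.
From mathcomp Require Import all_boot all_order all_algebra.
From mathcomp Require Import all_classical all_reals all_analysis.
From mathcomp Require Import measurable_realfun ess_sup_inf ring lra zify.

Set Implicit Arguments.
Unset Strict Implicit.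
Unset Printing Implicit Defensive.
Import Order.TTheory GRing.Theory Num.Theory.
Import numFieldNormedType.Exports.
From mathcomp Require Import complex.
Local Open Scope classical_set_scope.
Local Open Scope ring_scope.
Local Open Scope complex_scope.

(** * Integration on the circle and the space L^2 *)

(** Pointwise facts about a symbol are never extracted directly. Each of them (an upper bound for
    |f|, a lower bound, the vanishing of a function without Fourier coefficients) is phrased as Re
    <g p, p> >= 0 for all trigonometric polynomials p, and Fejer approximation with Lebesgue
    differentiation turns this into Re g >= 0 almost everywhere. Replacing p by chi_n p leaves these
    forms unchanged, so a compact summand is invisible to them. The delicate point about QC is that
    H^infty + C is closed in the sup norm: convergence of sums h + c controls neither summand until
    the splitting is rebalanced by Fejer means. Closedness serves three times: for products in
    H^infty + C, for the Neumann series of an inverse, and for the limit of the symbols of T_f + K.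
    Compactness enters as total boundedness of the image of the unit ball, which reduces uniform
    estimates to finitely many vectors. The lower bound for |f| is read off the range, not the
    kernel: a vector nearly orthogonal to the range and to finitely many complementary vectors is
    small, and chi_n p is nearly so when (conj f) p is small. *)

Section circle_integral.
Variable R : realType.
Local Notation mu := (circle_measure R).
Local Notation T := (measurableTypeR R).
Implicit Types (f g h : L0 R) (u v : T -> R[i]) (z w : R[i]).

(* The Euclidean norm, with values in [R] rather than [R[i]]. *)
Definition nm z : R := Re `|z|.

Lemma nm_ge0 z : 0 <= nm z. Proof. exact: Re_norm_ge0. Qed.

Lemma normC_nm z : `|z| = (nm z)%:C%C.
Proof. by rewrite /nm normc_def. Qed.

Lemma sqr_nm z : nm z ^+ 2 = Re z ^+ 2 + Im z ^+ 2.
Proof. by rewrite /nm normc_def/= sqr_sqrtr// addr_ge0// sqr_ge0. Qed.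

Lemma nm0 : nm (0 : R[i]) = 0. Proof. by rewrite /nm normr0. Qed.

Lemma nmN z : nm (- z) = nm z. Proof. by rewrite /nm normrN. Qed.

Lemma nmBC z w : nm (z - w) = nm (w - z).
Proof. by rewrite /nm distrC. Qed.

Lemma nm_conj z : nm z^* = nm z.
Proof. by rewrite /nm normcJ. Qed.

Lemma nm_real (x : R) : nm (x%:C)%C = `|x|.
Proof. by rewrite /nm normc_def/= expr0n/= addr0 sqrtr_sqr. Qed.

Lemma nm_eq0 z : nm z = 0 -> z = 0.
Proof. by move=> z0; apply/normr0_eq0; rewrite normC_nm z0. Qed.

Lemma Re_le_nm z : `|Re z| <= nm z.
Proof. by rewrite /nm normc_def/= -sqrtr_sqr ler_wsqrtr// lerDl sqr_ge0. Qed.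

Lemma Im_le_nm z : `|Im z| <= nm z.
Proof. by rewrite /nm normc_def/= -sqrtr_sqr ler_wsqrtr// lerDr sqr_ge0. Qed.

Lemma nm_le_ReIm z : nm z <= `|Re z| + `|Im z|.
Proof.
rewrite -ler_sqr ?nnegrE ?nm_ge0 ?addr_ge0// sqr_nm.
by rewrite sqrrD !real_normK ?num_real// lerD2r lerDl mulrn_wge0// mulr_ge0.
Qed.

Lemma mul_conj z : z * z^* = ((nm z) ^+ 2)%:C%C.
Proof. by rewrite -sqr_normc normC_nm rmorphXn. Qed.

Lemma ReJ z : Re z^* = Re z. Proof. by case: z. Qed.
Lemma ImJ z : Im z^* = - Im z. Proof. by case: z. Qed.
Lemma Re_D z w : Re (z + w) = Re z + Re w. Proof. by case: z; case: w. Qed.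
Lemma Im_D z w : Im (z + w) = Im z + Im w. Proof. by case: z; case: w. Qed.
Lemma Re_N z : Re (- z) = - Re z. Proof. by case: z. Qed.
Lemma Im_N z : Im (- z) = - Im z. Proof. by case: z. Qed.
Lemma Re_M z w : Re (z * w) = Re z * Re w - Im z * Im w.
Proof. by case: z; case: w. Qed.
Lemma Im_M z w : Im (z * w) = Re z * Im w + Im z * Re w.
Proof. by case: z; case: w. Qed.

Lemma nmM z w : nm (z * w) = nm z * nm w.
Proof. exact: Defs.ReM. Qed.

Lemma nmD z w : nm (z + w) <= nm z + nm w.
Proof. exact: Defs.ReD. Qed.

(** Rotating an integral onto the nonnegative axis reduces [nm_cintegral] to monotonicity of the
    real integral. *)
Lemma nm_unit_rot z : exists2 w, nm w = 1 & w * z = (nm z)%:C%C.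
Proof.
have [->|z0] := eqVneq z 0.
  by exists 1; rewrite ?mul1r ?nm0// /nm normr1.
have n0 : nm z != 0 by apply: contra_neq z0 => /nm_eq0.
exists (z^* * ((nm z)^-1)%:C%C).
  by rewrite nmM nm_conj nm_real ger0_norm ?invr_ge0 ?nm_ge0// mulfV.
rewrite mulrAC [z^* * z]mulrC mul_conj -rmorphM/=; congr (_%:C)%C.
by rewrite expr2 -mulrA mulfV ?mulr1.
Qed.

Lemma cintegrable_nm u : measurable_fun setT u ->
  cintegrable u <-> mu.-integrable setT (EFin \o (fun t => nm (u t))).
Proof.
move=> mu_u; have [mr mi] := (measurable_ReP mu_u, measurable_ImP mu_u).
have mn := measurable_cnorm mu_u.
split=> [[iru iiu]|inu].
  have ib := integrableD measurableT (integrable_norm iru) (integrable_norm iiu).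
  apply: (le_integrable measurableT _ _ ib); first exact/measurable_EFinP.
  move=> t _ /=; rewrite lee_fin ger0_norm ?nm_ge0//.
  by rewrite ger0_norm ?addr_ge0//; exact: nm_le_ReIm.
split; apply: (le_integrable measurableT _ _ inu) => //=.
- exact/measurable_EFinP.
- by move=> t _; rewrite lee_fin (ger0_norm (nm_ge0 _)) Re_le_nm.
- exact/measurable_EFinP.
- by move=> t _; rewrite lee_fin (ger0_norm (nm_ge0 _)) Im_le_nm.
Qed.

Lemma le_ae_integrable (a b : T -> R) : measurable_fun setT a ->
  mu.-integrable setT (EFin \o b) -> (\forall t \ae mu, `|a t| <= b t) ->
  mu.-integrable setT (EFin \o a).
Proof.
move=> ma ib ab; have [mb fb] := integrableP _ _ _ ib.
apply/integrableP; split; first exact/measurable_EFinP.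
apply: le_lt_trans fb; apply: ae_ge0_le_integral => //.
- by apply/measurable_EFinP; exact: measurableT_comp.
- exact: measurableT_comp mb.
- by apply: filterS ab => t abt _; rewrite /= lee_fin (le_trans abt)// ler_norm.
Qed.

Lemma le_ae_Rintegral (a b : T -> R) :
  mu.-integrable setT (EFin \o a) -> mu.-integrable setT (EFin \o b) ->
  (\forall t \ae mu, a t <= b t) -> \int[mu]_t a t <= \int[mu]_t b t.
Proof.
move=> ia ib ab; rewrite -subr_ge0 -RintegralB//.
have iab := integrableB measurableT ib ia.
(* Positivity of the integral is applied to a pointwise nonnegative function; truncation at 0 alters
   the integrand only on a null set. *)
have -> : \int[mu]_t (b t - a t) = \int[mu]_t (Num.max 0 (b t - a t)).
  rewrite /Rintegral; congr fine; apply: ae_eq_integral => //.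
  - by apply: measurable_int iab.
  - apply/measurable_EFinP/measurable_maxr => //.
    by apply/measurable_EFinP; apply: measurable_int iab.
  - by apply: filterS ab => t abt _; rewrite /= max_r// subr_ge0.
by apply: Rintegral_ge0 => t _; rewrite le_max lexx.
Qed.

Lemma cintegrable_le u v : measurable_fun setT u -> measurable_fun setT v ->
  cintegrable v -> (\forall t \ae mu, nm (u t) <= nm (v t)) -> cintegrable u.
Proof.
move=> mu_u mu_v /(cintegrable_nm mu_v) iv uv; apply/(cintegrable_nm mu_u).
apply: (le_ae_integrable (measurable_cnorm mu_u) iv).
by apply: filterS uv => t; rewrite (ger0_norm (nm_ge0 _)).
Qed.

Lemma cintegrable_ae u v : measurable_fun setT u -> measurable_fun setT v ->
  (\forall t \ae mu, u t = v t) -> cintegrable v -> cintegrable u.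
Proof.
move=> mu_u mu_v uv iv; apply: (cintegrable_le mu_u mu_v iv).
by apply: filterS uv => t ->.
Qed.

Lemma cintegrable_lin c u v : cintegrable u -> cintegrable v ->
  cintegrable (fun t => c * u t + v t).
Proof.
move=> [iru iiu] [irv iiv].
have Z k (w : T -> R) : mu.-integrable setT (EFin \o w) ->
    mu.-integrable setT (EFin \o (fun t => k * w t)).
  by move=> iw; exact: (integrableZl measurableT k iw).
have D (w w' : T -> R) : mu.-integrable setT (EFin \o w) ->
    mu.-integrable setT (EFin \o w') ->
    mu.-integrable setT (EFin \o (fun t => w t + w' t)).
  by move=> iw iw'; exact: (integrableD measurableT iw iw').
split.
  rewrite (_ : (fun t => _) = fun t => (Re c * Re (u t) + (- Im c) * Im (u t)) + Re (v t)).
    by apply: (D _ _) => //; apply: (D _ _); exact: Z.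
  by apply/funext => t; rewrite Re_D Re_M mulNr.
rewrite (_ : (fun t => _) = fun t => (Re c * Im (u t) + Im c * Re (u t)) + Im (v t)).
  by apply: (D _ _) => //; apply: (D _ _); exact: Z.
by apply/funext => t; rewrite Im_D Im_M.
Qed.

Lemma nm_cintegral u : measurable_fun setT u -> cintegrable u ->
  nm (cintegral u) <= \int[mu]_t nm (u t).
Proof.
move=> mu_u iu; have [w w1 ew] := nm_unit_rot (cintegral u).
have c0 : cintegrable (cst (0 : R[i])).
  by split; rewrite [X in mu.-integrable _ X](_ : _ = cst 0%E) //; exact: integrable0.
have I0 : cintegral (cst (0 : R[i])) = 0.
  by rewrite /cintegral /Rintegral !integral0.
have := cintegral_lin w iu c0; rewrite I0 addr0 ew => /(congr1 (@Re R)) /= <-.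
apply: le_ae_Rintegral.
- by have [] := cintegrable_lin w iu c0.
- exact/(cintegrable_nm mu_u).
- apply: aeW => t; rewrite addr0; apply: le_trans (ler_norm _) _.
  by apply: le_trans (Re_le_nm _) _; rewrite nmM w1 mul1r.
Qed.

Definition L1 f := cintegrable f.
Definition I f := cintegral f.

Lemma L1_nm f : L1 f <-> mu.-integrable setT (EFin \o L0abs f).
Proof. exact: cintegrable_nm (L0fun_measurable f). Qed.

Lemma L1_le f g : (\forall t \ae mu, nm (f t) <= nm (g t)) -> L1 g -> L1 f.
Proof. by move=> fg ig; apply: cintegrable_le ig fg; exact: L0fun_measurable. Qed.

Lemma L0_linE c f g : \forall t \ae mu, (c *: f + g : L0 R) t = c * f t + g t.
Proof. by apply: filterS2 (L0_addE (c *: f) g) (L0_scaleE c f) => t -> ->. Qed.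

Lemma L0_subE f g : \forall t \ae mu, (f - g : L0 R) t = f t - g t.
Proof. by apply: filterS2 (L0_addE f (- g)) (L0_oppE g) => t -> ->. Qed.

Lemma measurable_lin c f g : measurable_fun setT (fun t : T => c * f t + g t).
Proof.
apply: measurable_cD; last exact: L0fun_measurable.
by apply: measurable_cM; [exact: measurable_cst|exact: L0fun_measurable].
Qed.

Lemma L1_lin c f g : L1 f -> L1 g -> L1 (c *: f + g).
Proof.
move=> lf lg; apply: cintegrable_ae (L0_linE c f g) _; first exact: L0fun_measurable.
  exact: measurable_lin.
exact: cintegrable_lin.
Qed.

Lemma I_lin c f g : L1 f -> L1 g -> I (c *: f + g) = c * I f + I g.
Proof.
move=> lf lg; rewrite /I -cintegral_lin//.
apply: cintegral_ae (L0_linE c f g); first exact: L0fun_measurable.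
exact: measurable_lin.
Qed.

Lemma I_0 : I 0 = 0.
Proof.
rewrite /I (@cintegral_ae _ _ (cst 0)) ?measurable_cst//.
- by rewrite /cintegral /Rintegral !integral0.
- exact: L0_0E.
Qed.

Lemma L1_0 : L1 0.
Proof.
apply: (cintegrable_ae _ _ (L0_0E R)); [exact: L0fun_measurable|exact: measurable_cst|].
by split; rewrite [X in mu.-integrable _ X](_ : _ = cst 0%E) //; exact: integrable0.
Qed.

Lemma L1_D f g : L1 f -> L1 g -> L1 (f + g).
Proof. by move=> lf lg; rewrite -[f]scale1r; exact: L1_lin. Qed.

Lemma I_D f g : L1 f -> L1 g -> I (f + g) = I f + I g.
Proof. by move=> lf lg; rewrite -[f in LHS]scale1r I_lin// mul1r. Qed.

Lemma L1_Z c f : L1 f -> L1 (c *: f).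
Proof. by move=> lf; rewrite -[_ *: _]addr0; exact: L1_lin L1_0. Qed.

Lemma I_Z c f : L1 f -> I (c *: f) = c * I f.
Proof. by move=> lf; rewrite -[_ *: _]addr0 I_lin//; [rewrite I_0 addr0|exact: L1_0]. Qed.

Lemma nm_I f : L1 f -> nm (I f) <= \int[mu]_t L0abs f t.
Proof. exact: (nm_cintegral (@L0fun_measurable R f)). Qed.

Lemma I_conj f : L1 f -> I (L0conj f) = (I f)^*.
Proof.
move=> [ir ii]; rewrite /I; transitivity (cintegral (fun t => (f t)^*)).
  apply: cintegral_ae (L0conjE f); first exact: L0fun_measurable.
  exact: (measurable_conj (@L0fun_measurable R f)).
rewrite /cintegral /=; congr (_ +i* _)%C.
  by apply: eq_Rintegral => t _; rewrite ReJ.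
transitivity (\int[mu]_t ((-1) * Im (f t))).
  by apply: eq_Rintegral => t _; rewrite ImJ mulN1r.
by rewrite RintegralZl// mulN1r.
Qed.

End circle_integral.

Arguments L2inner : simpl never.
Arguments I : simpl never.
Arguments nm : simpl never.

(** * Inner product, norms and multiplication by bounded functions *)

Section inner_product.
Variable R : realType.
Local Notation mu := (circle_measure R).
Local Notation T := (measurableTypeR R).
Implicit Types (f g h : L0 R) (z w c : R[i]).

Lemma L0_scaleAl c f g : (c *: f) * g = c *: (f * g).
Proof.
apply/L0_eq; apply: filterS (filterI (filterI (L0_mulE (c *: f) g) (L0_mulE f g))
  (filterI (L0_scaleE c f) (L0_scaleE c (f * g)))) => t [[-> e] [-> ->]].
by rewrite e mulrA.
Qed.

Lemma L0_scaleAr c f g : f * (c *: g) = c *: (f * g).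
Proof. by rewrite mulrC L0_scaleAl mulrC. Qed.

Lemma L0conjD f g : L0conj (f + g) = L0conj f + L0conj g.
Proof.
apply/L0_eq; apply: filterS (filterI (filterI (L0_addE f g)
  (L0_addE (L0conj f) (L0conj g))) (filterI (L0conjE (f + g))
  (filterI (L0conjE f) (L0conjE g)))) => t [[e1 ->] [-> [-> ->]]].
by rewrite e1 rmorphD.
Qed.

Lemma L0conjZ c f : L0conj (c *: f) = conjc c *: L0conj f.
Proof.
apply/L0_eq; apply: filterS (filterI (filterI (L0_scaleE c f)
  (L0_scaleE (conjc c) (L0conj f))) (filterI (L0conjE (c *: f)) (L0conjE f)))
  => t [[e1 ->] [-> ->]].
by rewrite e1 rmorphM.
Qed.

Lemma L0conjM f g : L0conj (f * g) = L0conj f * L0conj g.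
Proof.
apply/L0_eq; apply: filterS (filterI (filterI (L0_mulE f g)
  (L0_mulE (L0conj f) (L0conj g))) (filterI (L0conjE (f * g))
  (filterI (L0conjE f) (L0conjE g)))) => t [[e1 ->] [-> [-> ->]]].
by rewrite e1 rmorphM.
Qed.

Lemma L0conjK f : L0conj (L0conj f) = f.
Proof.
apply/L0_eq; apply: filterS2 (L0conjE (L0conj f)) (L0conjE f) => t -> ->.
by rewrite conjcK.
Qed.

Lemma L0conjN f : L0conj (- f) = - L0conj f.
Proof. by rewrite -scaleN1r L0conjZ rmorphN rmorph1 scaleN1r. Qed.

Lemma L0conjB f g : L0conj (f - g) = L0conj f - L0conj g.
Proof. by rewrite L0conjD L0conjN. Qed.

Definition L2 f := Lp 2%:E f.

Lemma L2_0 : L2 0. Proof. exact: Lp2_0. Qed.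

Lemma L2_lin c f g : L2 f -> L2 g -> L2 (c *: f + g).
Proof. exact: Lp2_lin. Qed.

Lemma L2_D f g : L2 f -> L2 g -> L2 (f + g).
Proof. by move=> lf lg; rewrite -[f]scale1r; exact: L2_lin. Qed.

Lemma L2_Z c f : L2 f -> L2 (c *: f).
Proof. by move=> lf; rewrite -[_ *: _]addr0; exact: L2_lin L2_0. Qed.

Lemma L2_N f : L2 f -> L2 (- f).
Proof. by rewrite -scaleN1r; exact: L2_Z. Qed.

Lemma L2_B f g : L2 f -> L2 g -> L2 (f - g).
Proof. by move=> lf lg; apply: L2_D => //; exact: L2_N. Qed.

Lemma L2_sum J (r : seq J) (P : pred J) (F : J -> L0 R) :
  (forall j, P j -> L2 (F j)) -> L2 (\sum_(j <- r | P j) F j).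
Proof. by move=> lF; apply: (big_ind L2) => //; [exact: L2_0|exact: L2_D]. Qed.

Let powE f (t : T) : ((`|(EFin \o L0abs f) t| `^ 2) = (L0abs f t ^+ 2)%:E)%E.
Proof.
rewrite [LHS](poweR_EFin `|L0abs f t| 2); congr EFin.
by rewrite ger0_norm ?L0abs_ge0// powR_mulrn ?L0abs_ge0.
Qed.

Let msq f : measurable_fun setT (fun t => L0abs f t ^+ 2).
Proof. by apply: measurable_funX; exact: measurable_L0abs. Qed.

Lemma L2P f : L2 f <-> mu.-integrable setT (EFin \o (fun t => L0abs f t ^+ 2)).
Proof.
have E : (\int[mu]_t `|(L0abs f t ^+ 2)%:E| =
          'N[mu]_2%:E[EFin \o L0abs f] `^ 2)%E.
  rewrite poweR_Lnorm//; apply: eq_integral => t _.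
  by rewrite powE gee0_abs// lee_fin sqr_ge0.
split=> [lf|/integrableP[_ lf]].
  apply/integrableP; split; first by apply/measurable_EFinP; exact: msq.
  by rewrite [X in (X < _)%E]E; apply: poweR_lty.
by rewrite /L2/Lp/=/finite_norm; apply: (@lty_poweRy _ _ 2) => //; rewrite -E.
Qed.

Lemma L2norm_ge0 f : 0 <= L2norm f.
Proof. by apply: fine_ge0; exact: Lnorm_ge0. Qed.

Lemma L2norm_sqr f : L2 f -> L2norm f ^+ 2 = \int[mu]_t (L0abs f t ^+ 2).
Proof.
move=> lf; rewrite /L2norm -powR_mulrn; last exact: L2norm_ge0.
have Nf : ('N[mu]_2%:E[EFin \o L0abs f] \is a fin_num)%E.
  by rewrite ge0_fin_numE ?Lnorm_ge0.
apply/EFin_inj; rewrite -poweR_EFin fineK// poweR_Lnorm//.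
under eq_integral do rewrite powE.
rewrite /Rintegral fineK//; apply: integrable_fin_num => //.
exact/L2P.
Qed.

Lemma L1_mul f g : L2 f -> L2 g -> L1 (f * g).
Proof.
move=> /L2P lf /L2P lg; apply/L1_nm.
apply: (le_ae_integrable (measurable_L0abs _) (integrableD measurableT lf lg)).
apply: filterS (L0_mulE f g) => t e.
rewrite ger0_norm ?L0abs_ge0// {1}/L0abs e -/(nm _) nmM -/(L0abs f t) -/(L0abs g t).
rewrite -/(nm (f t)) -/(nm (g t)).
have [a0 b0] := (nm_ge0 (f t), nm_ge0 (g t)).
by rewrite /L0abs -/(nm (f t)) -/(nm (g t)); nra.
Qed.

Lemma L2_le f g : (\forall t \ae mu, nm (f t) <= nm (g t)) -> L2 g -> L2 f.
Proof.
move=> fg /L2P lg; apply/L2P; apply: (le_ae_integrable (msq f) lg).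
apply: filterS fg => t fgt; rewrite ger0_norm ?sqr_ge0//.
by rewrite ler_sqr ?nnegrE ?L0abs_ge0.
Qed.

Lemma L2norm_le f g : (\forall t \ae mu, nm (f t) <= nm (g t)) -> L2 g ->
  L2norm f <= L2norm g.
Proof.
move=> fg lg; have lf := L2_le fg lg.
rewrite -ler_sqr ?nnegrE ?L2norm_ge0// !L2norm_sqr//.
apply: le_ae_Rintegral; [exact/L2P|exact/L2P|].
by apply: filterS fg => t fgt; rewrite ler_sqr ?nnegrE ?L0abs_ge0.
Qed.

Lemma L2_conj f : L2 f -> L2 (L0conj f).
Proof. by apply: L2_le; apply: filterS (L0conjE f) => t ->; rewrite nm_conj. Qed.

Local Notation "⟪ f , g ⟫" := (L2inner f g) (format "⟪ f ,  g ⟫").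

Lemma innerE f g : ⟪f, g⟫ = I (f * L0conj g). Proof. by []. Qed.

Lemma L1_inner f g : L2 f -> L2 g -> L1 (f * L0conj g).
Proof. by move=> lf lg; apply: L1_mul => //; exact: L2_conj. Qed.

Lemma inner_lin c f g h : L2 f -> L2 g -> L2 h ->
  ⟪c *: f + g, h⟫ = c * ⟪f, h⟫ + ⟪g, h⟫.
Proof.
by move=> lf lg lh; rewrite !innerE mulrDl L0_scaleAl I_lin//; exact: L1_inner.
Qed.

Lemma inner_conj f g : L2 f -> L2 g -> ⟪g, f⟫ = (⟪f, g⟫)^*.
Proof.
move=> lf lg; rewrite !innerE -I_conj; last exact: L1_inner.
by rewrite L0conjM L0conjK mulrC.
Qed.

Lemma innerDl f g h : L2 f -> L2 g -> L2 h -> ⟪f + g, h⟫ = ⟪f, h⟫ + ⟪g, h⟫.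
Proof. by move=> *; rewrite -[f in LHS]scale1r inner_lin// mul1r. Qed.

Lemma inner0l h : ⟪0, h⟫ = 0.
Proof. by rewrite innerE mul0r I_0. Qed.

Lemma innerZl c f h : L2 f -> L2 h -> ⟪c *: f, h⟫ = c * ⟪f, h⟫.
Proof.
by move=> *; rewrite -[_ *: _]addr0 inner_lin ?inner0l ?addr0//; exact: L2_0.
Qed.

Lemma innerNl f h : L2 f -> L2 h -> ⟪- f, h⟫ = - ⟪f, h⟫.
Proof. by move=> *; rewrite -scaleN1r innerZl// mulN1r. Qed.

Lemma innerBl f g h : L2 f -> L2 g -> L2 h -> ⟪f - g, h⟫ = ⟪f, h⟫ - ⟪g, h⟫.
Proof. by move=> *; rewrite innerDl ?innerNl//; exact: L2_N. Qed.

Lemma innerDr f g h : L2 f -> L2 g -> L2 h -> ⟪f, g + h⟫ = ⟪f, g⟫ + ⟪f, h⟫.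
Proof.
by move=> lf lg lh; rewrite (inner_conj (L2_D lg lh) lf) innerDl// rmorphD (inner_conj lg lf) (inner_conj lh lf).
Qed.

Lemma innerZr c f g : L2 f -> L2 g -> ⟪f, c *: g⟫ = conjc c * ⟪f, g⟫.
Proof.
by move=> lf lg; rewrite (inner_conj (L2_Z c lg) lf) innerZl// rmorphM (inner_conj lg lf).
Qed.

Lemma inner0r f : ⟪f, 0⟫ = 0.
Proof. by rewrite innerE -(scale0r 0) L0conjZ rmorph0 scale0r mulr0 I_0. Qed.

Lemma innerNr f g : L2 f -> L2 g -> ⟪f, - g⟫ = - ⟪f, g⟫.
Proof. by move=> *; rewrite -scaleN1r innerZr// rmorphN rmorph1 mulN1r. Qed.

Lemma innerBr f g h : L2 f -> L2 g -> L2 h -> ⟪f, g - h⟫ = ⟪f, g⟫ - ⟪f, h⟫.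
Proof. by move=> *; rewrite innerDr ?innerNr//; exact: L2_N. Qed.

Lemma inner_suml J (r : seq J) (P : pred J) (F : J -> L0 R) h : L2 h ->
  (forall j, P j -> L2 (F j)) ->
  ⟪\sum_(j <- r | P j) F j, h⟫ = \sum_(j <- r | P j) ⟪F j, h⟫.
Proof.
move=> lh lF; suff [] : L2 (\sum_(j <- r | P j) F j) /\
  ⟪\sum_(j <- r | P j) F j, h⟫ = \sum_(j <- r | P j) ⟪F j, h⟫ by [].
apply: (big_ind2 (fun x y => L2 x /\ ⟪x, h⟫ = y)).
- by split; [exact: L2_0|exact: inner0l].
- by move=> x y x' y' [lx <-] [lx' <-]; split; [exact: L2_D|exact: innerDl].
- by move=> j Pj; split => //; exact: lF.
Qed.

Lemma inner_self f : L2 f -> ⟪f, f⟫ = ((L2norm f) ^+ 2)%:C%C.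
Proof.
move=> lf; have E : \forall t \ae mu, L0fun (f * L0conj f) t = ((L0abs f t) ^+ 2)%:C%C.
  by apply: filterS2 (L0_mulE f (L0conj f)) (L0conjE f) => t -> ->; rewrite mul_conj.
rewrite innerE /I (cintegral_ae _ _ E); last 2 first.
- exact: L0fun_measurable.
- by apply: measurable_Complex; [exact: msq|exact: measurable_cst].
by rewrite /cintegral /= {2}/Rintegral integral0 L2norm_sqr.
Qed.

Lemma nm_inner f g : L2 f -> L2 g -> nm ⟪f, g⟫ <= L2norm f * L2norm g.
Proof.
move=> lf lg; have [z ez] : exists z, z = ⟪f, g⟫ by exists ⟪f, g⟫.
rewrite -ez.
(* Expansion of the squared norm of f - s<f, g>g for real s: a quadratic in s that never becomes
   negative. *)
have key (s : R) : 0 <= L2norm f ^+ 2 - 2 * s * nm z ^+ 2 + s ^+ 2 * nm z ^+ 2 * L2norm g ^+ 2.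
  pose c := (s%:C)%C * z.
  have l1 : L2 (c *: g) by exact: L2_Z.
  have := inner_self (L2_B lf l1).
  rewrite innerBl ?innerBr ?innerZl ?innerZr//; last exact: L2_B.
  rewrite (inner_conj lf lg) -ez !inner_self// /c.
  have := sqr_ge0 (L2norm (f - c *: g)).
  rewrite -/c; move: (L2norm (f - _)) (L2norm f) (L2norm g) => N F G N0.
  move=> /(congr1 (@Re R)) /=.
  rewrite [RHS]/= => e; rewrite -e in N0; move: N0; rewrite sqr_nm.
  rewrite /c; clear e l1; clear c; clear ez; case: z => a b /= h.
  by apply: le_trans h _; rewrite le_eqVlt; apply/orP; left; apply/eqP; ring.
have [[F0 G0] z0] := (L2norm_ge0 f, L2norm_ge0 g, nm_ge0 z).
move: key F0 G0 z0; move: (L2norm f) (L2norm g) (nm z) => F G a key F0 G0 a0.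
rewrite leNgt; apply/negP => FGa.
have a1 : 0 < a by apply: le_lt_trans FGa; exact: mulr_ge0.
have [G0'|Gn] := eqVneq G 0.
  (* For a null [g] the polynomial is affine in s, and this value of s makes it equal to -1. *)
  have := key ((F ^+ 2 + 1) / (2 * a ^+ 2)); rewrite G0' expr0n mulr0 addr0.
  have -> : 2 * ((F ^+ 2 + 1) / (2 * a ^+ 2)) * a ^+ 2 = F ^+ 2 + 1.
    by field; rewrite gt_eqF.
  by lra.
have G1 : 0 < G by rewrite lt_def Gn.
(* The minimizer of the quadratic. *)
have := key (G ^- 2).
have -> : F ^+ 2 - 2 * G ^- 2 * a ^+ 2 + (G ^- 2) ^+ 2 * a ^+ 2 * G ^+ 2 = F ^+ 2 - (a / G) ^+ 2.
  by field.
rewrite subr_ge0 ler_sqr ?nnegrE ?divr_ge0// ler_pdivrMr//.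
by move=> /(lt_le_trans FGa); rewrite ltxx.
Qed.

Lemma L2normZ c f : L2 f -> L2norm (c *: f) = nm c * L2norm f.
Proof.
move=> lf; apply/EFin_inj; rewrite EFinM /L2norm !fineK ?Lnorm2_L0absZ//.
- by rewrite ge0_fin_numE ?Lnorm_ge0.
- by rewrite -Lnorm2_L0absZ// ge0_fin_numE ?Lnorm_ge0//; exact: (L2_Z c lf).
Qed.

Lemma L2normD f g : L2 f -> L2 g -> L2norm (f + g) <= L2norm f + L2norm g.
Proof.
move=> lf lg; rewrite -lee_fin EFinD /L2norm !fineK ?Lnorm2_L0absD//;
  rewrite ge0_fin_numE ?Lnorm_ge0//; exact: (L2_D lf lg).
Qed.

Lemma L2normN f : L2 f -> L2norm (- f) = L2norm f.
Proof. by move=> lf; rewrite -scaleN1r L2normZ// nmN /nm normr1 mul1r. Qed.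

Lemma L2norm0 : L2norm 0 = 0 :> R.
Proof. by rewrite -(scale0r 0) L2normZ ?nm0 ?mul0r//; exact: L2_0. Qed.

Lemma L2norm_eq0 f : L2 f -> L2norm f = 0 -> f = 0.
Proof.
move=> lf f0; apply/L0_eq.
have /Lnorm_eq0_eq0 : ('N[mu]_2%:E[EFin \o L0abs f] = 0)%E.
  by rewrite -(@fineK _ ('N[mu]_2%:E[EFin \o L0abs f])%E) -?/(L2norm f) ?f0//
    ge0_fin_numE ?Lnorm_ge0.
have mx : measurable_fun setT (EFin \o L0abs f).
  by apply/measurable_EFinP; exact: measurable_L0abs.
have p2 : (0 < 2%:E :> \bar R)%E by rewrite lte_fin.
move=> /(_ mx p2) xe.
apply: filterS2 xe (L0_0E R) => t /(_ Logic.I) /= [xt] ->.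
exact: nm_eq0.
Qed.

Lemma pythagoras f g : L2 f -> L2 g -> ⟪f, g⟫ = 0 ->
  L2norm (f + g) ^+ 2 = L2norm f ^+ 2 + L2norm g ^+ 2.
Proof.
move=> lf lg fg; apply: (@complexI R).
rewrite rmorphD/= -!inner_self//; last exact: L2_D.
rewrite innerDl ?innerDr//; last exact: L2_D.
by rewrite fg [in ⟪g, f⟫]inner_conj// fg rmorph0 addr0 add0r.
Qed.

Lemma inner_mull f g h : ⟪f * g, h⟫ = ⟪g, L0conj f * h⟫.
Proof. by rewrite !innerE L0conjM L0conjK mulrA [f * g]mulrC. Qed.

Definition bnd (M : R) f := \forall t \ae mu, nm (f t) <= M.

Lemma mu_setT_gt0 : (0 < mu setT)%E.
Proof.
rewrite /circle_measure/= /mrestr/= setTI lebesgue_measure_itv/= lte_fin.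
by rewrite mulrn_wgt0 ?pi_gt0// oppr0 adde0 lte_fin mulrn_wgt0 ?pi_gt0.
Qed.

Lemma LinfP f : Lp +oo%E f <-> exists2 M, 0 <= M & bnd M f.
Proof.
rewrite /Lp/=/finite_norm unlock mu_setT_gt0; split=> [h|[M M0 bM]].
  (* The maximum with 0 supplies the lower bound needed for [fine] to be applied to a finite
     value. *)
  exists (fine (maxe 0%E (ess_sup mu (abse \o (EFin \o L0abs f))))%E).
    by apply: fine_ge0; rewrite le_max lexx.
  have fn : (maxe 0%E (ess_sup mu (abse \o (EFin \o L0abs f))) \is a fin_num)%E.
    by rewrite ge0_fin_numE ?le_max ?lexx// gt_max h ltry.
  apply: filterS (ess_sup_ge mu (abse \o (EFin \o L0abs f))) => t /= ht.
  rewrite -lee_fin fineK// le_max; apply/orP; right; apply: le_trans ht.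
  by rewrite lee_fin ler_norm.
apply: le_lt_trans (ltry M); apply/ess_supP; apply: filterS bM => t /=.
by rewrite lee_fin ger0_norm ?L0abs_ge0.
Qed.

Lemma ae_exists (P : T -> Prop) : (\forall t \ae mu, P t) -> exists t, P t.
Proof.
move=> aP; apply: contrapT => /forallNP nP.
have : mu setT = 0%E.
  apply/negligibleP => //; case: aP => A [mA A0 PA]; exists A; split => //.
  by move=> t _; apply: PA => /= /nP.
by move=> e; have := mu_setT_gt0; rewrite e ltxx.
Qed.

Lemma bnd_ge0 M f : bnd M f -> 0 <= M.
Proof. by move=> /ae_exists[t]; exact/le_trans/nm_ge0. Qed.

Lemma bnd_mono M N f : M <= N -> bnd M f -> bnd N f.
Proof. by move=> MN; apply: filterS => t /le_trans; exact. Qed.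

Lemma bndD M N f g : bnd M f -> bnd N g -> bnd (M + N) (f + g).
Proof.
move=> bf bg; apply: filterS3 (L0_addE f g) bf bg => t -> ft gt.
by apply: le_trans (nmD _ _) _; exact: lerD.
Qed.

Lemma bndZ M c f : bnd M f -> bnd (nm c * M) (c *: f).
Proof.
move=> bf; apply: filterS2 (L0_scaleE c f) bf => t -> ft.
by rewrite nmM ler_wpM2l ?nm_ge0.
Qed.

Lemma bndN M f : bnd M f -> bnd M (- f).
Proof. by apply: filterS2 (L0_oppE f) => t ->; rewrite nmN. Qed.

Lemma bndB M N f g : bnd M f -> bnd N g -> bnd (M + N) (f - g).
Proof. by move=> bf bg; apply: bndD => //; exact: bndN. Qed.

Lemma bnd_conj M f : bnd M f -> bnd M (L0conj f).
Proof. by apply: filterS2 (L0conjE f) => t ->; rewrite nm_conj. Qed.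

Lemma bndM M N f g : bnd M f -> bnd N g -> bnd (M * N) (f * g).
Proof.
move=> bf bg; apply: filterS3 (L0_mulE f g) bf bg => t -> ft gt.
by rewrite nmM ler_pM ?nm_ge0.
Qed.

Lemma bnd0 : bnd 0 0.
Proof. by apply: filterS (L0_0E R) => t ->; rewrite nm0. Qed.

Lemma bnd1 : bnd 1 1.
Proof. by apply: filterS (L0_1E R) => t ->; rewrite /nm normr1. Qed.

Lemma bnd_eq0 f : (forall e, 0 < e -> bnd e f) -> f = 0.
Proof.
move=> bf; apply/L0_eq.
have : \forall t \ae mu, forall n : nat, nm (f t) <= n.+1%:R^-1.
  by apply/ae_foralln => n; apply: bf; rewrite invr_gt0.
apply: filterS2 (L0_0E R) => t -> ft; apply: nm_eq0.
apply/eqP; rewrite eq_le nm_ge0 andbT; apply/ler_addgt0Pr => e e0.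
have [n _ en] := near_infty_natSinv_lt (PosNum e0).
by rewrite add0r; apply: le_trans (ft n) (ltW (en n _)) => /=.
Qed.

Lemma L2_bndM M f g : bnd M f -> L2 g ->
  L2 (f * g) /\ L2norm (f * g) <= M * L2norm g.
Proof.
move=> bf lg; have M0 := bnd_ge0 bf.
have fg : \forall t \ae mu, nm (L0fun (f * g) t) <= nm (L0fun (M%:C%C *: g) t).
  apply: filterS3 (L0_mulE f g) (L0_scaleE M%:C%C g) bf => t -> -> ft.
  by rewrite !nmM nm_real ger0_norm// ler_wpM2r ?nm_ge0.
have lM : L2 (M%:C%C *: g) by exact: L2_Z.
split; first exact: L2_le lM.
by apply: le_trans (L2norm_le fg lM) _; rewrite L2normZ// nm_real ger0_norm.
Qed.

Lemma L1_bndM M f g : bnd M f -> L1 g -> L1 (f * g).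
Proof.
move=> bf lg; have M0 := bnd_ge0 bf.
apply: L1_le (L1_Z M%:C%C lg).
apply: filterS3 (L0_mulE f g) (L0_scaleE M%:C%C g) bf => t -> -> ft.
by rewrite !nmM nm_real ger0_norm// ler_wpM2r ?nm_ge0.
Qed.

Lemma L2_1 : L2 1.
Proof.
apply/L2P; apply: (@le_ae_integrable _ _ (cst 1)) => //.
  apply/integrableP; split; first by apply/measurable_EFinP; exact: measurable_cst.
  rewrite (eq_integral (cst 1%E)) => [|t _]; last by rewrite /= normr1.
  by rewrite integral_cst// mul1e -ge0_fin_numE ?circle_measure_fin.
apply: filterS (L0_1E R) => t e; rewrite /L0abs e normr1 expr1n normr1//.
Qed.

Lemma L2_bnd M f : bnd M f -> L2 f.
Proof. by move=> bf; have [] := L2_bndM bf L2_1; rewrite mulr1. Qed.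

Lemma L2_L1 f : L2 f -> L1 f.
Proof. by move=> lf; rewrite -[f]mulr1; apply: L1_mul => //; exact: L2_1. Qed.

End inner_product.

(** * Trigonometric polynomials and Fejer means *)

Section fourier.
Variable R : realType.
Local Notation mu := (circle_measure R).
Local Notation T := (measurableTypeR R).
Local Notation twopi := (pi *+ 2 : R).
Local Notation "⟪ f , g ⟫" := (L2inner f g) (format "⟪ f ,  g ⟫").
Implicit Types (f g h p : L0 R) (z w c : R[i]) (m n : int).

Lemma twopi_gt0 : 0 < twopi. Proof. by rewrite mulrn_wgt0 ?pi_gt0. Qed.

Lemma ae_circle : {ae mu, forall t : T, 0 < (t : R) < twopi}.
Proof.
exists [set t : T | ~~ (0 < t < twopi)]; split => //.
- rewrite [X in measurable X](_ : _ = ~` `]0, twopi[%classic).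
    exact: measurableC (measurable_itv _).
  by apply/seteqP; split => t /=; rewrite in_itv/= => /negP.
- rewrite /circle_measure/= /mrestr.
  apply: (@subset_measure0 _ _ _ (@lebesgue_measure R) _ ([set 0] `|` [set twopi])).
  + apply: measurableI => //.
    rewrite [X in measurable X](_ : _ = ~` `]0, twopi[%classic).
      exact: measurableC (measurable_itv _).
    by apply/seteqP; split => t /=; rewrite in_itv/= => /negP.
  + by apply: measurableU; exact: measurable_set1.
  + move=> t /= [/negP ntu]; rewrite in_itv/= => /andP[t0 tu].
    move: t0 tu; rewrite !le_eqVlt => /orP[/eqP ->|t0]; first by left.
    by move=> /orP[/eqP ->|tu]; [right|rewrite t0 tu in ntu].
  + by apply: (@null_set_setU _ _ _ (@lebesgue_measure R)) => //; exact: lebesgue_measure_set1.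
- by move=> t /= /negP.
Qed.

Lemma ae_circle_le : {ae mu, forall t : T, 0 <= (t : R) <= twopi}.
Proof. by apply: filterS ae_circle => t /andP[/ltW -> /ltW ->]. Qed.

Lemma circle_integralE (f : T -> \bar R) : measurable_fun setT f ->
  (\int[mu]_t f t = \int[@lebesgue_measure R]_(t in `[0%R, twopi]) f t)%E.
Proof.
move=> mf; transitivity (\int[mu]_(t in `[0%R, twopi]) f t)%E.
  rewrite [RHS]integral_mkcond; apply: ae_eq_integral => //.
    by apply/(measurable_restrictT _ _).1 => //; exact: measurable_funTS.
  apply: filterS ae_circle_le => t tu _; rewrite patchE.
  by rewrite mem_set//= in_itv.
apply: eq_measure_integral => A mA A01.
by rewrite /circle_measure/= /mrestr setIidl.
Qed.

Lemma nm_cexp (x : R) : nm (cexp x) = 1.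
Proof. by rewrite /nm normc_def/= cos2Dsin2 sqrtr1. Qed.

Lemma cexpD (x y : R) : cexp (x + y) = cexp x * cexp y.
Proof. by rewrite /cexp cosD sinD; simpc; congr (_ +i* _)%C; rewrite addrC. Qed.

Lemma cexp0 : cexp 0 = 1 :> R[i].
Proof. by rewrite /cexp cos0 sin0. Qed.

Lemma cexpN (x : R) : cexp (- x) = (cexp x)^*.
Proof. by rewrite /cexp cosN sinN. Qed.

Lemma cexpX (x : R) k : cexp (k%:R * x) = cexp x ^+ k.
Proof.
elim: k => [|k ih]; first by rewrite mul0r cexp0.
by rewrite -natr1 mulrDl mul1r cexpD ih exprSr.
Qed.

Lemma cexp_per m : cexp (m%:~R * twopi) = 1.
Proof.
have e1 : cexp twopi = 1 by rewrite /cexp cos2pi sin2pi.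
case: m => k; first by rewrite cexpX e1 expr1n.
by rewrite NegzE mulNr cexpN cexpX e1 expr1n rmorph1.
Qed.

Lemma chiE m : \forall t \ae mu, L0fun (chi R m) t = cexp (m%:~R * t).
Proof. exact: L0classE. Qed.

Lemma chiM m n : chi R m * chi R n = chi R (m + n).
Proof.
apply/L0_eq; apply: filterS (filterI (filterI (L0_mulE (chi R m) (chi R n)) (chiE m))
  (filterI (chiE n) (chiE (m + n)))) => t [[-> ->] [-> ->]].
by rewrite -cexpD -mulrDl -rmorphD.
Qed.

Lemma chi0 : chi R 0 = 1.
Proof.
by apply/L0_eq; apply: filterS2 (chiE 0) (L0_1E R) => t -> ->; rewrite mul0r cexp0.
Qed.

Lemma chi_conj m : L0conj (chi R m) = chi R (- m).
Proof.
apply/L0_eq; apply: filterS3 (L0conjE (chi R m)) (chiE m) (chiE (- m)) => t -> -> ->.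
by rewrite -cexpN -mulNr -rmorphN.
Qed.

Lemma chiK m : chi R m * chi R (- m) = 1.
Proof. by rewrite chiM subrr chi0. Qed.

Lemma bnd_chi m : bnd 1 (chi R m).
Proof. by apply: filterS (chiE m) => t ->; rewrite nm_cexp. Qed.

Lemma L2_chi m : L2 (chi R m). Proof. exact: L2_bnd (bnd_chi m). Qed.

Lemma L2_mulchi m f : L2 f -> L2 (f * chi R m).
Proof. by rewrite mulrC => lf; have [] := L2_bndM (bnd_chi m) lf. Qed.

Lemma L2norm_mulchi m f : L2 f -> L2norm (f * chi R m) = L2norm f.
Proof.
move=> lf; apply/eqP; rewrite eq_le; apply/andP; split.
  by have [_] := L2_bndM (bnd_chi m) lf; rewrite mul1r mulrC.
have [_] := L2_bndM (bnd_chi (- m)) (L2_mulchi m lf).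
by rewrite mul1r mulrC -mulrA chiK mulr1.
Qed.

Let deriv_itv (F f : R -> R) : (forall x : R, is_derive x 1 F (f x)) ->
  continuous f -> F twopi = F 0 -> measurable_fun setT f ->
  \int[mu]_t (f t) = 0.
Proof.
move=> dF cf FE mf; rewrite /Rintegral circle_integralE; last exact/measurable_EFinP.
have cF : continuous F.
  move=> x; apply: differentiable_continuous; apply/derivable1_diffP.
  by have [] := dF x.
rewrite (@continuous_FTC2 _ f F 0 twopi).
- by rewrite FE -EFinD subrr.
- exact: twopi_gt0.
- exact: continuous_subspaceT.
- split=> [x _||]; first by have [] := dF x.
  + by apply: cvg_at_right_filter; exact: cF.
  + by apply: cvg_at_left_filter; exact: cF.
- by move=> x _; rewrite derive1E; have [_ ->] := dF x.
Qed.

Lemma I_chi m : I (chi R m) = if m == 0 then twopi%:C%C else 0.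
Proof.
have [->|m0] := eqVneq.
  rewrite chi0 /I (cintegral_ae _ _ (L0_1E R)); last 2 first.
  - exact: L0fun_measurable.
  - exact: measurable_cst.
  rewrite /cintegral /= {2}/Rintegral integral0 /=; congr (_ +i* _)%C.
  rewrite Rintegral_cst// mul1r /circle_measure/= /mrestr/= setTI.
  by rewrite lebesgue_measure_itv/= lte_fin twopi_gt0 oppr0 adde0.
rewrite /I (cintegral_ae _ _ (chiE m)); last 2 first.
- exact: L0fun_measurable.
- exact: measurable_chi.
have mr0 : m%:~R != 0 :> R by rewrite intr_eq0.
have lin (x : R) : is_derive x 1 (fun y => m%:~R * y) (m%:~R).
  have := @is_deriveZ R R R (fun y : R => y) (m%:~R : R) x 1 1 (is_derive_id x 1).
  by rewrite [_%:A]mulr1.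
have cm (x : R) : continuous (fun y : R => m%:~R * y).
  by move=> y; apply: cvgM; [exact: cvg_cst|exact: cvg_id].
have sper : sin (m%:~R * twopi) = 0 by have := congr1 (@Im R) (cexp_per m).
have cper : cos (m%:~R * twopi) = 1 by have := congr1 (@Re R) (cexp_per m).
have mc := @measurable_chi R m.
have mcos : measurable_fun setT (fun t : T => cos (m%:~R * (t : R))).
  exact: measurable_ReP mc.
have msin : measurable_fun setT (fun t : T => sin (m%:~R * (t : R))).
  exact: measurable_ImP mc.
rewrite /cintegral /=.
have -> : \int[mu]_t cos (m%:~R * (t : R)) = 0.
  apply: (@deriv_itv (fun t => m%:~R^-1 * sin (m%:~R * t))) => //.
  - move=> x; have d := is_derive1_comp (is_derive_sin _) (lin x).
    apply: (is_derive_eq (@is_deriveZ R R R (fun t => sin (m%:~R * t)) (m%:~R^-1) x 1 _ d)).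
    by rewrite /GRing.scale/=; field.
  - move=> x; apply: (@continuous_comp _ _ _ (fun y : R => m%:~R * y)); first exact: cm.
    exact: continuous_cos.
  - by rewrite sper !mulr0 sin0 mulr0.
have -> : \int[mu]_t sin (m%:~R * (t : R)) = 0.
  apply: (@deriv_itv (fun t => - m%:~R^-1 * cos (m%:~R * t))) => //.
  - move=> x; have d := is_derive1_comp (is_derive_cos _) (lin x).
    apply: (is_derive_eq (@is_deriveZ R R R (fun t => cos (m%:~R * t)) (- m%:~R^-1) x 1 _ d)).
    by rewrite /GRing.scale/=; field.
  - move=> x; apply: (@continuous_comp _ _ _ (fun y : R => m%:~R * y)); first exact: cm.
    exact: continuous_sin.
  - by rewrite cper mulr0 cos0.
by [].
Qed.

Lemma inner_chi m n : ⟪chi R m, chi R n⟫ = if m == n then twopi%:C%C else 0.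
Proof. by rewrite innerE chi_conj chiM I_chi subr_eq0. Qed.

Lemma L2norm_chi m : L2norm (chi R m) ^+ 2 = twopi.
Proof.
by apply: (@complexI R); rewrite -inner_self ?inner_chi ?eqxx//; exact: L2_chi.
Qed.

Definition tpol (s : seq (R[i] * int)) : L0 R := \sum_(p <- s) p.1 *: chi R p.2.
Definition tpolf (s : seq (R[i] * int)) (t : R) : R[i] :=
  \sum_(p <- s) p.1 * cexp (p.2%:~R * t).

Lemma tpolE s : \forall t \ae mu, L0fun (tpol s) t = tpolf s t.
Proof.
elim: s => [|p s ih].
  by apply: filterS (L0_0E R) => t; rewrite /tpol /tpolf !big_nil.
rewrite /tpol /tpolf big_cons.
apply: filterS3 ih (L0_linE p.1 (chi R p.2) (tpol s)) (chiE p.2) => t e1 e2 e3.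
by rewrite e2 e3 e1 big_cons.
Qed.

Lemma bnd_tpol s : exists M, bnd M (tpol s).
Proof.
elim: s => [|p s [M bM]]; first by exists 0; rewrite /tpol big_nil; exact: bnd0.
exists (nm p.1 * 1 + M); rewrite /tpol big_cons; apply: bndD => //.
exact/bndZ/bnd_chi.
Qed.

Lemma L2_tpol s : L2 (tpol s).
Proof. by have [M] := bnd_tpol s; exact: L2_bnd. Qed.

(* [|dirichlet n t|^2 / (2 pi n)] is the Fejer kernel centred at [t]. *)
Definition dirichlet (n : nat) (t : R) : L0 R :=
  \sum_(j < n) cexp (j%:R * t) *: chi R (- j%:Z).

Lemma L2_dirichlet (n : nat) t : L2 (dirichlet n t).
Proof. by apply: L2_sum => j _; exact/L2_Z/L2_chi. Qed.

Lemma dirichletE (n : nat) t : \forall s \ae mu,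
  L0fun (dirichlet n t) s = \sum_(j < n) cexp (t - s) ^+ j.
Proof.
elim: n => [|n ih].
  by apply: filterS (L0_0E R) => s; rewrite /dirichlet !big_ord0.
rewrite /dirichlet big_ord_recr /= addrC.
apply: filterS3 ih (L0_linE (cexp (n%:R * t)) (chi R (- n%:Z)) (dirichlet n t)) (chiE (- n%:Z)) => s e1 e2 e3.
rewrite e2 e3 e1 big_ord_recr /= addrC; congr (_ + _).
by rewrite rmorphN/= mulNr -cexpD -mulrN -mulrDr cexpX.
Qed.

Lemma dirichlet_inner (n : nat) t f : L1 f ->
  I (f * (dirichlet n t * L0conj (dirichlet n t))) =
  \sum_(j < n) \sum_(k < n) cexp ((j%:Z - k%:Z)%:~R * t) * I (f * chi R (k%:Z - j%:Z)).
Proof.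
move=> lf; have -> : dirichlet n t * L0conj (dirichlet n t) =
    \sum_(j < n) \sum_(k < n) cexp ((j%:Z - k%:Z)%:~R * t) *: chi R (k%:Z - j%:Z).
  rewrite /dirichlet big_distrl /=; apply: eq_bigr => j _.
  rewrite (big_morph _ (@L0conjD R) (_ : L0conj 0 = 0)); last first.
    by rewrite -[X in L0conj X](scale0r 0) L0conjZ rmorph0 scale0r.
  rewrite big_distrr /=; apply: eq_bigr => k _.
  rewrite L0conjZ chi_conj opprK L0_scaleAl L0_scaleAr scalerA chiM.
  rewrite -cexpN -cexpD [(- _ + _)%R]addrC; congr (cexp _ *: _).
  by rewrite rmorphB/= mulrBl.
have li k : L1 (f * chi R k) by rewrite mulrC; exact: L1_bndM (bnd_chi k) lf.
have lin (J : Type) (r : seq J) (F : J -> L0 R) (G : J -> R[i]) :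
    (forall j, L1 (f * F j) /\ I (f * F j) = G j) ->
    L1 (f * \sum_(j <- r) F j) /\ I (f * \sum_(j <- r) F j) = \sum_(j <- r) G j.
  move=> FG; apply: (big_ind2 (fun x y => L1 (f * x) /\ I (f * x) = y)) => //.
  - by rewrite mulr0 I_0; split => //; exact: L1_0.
  - move=> x1 x2 y1 y2 [l1 <-] [l2 <-]; rewrite mulrDr I_D//; split => //.
    exact: L1_D.
have H (j : 'I_n) : L1 (f * \sum_(k < n) cexp ((j%:Z - k%:Z)%:~R * t) *: chi R (k%:Z - j%:Z)) /\
    I (f * \sum_(k < n) cexp ((j%:Z - k%:Z)%:~R * t) *: chi R (k%:Z - j%:Z)) =
    \sum_(k < n) cexp ((j%:Z - k%:Z)%:~R * t) * I (f * chi R (k%:Z - j%:Z)).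
  apply: lin => k; rewrite L0_scaleAr I_Z//; split => //; exact: L1_Z.
by have [_ ->] := lin _ (index_enum 'I_n) _ _ H.
Qed.

Lemma L2norm_dirichlet (n : nat) t : L2norm (dirichlet n t) ^+ 2 = n%:R * twopi.
Proof.
apply: (@complexI R); rewrite -inner_self; last exact: L2_dirichlet.
rewrite innerE -[_ * L0conj _]mul1r dirichlet_inner; last exact/L2_L1/L2_1.
under eq_bigr => j _.
  rewrite (bigD1 j)//= big1 => [|k kj].
    rewrite subrr mul0r cexp0 mul1r mul1r I_chi eqxx addr0.
    over.
  rewrite mul1r I_chi subr_eq0 (_ : _ == _ = false) ?mulr0//.
  by rewrite eqz_nat; exact/negbTE.
by rewrite sumr_const card_ord rmorphM/= rmorph_nat mulr_natl.
Qed.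

(** The Fejer mean as an uncollected double sum: a frequency m with |m| < n occurs n - |m| times,
    which produces the Cesaro weights 1 - |m|/n. *)
Definition fejer_seq (n : nat) f : seq (R[i] * int) :=
  [seq ((((n%:R * twopi)^-1)%:C)%C * I (f * chi R (k%:Z - j%:Z)), j%:Z - k%:Z)
     | j <- iota 0 n, k <- iota 0 n].

Lemma fejer_inner (n : nat) f t : L1 f -> tpolf (fejer_seq n f) t =
  ((n%:R * twopi)^-1)%:C%C * ⟪f * dirichlet n t, dirichlet n t⟫.
Proof.
move=> lf; rewrite innerE -mulrA dirichlet_inner//.
rewrite /tpolf /fejer_seq big_allpairs_dep/= mulr_sumr.
have -> : iota 0 n = index_iota 0 n by rewrite /index_iota subn0.
rewrite big_mkord; apply: eq_bigr => j _.
rewrite mulr_sumr big_mkord; apply: eq_bigr => k _.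
by rewrite mulrAC mulrA.
Qed.

(** For n > 0 the mean is <f D, D> / |D|^2 with D the Dirichlet sum, so it is an average of [f];
    Cauchy-Schwarz suffices. *)
Lemma fejer_bnd (n : nat) f M t : bnd M f -> nm (tpolf (fejer_seq n f) t) <= M.
Proof.
move=> bf; have M0 := bnd_ge0 bf.
rewrite fejer_inner; last exact/L2_L1/(L2_bnd bf).
case: n => [|n].
  by rewrite mul0r invr0 mul0r nm0.
have n0 : 0 < n.+1%:R * twopi by rewrite mulr_gt0 ?twopi_gt0.
rewrite nmM nm_real ger0_norm ?invr_ge0 ?(ltW n0)// ler_pdivrMl//.
have lD := L2_dirichlet n.+1 t.
have [lfD le] := L2_bndM bf lD.
apply: le_trans (nm_inner lfD lD) _.
rewrite mulrC -[n.+1%:R * _](L2norm_dirichlet n.+1 t) expr2 -mulrA.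
by rewrite ler_wpM2l ?L2norm_ge0 ?[_ * M]mulrC.
Qed.

End fourier.

(** * Uniform convergence of Fejer means of continuous periodic functions *)

Section fejer_approximation.
Variable R : realType.
Local Notation mu := (circle_measure R).
Local Notation T := (measurableTypeR R).
Local Notation twopi := (pi *+ 2 : R).
Implicit Types (f h p : L0 R) (z w c : R[i]).

Lemma continuous_nmP (g : R -> R[i]^o) : continuous g <->
  forall (x : R) (e : R), 0 < e -> \forall y \near x, nm (g x - g y) < e.
Proof.
split=> [cg x e e0|cg x].
  have ec0 : (0 : R[i]) < e%:C by rewrite ltcR.
  have /cvgrPdist_lt /(_ _ ec0) := cg x; apply: filterS => y.
  by rewrite normC_nm ltcR.
apply/cvgrPdist_lt => e; rewrite ltcE /= => /andP[/eqP ie re].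
apply: filterS (cg x _ re) => y.
by rewrite normC_nm => h; rewrite ltcE/= ie eqxx.
Qed.

Lemma near_abs (x : R) (P : R -> Prop) :
  (\forall y \near x, P y) <-> exists2 d : R, 0 < d & forall y, `|x - y| < d -> P y.
Proof.
split; first by move=> /nbhs_normP[d d0 dP]; exists d => // y; exact: dP.
by move=> [d d0 dP]; apply/nbhs_normP; exists d => // y; exact: dP.
Qed.

(** Only x is confined to the segment. The point y may leave it, which is needed where the circle
    closes up: [circle_modulus] takes y to be a translate by 2 pi. *)
Lemma unif_segment (g : R -> R[i]^o) (e : R) : continuous g -> 0 < e ->
  exists2 d : R, 0 < d & forall x y : R, 0 <= x <= twopi -> `|x - y| < d -> nm (g x - g y) < e.
Proof.
move=> /continuous_nmP cg e0.
have /compact_near_coveringP/(_ R (0^'+) (fun (d : R) (x : R) =>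
  forall y : R, `|x - y| < d -> nm (g x - g y) < e)) := @segment_compact R 0 twopi.
case.
- move=> x _; have e2 : 0 < e / 2 by rewrite divr_gt0.
  have /near_abs[d d0 dP] := cg x _ e2.
  exists ([set y : R | `|x - y| < d / 2], [set s : R | 0 < s < d / 2]) => /=.
    split.
      by apply/near_abs; exists (d / 2) => //; rewrite divr_gt0.
    near=> s; apply/andP; split; near: s; first exact: nbhs_right_gt.
    by apply: nbhs_right_lt; rewrite divr_gt0.
  move=> [x' s] /= [xx' /andP[s0 sd]] y x'y.
  rewrite (_ : g x' - g y = (g x' - g x) + (g x - g y)); last by rewrite addrA subrK.
  apply: le_lt_trans (nmD _ _) _; rewrite [e]splitr ltrD//.
    rewrite nmBC; apply: dP; apply: lt_trans xx' _.
    by rewrite ltr_pdivrMr// ltr_pMr// ltr1n.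
  apply: dP; rewrite (_ : x - y = (x - x') + (x' - y)); last by rewrite addrA subrK.
  apply: le_lt_trans (ler_normD _ _) _; rewrite [d]splitr ltrD//.
  exact: lt_trans x'y sd.
- move=> /= d d0 dA; exists (d / 2) => [|x y x01]; first by rewrite divr_gt0.
  apply: dA; rewrite /= ?divr_gt0 ?in_itv//.
  by rewrite sub0r normrN gtr0_norm ?divr_gt0// ltr_pdivrMr// ltr_pMr// ltr1n.
Unshelve. all: by end_near. Qed.

Lemma bounded_segment (g : R -> R[i]^o) : continuous g ->
  exists2 M : R, 0 <= M & forall x : R, 0 <= x <= twopi -> nm (g x) <= M.
Proof.
move=> /continuous_nmP cg.
have /compact_near_coveringP/(_ R +oo (fun (M : R) (x : R) =>
  nm (g x) <= M)) := @segment_compact R 0 twopi.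
case.
- move=> x _; have /near_abs[d d0 dP] := cg x 1 ltr01.
  exists ([set y : R | `|x - y| < d], [set M : R | nm (g x) + 1 < M]) => /=.
    split; first by apply/near_abs; exists d.
    by exists (nm (g x) + 1); split => //; rewrite num_real.
  move=> [x' M] /= [xx' xM].
  rewrite (_ : g x' = g x + (g x' - g x)); last by rewrite addrC subrK.
  apply: le_trans (nmD _ _) _; apply: le_trans (ltW xM).
  by rewrite lerD2l nmBC ltW// dP.
- move=> M [_ MP]; exists (`|M| + 1); first by rewrite addr_ge0.
  move=> x x01; apply: MP; last by rewrite /= in_itv.
  by rewrite (le_lt_trans (ler_norm _))// ltrDl.
Qed.

Lemma nm_1Bcexp (u : R) : nm (1 - cexp u) ^+ 2 = 2 - 2 * cos u.
Proof.
rewrite sqr_nm /cexp /= sub0r sqrrN.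
have -> : (1 - cos u) ^+ 2 + sin u ^+ 2 = 2 - 2 * cos u + (cos u ^+ 2 + sin u ^+ 2 - 1) by ring.
by rewrite cos2Dsin2 subrr addr0.
Qed.

Lemma cos_le_mid (d u : R) : 0 < d -> d <= u -> u <= twopi - d -> cos u <= cos d.
Proof.
move=> d0 du ud; have d_pi : d <= pi.
  by have := le_trans du ud; rewrite -subr_ge0 mulr2n => h; lra.
have [upi|piu] := leP u pi.
  rewrite leNgt ltr_cos ?in_itv/= ?(ltW d0)//; last by rewrite upi (le_trans (ltW d0)).
  by rewrite -leNgt.
have -> : cos u = cos (twopi - u).
  by rewrite cosB cos2pi sin2pi mul1r mul0r addr0.
rewrite leNgt ltr_cos ?in_itv/= ?(ltW d0)//; last first.
  rewrite mulr2n in ud *; apply/andP; split; lra.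
by rewrite -leNgt; lra.
Qed.

Lemma periodicB (g : R -> R[i]) t : periodic g twopi -> g (t - twopi) = g t.
Proof. by move=> pg; rewrite -pg subrK. Qed.

(* Korovkin-type bound: the modulus of continuity of [g] is controlled by a
   test function whose Fejer means are computable. *)
Lemma circle_modulus (g : R -> R[i]^o) (e : R) : continuous g -> periodic g twopi ->
  0 < e -> exists2 C : R, 0 <= C & forall s t : R, 0 <= s <= twopi -> 0 <= t <= twopi ->
    nm (g s - g t) <= e + C * nm (1 - cexp (t - s)) ^+ 2.
Proof.
move=> cg pg e0.
(* The cap at 1 keeps d inside (0, pi), where cosine decreases strictly, so that 2 - 2 cos d is
   positive. *)
have [d [d0 dpi dP]] : exists d : R, [/\ 0 < d, d < pi &
    forall x y : R, 0 <= x <= twopi -> `|x - y| < d -> nm (g x - g y) < e].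
  have [d d0 dP] := unif_segment cg e0; exists (Num.min d 1); split.
  - by rewrite lt_min d0 ltr01.
  - by rewrite gt_min; apply/orP; right; have := pi_ge2 R; lra.
  - by move=> x y x01; rewrite lt_min => /andP[+ _]; exact: dP.
have [M M0 MP] := bounded_segment cg.
have k0 : 0 < 2 - 2 * cos d.
  have : cos d < cos 0 by rewrite ltr_cos ?in_itv/= ?lexx ?pi_ge0 ?(ltW d0) ?(ltW dpi).
  by rewrite cos0; lra.
(* 2M bounds the oscillation of [g], and 2 - 2 cos d is the least value of |1 - e^(iu)|^2 for u at
   distance at least d from the multiples of 2 pi. *)
exists (2 * M / (2 - 2 * cos d)); first by rewrite divr_ge0 ?mulr_ge0// ltW.
move=> s t s01 t01.
have C0 : 0 <= 2 * M / (2 - 2 * cos d) * nm (1 - cexp (t - s)) ^+ 2.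
  by rewrite mulr_ge0 ?sqr_ge0// divr_ge0 ?mulr_ge0// ltW.
have ok : nm (g s - g t) < e -> nm (g s - g t) <= e + 2 * M / (2 - 2 * cos d) * nm (1 - cexp (t - s)) ^+ 2.
  by move=> h; rewrite (le_trans (ltW h))// lerDl.
(* For two points of [0, 2 pi], closeness on the circle means that s is close to t or to one of its
   two translates by 2 pi. *)
have [/(dP _ _ s01)/ok //|st] := ltP `|s - t| d.
have [h|h1] := ltP `|s - (t + twopi)| d.
  by apply: ok; rewrite -(pg t); exact: dP.
have [h|h2] := ltP `|s - (t - twopi)| d.
  by apply: ok; rewrite -(periodicB t pg); exact: dP.
apply: (@le_trans _ _ (2 * M)).
  by apply: le_trans (nmD _ _) _; rewrite nmN mulr_natl mulr2n lerD ?MP.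
apply: (@le_trans _ _ (2 * M / (2 - 2 * cos d) * nm (1 - cexp (t - s)) ^+ 2)).
  rewrite mulrAC ler_pdivlMr// ler_wpM2l ?mulr_ge0// nm_1Bcexp.
  rewrite lerD2l lerN2 ler_pM2l//.
  have -> : cos (t - s) = cos `|t - s| by case: (ger0P (t - s)) => _; rewrite ?cosN.
  move: s01 t01 => /andP[s0 s1] /andP[t0 t1].
  apply: cos_le_mid => //; first by rewrite distrC.
  have [ts|ts] := leP t s.
    rewrite distrC ger0_norm ?subr_ge0//.
    move: h1; rewrite distrC ger0_norm => [|]; rewrite mulr2n in s1 t1 *; lra.
  rewrite gtr0_norm ?subr_gt0//.
  move: h2; rewrite ger0_norm => [|]; rewrite mulr2n in s1 t1 *; lra.
by rewrite lerDr ltW.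
Qed.

Lemma nmX z n : nm (z ^+ n) = nm z ^+ n.
Proof. by elim: n => [|n ih]; [rewrite /nm normr1|rewrite !exprS nmM ih]. Qed.

(** The geometric sum telescopes to 1 - e^(inx), of modulus at most 2. The bound does not depend on
    n, so division by 2 pi n makes the contribution of the test function vanish. *)
Lemma kernel_bound n (x : R) :
  nm (1 - cexp x) ^+ 2 * nm (\sum_(j < n) cexp x ^+ j) ^+ 2 <= 4.
Proof.
rewrite -exprMn -nmM -nmN -mulNr opprB -subrX1.
have -> : (4 : R) = 2 ^+ 2 by ring.
rewrite ler_sqr ?nnegrE ?nm_ge0//.
apply: le_trans (nmD _ _) _; rewrite nmN nmX nm_cexp expr1n.
by rewrite /nm normr1.
Qed.

Lemma measurable_continuous (g : R -> R[i]^o) : continuous g ->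
  measurable_fun [set: T] (g : T -> R[i]).
Proof.
move=> /continuous_nmP cg.
have cr : continuous (fun t : R => Re (g t)).
  move=> x; apply/cvgrPdist_lt => e e0; apply: filterS (cg x e e0) => y.
  by apply: le_lt_trans; rewrite -Re_N -Re_D; exact: Re_le_nm.
have ci : continuous (fun t : R => Im (g t)).
  move=> x; apply/cvgrPdist_lt => e e0; apply: filterS (cg x e e0) => y.
  by apply: le_lt_trans; rewrite -Im_N -Im_D; exact: Im_le_nm.
have := measurable_Complex (continuous_measurable_fun cr) (continuous_measurable_fun ci).
by congr measurable_fun; apply/funext => x; case: (g x).
Qed.

Lemma fejer_cvg f (g : R -> R[i]^o) (e : R) : continuous g -> periodic g twopi ->
  {ae mu, forall t : T, f t = g t} -> 0 < e ->
  exists N : nat, forall n, (N <= n)%N -> forall t : R, 0 <= t <= twopi ->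
    nm (tpolf (fejer_seq n f) t - g t) <= e.
Proof.
move=> cg pg fg e0; have e2 : 0 < e / 2 by rewrite divr_gt0.
have [C C0 CP] := circle_modulus cg pg e2.
have [M M0 MP] := bounded_segment cg.
have bf : bnd M f.
  by apply: filterS2 fg (ae_circle_le R) => t -> /MP.
have lf : L1 f by exact/L2_L1/(L2_bnd bf).
(* The final error is e/2 + 4C/n: the first term comes from the modulus of continuity, the second
   from [kernel_bound]. *)
exists (Num.truncn (8 * C / e)).+1 => n Nn t t01.
have n0 : 0 < n%:R :> R by rewrite ltr0n; case: n Nn.
have nC : 8 * C / e < n%:R.
  by apply: lt_le_trans (truncnS_gt _) _; rewrite ler_nat.
pose D := dirichlet n t.
have lD : L2 D := L2_dirichlet n t.
have tp0 := twopi_gt0 R.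
have ntp0 : 0 < n%:R * twopi by rewrite mulr_gt0.
have ND : L2norm D ^+ 2 = n%:R * twopi := L2norm_dirichlet n t.
pose k : R[i] := ((n%:R * twopi)^-1)%:C.
pose gt : R[i] := g t; rewrite -[g t]/gt.
have bh : bnd (M + nm gt * 1) (f - gt *: (1 : L0 R)).
  by apply: bndB => //; apply: bndZ; exact: bnd1.
have [lhD _] := L2_bndM bh lD.
(* The kernel has total mass 1, so the constant [gt] can be moved under the integral. *)
have -> : tpolf (fejer_seq n f) t - gt = k * I ((f - gt *: (1 : L0 R)) * D * L0conj D).
  rewrite -innerE mulrBl innerBl//; last 2 first.
  - by have [] := L2_bndM bf lD.
  - by rewrite L0_scaleAl mul1r; exact: L2_Z.
  rewrite L0_scaleAl mul1r innerZl// inner_self// ND mulrBr fejer_inner//.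
  congr (_ - _); rewrite mulrCA -rmorphM/= mulVf ?mulr1//.
  by rewrite gt_eqF.
rewrite nmM nm_real ger0_norm ?invr_ge0 ?(ltW ntp0)// ler_pdivrMl//.
have lID : L1 ((f - gt *: (1 : L0 R)) * D * L0conj D) by exact: L1_inner.
apply: le_trans (nm_I lID) _.
have iD : mu.-integrable setT (EFin \o (fun s => e / 2 * (L0abs D s ^+ 2))).
  exact: (integrableZl measurableT (e / 2) ((L2P D).1 lD)).
have mfin : (mu setT < +oo)%E by rewrite -ge0_fin_numE ?circle_measure_fin.
have ic : mu.-integrable setT (EFin \o (fun s : T => 4 * C)).
  apply/integrableP; split; first by apply/measurable_EFinP; exact: measurable_cst.
  by rewrite [X in (X < _)%E](integral_cst _ _ `|4 * C|%:E)// lte_mul_pinfty// lee_fin.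
apply: (@le_trans _ _ (\int[mu]_s (e / 2 * (L0abs D s ^+ 2) + 4 * C))).
  apply: le_ae_Rintegral.
  - exact/L1_nm.
  - exact: (integrableD measurableT iD ic).
  apply: filterS (filterI (filterI (filterI fg (ae_circle_le R)) (filterI (L0_mulE ((f - gt *: (1 : L0 R)) * D) (L0conj D))
    (L0_mulE (f - gt *: (1 : L0 R)) D))) (filterI (filterI (L0conjE D) (L0_subE f (gt *: (1 : L0 R))))
    (filterI (filterI (L0_scaleE gt 1) (L0_1E R)) (dirichletE n t)))) =>
    s [[[fs s01] [e1 e3]] [[e4 e5] [[e6 e7] e8]]].
  rewrite /L0abs -!/(nm _) e1 e3 e4 e5 e6 e7 fs mulr1 !nmM nm_conj -mulrA -expr2.
  rewrite -/D in e8.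
  apply: (@le_trans _ _ ((e / 2 + C * nm (1 - cexp (t - s)) ^+ 2) * nm (D s) ^+ 2)).
    by rewrite ler_wpM2r ?sqr_ge0//; exact: CP.
  rewrite mulrDl lerD2l e8 -mulrA [X in _ <= X]mulrC ler_wpM2l//.
  exact: kernel_bound.
rewrite RintegralD// RintegralZl//; last exact/L2P.
rewrite -L2norm_sqr// ND (Rintegral_cst mu measurableT).
have -> : fine (mu setT) = twopi.
  by rewrite /circle_measure/= /mrestr/= setTI lebesgue_measure_itv/= lte_fin tp0 oppr0 adde0.
rewrite ltr_pdivrMr// in nC.
have : 8 * C * twopi <= n%:R * e * twopi by rewrite ler_pM2r// ltW.
by move: (twopi) => P; lra.
Qed.

End fejer_approximation.

(** * From nonnegative quadratic forms to almost everywhere inequalities *)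

Section positivity.
Variable R : realType.
Local Notation mu := (circle_measure R).
Local Notation leb := (@lebesgue_measure R).
Local Notation T := (measurableTypeR R).
Local Notation twopi := (pi *+ 2 : R).
Implicit Types (f h p : L0 R) (z w c : R[i]).

Lemma continuous_real_complex (w : R -> R) : continuous w ->
  continuous ((fun t => (w t)%:C) : R -> R[i]^o).
Proof.
move=> cw; apply/continuous_nmP => x e e0.
have /cvgrPdist_lt /(_ _ e0) := cw x; apply: filterS => y.
by rewrite -rmorphB nm_real.
Qed.

Lemma CT_tpol_approx (g : R -> R[i]^o) (e : R) : continuous g -> periodic g twopi ->
  0 < e -> exists s, forall t : R, 0 <= t <= twopi -> nm (tpolf s t - g t) <= e.
Proof.
move=> cg pg e0; have mg := measurable_continuous cg.
have [N NP] := fejer_cvg cg pg (L0classE mg) e0.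
by exists (fejer_seq N (L0class mg)) => t; exact: NP (leqnn N) t.
Qed.

Lemma measurable_tpolf s : measurable_fun [set: T] (tpolf s : T -> R[i]).
Proof.
elim: s => [|p s ih].
  rewrite (_ : tpolf _ = cst 0); first exact: measurable_cst.
  by apply/funext => t; rewrite /tpolf big_nil.
rewrite (_ : tpolf _ = fun t => p.1 * cexp (p.2%:~R * t) + tpolf s t).
  apply: measurable_cD ih; apply: measurable_cM; first exact: measurable_cst.
  exact: measurable_chi.
by apply/funext => t; rewrite /tpolf big_cons.
Qed.

Lemma integrable_bounded_mul (u v : T -> R) (M : R) :
  mu.-integrable setT (EFin \o u) -> measurable_fun setT v ->
  {ae mu, forall t : T, `|v t| <= M} -> mu.-integrable setT (EFin \o (fun t => u t * v t)).
Proof.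
move=> iu mv bv; have mu_u : measurable_fun setT u by apply/measurable_EFinP; exact: measurable_int iu.
have iMu : mu.-integrable setT (EFin \o (fun t => M * `|u t|)).
  exact: (integrableZl measurableT M (integrable_norm iu)).
apply: (le_ae_integrable _ iMu); first exact: measurable_funM.
by apply: filterS bv => t vt; rewrite normrM mulrC ler_wpM2r.
Qed.

(** A nonnegative continuous periodic [w] is the square of its root, and the root is a uniform limit
    of trigonometric polynomials; the squared moduli of these converge to [w]. *)
Lemma ge0_Rintegral_continuous (u : T -> R) : mu.-integrable setT (EFin \o u) ->
  (forall s, 0 <= \int[mu]_t (u t * nm (tpolf s t) ^+ 2)) ->
  forall w : R -> R, continuous w -> periodic w twopi -> (forall t, 0 <= w t) ->
  0 <= \int[mu]_t (u t * w t).
Proof.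
move=> iu pu w cw pw w0.
have mw : measurable_fun [set: T] (w : T -> R) by exact: continuous_measurable_fun.
pose v t := Num.sqrt (w t).
have cv : continuous v.
  by move=> x; apply: continuous_comp; [exact: cw|exact: sqrt_continuous].
pose g : R -> R[i]^o := fun t => (v t)%:C.
have cg : continuous g by exact: continuous_real_complex.
have pg : periodic g twopi by move=> x; rewrite /g /v pw.
have [M M0 MP] := bounded_segment cg.
have vM t : 0 <= t <= twopi -> 0 <= v t <= M.
  by move=> /MP; rewrite /g nm_real ger0_norm ?sqrtr_ge0// => ->.
have wv t : w t = v t ^+ 2 by rewrite sqr_sqrtr.
have iuw : mu.-integrable setT (EFin \o (fun t => u t * w t)).
  apply: (@integrable_bounded_mul _ _ (M ^+ 2)) => //.
  apply: filterS (ae_circle_le R) => t /vM /andP[v0 vM'].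
  by rewrite ger0_norm// wv ler_sqr ?nnegrE.
rewrite leNgt; apply/negP => neg.
pose K := \int[mu]_t `|u t|.
have K0 : 0 <= K by apply: Rintegral_ge0.
pose a := - \int[mu]_t (u t * w t).
have a0 : 0 < a by rewrite oppr_gt0.
(* With e <= 1 the squared modulus of the polynomial differs from [w] by at most e(2M + 1).
   Integrated against |u| this costs at most a/2, half of the supposed deficit [a]. *)
pose e := Num.min 1 (a / (2 * ((2 * M + 1) * (K + 1)))).
have k0 : 0 < (2 * M + 1) * (K + 1) by nra.
have e0 : 0 < e by rewrite lt_min ltr01 divr_gt0// mulr_gt0.
have [s sP] := CT_tpol_approx cg pg e0.
have e1 : e <= 1 by rewrite ge_min lexx.
have ea : e * ((2 * M + 1) * (K + 1)) <= a / 2.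
  have : e <= a / (2 * ((2 * M + 1) * (K + 1))) by rewrite ge_min lexx orbT.
  rewrite ler_pdivlMr; last by rewrite mulr_gt0.
  by lra.
have dif : {ae mu, forall t : T, `|nm (tpolf s t) ^+ 2 - w t| <= e * (2 * M + 1)}.
  apply: filterS (ae_circle_le R) => t t01.
  have [/andP[v0 vM'] st] := (vM _ t01, sP _ t01).
  have n0 := nm_ge0 (tpolf s t).
  have h1 : nm (tpolf s t) <= v t + e.
    rewrite -(subrK (g t) (tpolf s t)) addrC; apply: le_trans (nmD _ _) _.
    by rewrite {1}/g nm_real ger0_norm// lerD2l.
  have h2 : v t <= nm (tpolf s t) + e.
    have -> : v t = nm (g t) by rewrite /g nm_real ger0_norm.
    rewrite -{1}(subrK (tpolf s t) (g t)) addrC; apply: le_trans (nmD _ _) _.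
    by rewrite lerD2l nmBC.
  rewrite wv ler_norml; apply/andP; split; nra.
have mn : measurable_fun setT (fun t : T => nm (tpolf s t) ^+ 2).
  by apply: measurable_funX; exact: (measurable_cnorm (measurable_tpolf s)).
have iup : mu.-integrable setT (EFin \o (fun t => u t * nm (tpolf s t) ^+ 2)).
  apply: (@integrable_bounded_mul _ _ ((M + 1) ^+ 2)) => //.
  apply: filterS2 dif (ae_circle_le R) => t dt t01; rewrite ger0_norm ?sqr_ge0//.
  rewrite ler_sqr ?nnegrE ?nm_ge0 ?addr_ge0//.
  rewrite -(subrK (g t) (tpolf s t)) addrC; apply: le_trans (nmD _ _) _.
  by apply: lerD; [exact: MP|exact: le_trans (sP _ t01) e1].
have iK : mu.-integrable setT (EFin \o (fun t => e * (2 * M + 1) * `|u t|)).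
  exact: (integrableZl measurableT _ (integrable_norm iu)).
have : \int[mu]_t (u t * nm (tpolf s t) ^+ 2) <=
       \int[mu]_t (u t * w t + e * (2 * M + 1) * `|u t|).
  apply: le_ae_Rintegral => //; first exact: (integrableD measurableT iuw iK).
  apply: filterS dif => t dt; rewrite -lerBlDl -mulrBr.
  by apply: le_trans (ler_norm _) _; rewrite normrM mulrC ler_wpM2r.
rewrite RintegralD// RintegralZl//; last exact: integrable_norm.
rewrite -/K => h; have := le_trans (pu s) h.
have aE : \int[mu]_t (u t * w t) = - a by rewrite opprK.
rewrite aE => h2.
have : e * (2 * M + 1) * K <= e * ((2 * M + 1) * (K + 1)) by nra.
lra.
Qed.

(** The indicator of the ball is, off a null set of the circle, the pointwise limit of the
    continuous functions [w k], and dominated convergence applies. The conditions on r keep the ball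
    from wrapping around. *)
Lemma ge0_Rintegral_ball (u : T -> R) (t0 r : R) : mu.-integrable setT (EFin \o u) ->
  (forall s, 0 <= \int[mu]_t (u t * nm (tpolf s t) ^+ 2)) ->
  0 < r -> r <= t0 -> r <= twopi - t0 ->
  (0 <= \int[leb]_(y in ball t0 r) ((u \_ `[0%R, twopi]) y)%:E)%E.
Proof.
move=> iu pu r0 rt0 rt1.
have r_pi : r <= pi by rewrite mulr2n in rt1; lra.
(* Positive on (0, 2 pi) exactly inside the ball, and periodic by construction. *)
pose a s := cos (s - t0) - cos r.
have ca : continuous a.
  move=> x; apply: cvgB; last exact: cvg_cst.
  apply: (@continuous_comp _ _ _ (fun s => s - t0) cos); last exact: continuous_cos.
  by apply: cvgB; [exact: cvg_id|exact: cvg_cst].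
pose w (k : nat) s := Num.min 1 (k%:R * Num.max 0 (a s)).
have cw k : continuous (w k).
  move=> x; apply: (@continuous_min _ _ (cst 1) (fun s => k%:R * Num.max 0 (a s))).
    exact: cvg_cst.
  apply: cvgM; first exact: cvg_cst.
  by apply: (@continuous_max _ _ (cst 0) a); [exact: cvg_cst|exact: ca].
have w01 k s : 0 <= w k s <= 1.
  by rewrite /w ge_min lexx/= le_min ler01/= mulr_ge0// le_max lexx.
have pw k : periodic (w k) twopi.
  move=> s; rewrite /w /a (_ : s + twopi - t0 = (s - t0) + twopi); last by ring.
  by rewrite cosD cos2pi sin2pi mulr1 mulr0 subr0.
have wint k : 0 <= \int[mu]_t (u t * w k t).
  apply: ge0_Rintegral_continuous => // s; by have /andP[] := w01 k s.
have mu_u : measurable_fun setT u by apply/measurable_EFinP; exact: measurable_int iu.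
pose l s : R := if 0 < a s then 1 else 0.
have ml : measurable_fun [set: T] (l : T -> R).
  apply: measurable_fun_ifT; [|exact: measurable_cst..].
  apply: measurable_fun_ltr; first exact: measurable_cst.
  exact: continuous_measurable_fun.
have mw k : measurable_fun [set: T] (w k : T -> R) by exact: continuous_measurable_fun.
have wl s : w k s @[k --> \oo] --> l s.
  rewrite /l; case: ltP => as0.
    apply: cvg_near_cst; near=> k; rewrite /w; apply/min_idPl.
    rewrite max_r ?(ltW as0)// -ler_pdivrMr//.
    by near: k; exact: nbhs_infty_ger.
  by apply: cvg_near_cst; apply: nearW => k; rewrite /w max_l// mulr0 min_r.
have il : 0 <= \int[mu]_t (u t * l t).
  have f1 n : measurable_fun setT (fun t : T => (u t * w n t)%:E).
    by apply/measurable_EFinP; exact: measurable_funM.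
  have f2 : measurable_fun setT (fun t : T => (u t * l t)%:E).
    by apply/measurable_EFinP; exact: measurable_funM.
  have f3 : {ae mu, forall t : T, setT t -> (u t * w k t)%:E @[k --> \oo] --> (u t * l t)%:E}.
    apply: aeW => t _; apply: cvg_EFin; first by apply: nearW.
    by apply: cvgM; [exact: cvg_cst|exact: wl].
  have f4 : {ae mu, forall (t : T) n, setT t -> (`|(u t * w n t)%:E| <= (`|u t|)%:E)%E}.
    apply: aeW => t n _; have /andP[w0 w1] := w01 n t.
    by rewrite /= lee_fin normrM (ger0_norm w0) ler_piMr.
  have [_ _ dc] := dominated_convergence measurableT f1 f2 f3 (integrable_norm iu) f4.
  apply: fine_ge0; rewrite -(cvg_lim _ dc)//; apply: lime_ge; first by apply/cvg_ex; eexists; exact: dc.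
  apply: nearW => n; have := wint n; rewrite /Rintegral -lee_fin fineK//.
  apply: integrable_fin_num => //; apply: (@integrable_bounded_mul _ _ 1) => //.
  by apply: aeW => t; have /andP[w0 w1] := w01 n t; rewrite ger0_norm.
have iul : mu.-integrable setT (EFin \o (fun t => u t * l t)).
  apply: (@integrable_bounded_mul _ _ 1) => //.
  by apply: aeW => t; rewrite /l; case: ifP; rewrite ?normr1 ?normr0.
have : (0 <= \int[mu]_t (u t * l t)%:E)%E.
  by rewrite -[leRHS]fineK ?lee_fin//; exact: integrable_fin_num iul.
rewrite circle_integralE; last by apply/measurable_EFinP; exact: measurable_funM.
rewrite [X in (0 <= X)%E -> _]integral_mkcond [X in _ -> (0 <= X)%E]integral_mkcond.
congr (0%E <= _)%E; apply: ae_eq_integral => //.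
- apply/(measurable_restrictT _ _).1 => //; apply: measurable_funTS.
  by apply/measurable_EFinP; exact: measurable_funM.
- apply/(measurable_restrictT _ _).1 => //; first exact: measurable_ball.
  apply: measurable_funTS; apply/measurable_EFinP.
  by apply/(measurable_restrictT _ _).1 => //; exact: measurable_funTS.
have aP s : 0 < s < twopi -> (0 < a s) = (`|t0 - s| < r).
  move=> /andP[s0 s1]; rewrite /a subr_gt0 distrC.
  have -> : cos (s - t0) = cos `|s - t0| by case: (ger0P (s - t0)) => _; rewrite ?cosN.
  have [upi|piu] := leP `|s - t0| pi.
    by rewrite ltr_cos ?in_itv/= ?normr_ge0 ?(ltW r0).
  rewrite [RHS]ltNge (le_trans r_pi (ltW piu))/=; apply/negbTE; rewrite -leNgt.
  have := @cos_le_mid R r `|s - t0| r0; apply.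
    exact: le_trans r_pi (ltW piu).
  rewrite mulr2n in rt1 s1 *.
  have [st|st] := leP t0 s.
    by rewrite ger0_norm ?subr_ge0//; lra.
  by rewrite ltr0_norm ?subr_lt0//; lra.
have : {ae leb, forall s : T, s != 0 /\ s != twopi}.
  exists ([set 0] `|` [set twopi]); split.
  - by apply: measurableU; exact: measurable_set1.
  - by apply: (@null_set_setU _ _ _ leb) => //; exact: lebesgue_measure_set1.
  - move=> s /= /not_andP[/negP/negPn/eqP ->|/negP/negPn/eqP ->]; [by left|by right].
apply: filterS => s [s0 s1] _; rewrite !patchE.
have -> : (s \in `[0, twopi]%classic) = (0 <= s <= twopi).
  by apply/idP/idP; rewrite inE /= in_itv.
case: ifPn => s01.
  have s01' : 0 < s < twopi.
    by move: s01 => /andP[h1 h2]; rewrite !lt_neqAle eq_sym s0 h1 s1 h2.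
  rewrite /l aP//; case: ifPn => [h|/negP h'].
    by rewrite mulr1 mem_set.
  by rewrite mulr0 memNset//= => /h'.
by case: ifPn.
Unshelve. all: by end_near. Qed.

(** At a Lebesgue point t with u(t) < 0, nonnegative integrals over small balls force the mean of |u
    - u(t)| to be at least -u(t), whereas differentiation sends this mean to 0. *)
Lemma ae_ge0_tpol (u : T -> R) : mu.-integrable setT (EFin \o u) ->
  (forall s, 0 <= \int[mu]_t (u t * nm (tpolf s t) ^+ 2)) ->
  {ae mu, forall t : T, 0 <= u t}.
Proof.
move=> iu pu.
have mu_u : measurable_fun setT u by apply/measurable_EFinP; exact: measurable_int iu.
have ileb : leb.-integrable `[0, twopi] (EFin \o u).
  move/integrableP: iu => [m lt]; apply/integrableP; split; first exact: measurable_funTS.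
  by rewrite -circle_integralE//; exact: measurableT_comp.
have := lebesgue_differentiation (integrable_locally_restrict (measurable_itv _) ileb).
have ae_sub (P : T -> Prop) : {ae leb, forall t, P t} -> {ae mu, forall t, P t}.
  move=> [A [mA A0 PA]]; exists A; split => //.
  apply: (subset_measure0 _ mA _ A0) => //; first exact: measurableI.
move=> /ae_sub; apply: filterS2 (ae_circle R) => t /andP[t0 t1].
set f := u \_ `[0, twopi].
have fu : f t = u t by rewrite /f patchE mem_set//= in_itv/= (ltW t0) (ltW t1).
rewrite -fu leNgt => lpt; apply/negP => ft0.
have nft : (0 < (- f t)%:E)%E by rewrite lte_fin oppr_gt0.
have : \forall r \near 0^'+, (davg f t r < (- f t)%:E)%E.
  have /fine_cvgP[fn cv] := lpt.
  have nft' : 0 < - f t by rewrite oppr_gt0.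
  have /cvgrPdist_lt /(_ _ nft') := cv; apply: filterS2 fn => r fnr.
  rewrite sub0r normrN => h; rewrite -[davg _ _ _]fineK// lte_fin.
  exact: le_lt_trans (ler_norm _) h.
suff : \forall r \near 0^'+, ((- f t)%:E <= davg f t r)%E.
  move=> h1 h2; have : \forall r \near (0 : R)^'+, False.
    by apply: filterS2 h1 h2 => r; rewrite leNgt => /negP.
  by move=> /filter_ex[].
near=> r.
have r0 : 0 < r by near: r; exact: nbhs_right_gt.
have rt0 : r <= t by near: r; exact: nbhs_right_le.
have rt1 : r <= twopi - t by near: r; apply: nbhs_right_le; rewrite subr_gt0.
have ball_ge0 := ge0_Rintegral_ball iu pu r0 rt0 rt1.
have bsub : ball t r `<=` `[0, twopi].
  move=> s; rewrite /ball/= ltr_distlC in_itv/= => /andP[h1 h2].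
  by apply/andP; split; lra.
have ifb : leb.-integrable (ball t r) (EFin \o f).
  apply: (integrableS (E := setT)) => //; first exact: measurable_ball.
  rewrite /f -restrict_EFin; apply/(integrable_mkcond _ _).1 => //.
have icb : leb.-integrable (ball t r) (EFin \o cst (f t)).
  apply: measurable_bounded_integrable => //; first exact: measurable_ball.
  - by rewrite [X in (X < _)%E]lebesgue_measure_ball ?(ltW r0)// ltry.
  - exact: bounded_cst.
rewrite /davg /iavg lebesgue_measure_ball ?(ltW r0)// inver.
rewrite mulrn_eq0/= gt_eqF// lee_pdivlMl ?mulrn_wgt0//.
apply: (@le_trans _ _ (\int[leb]_(y in ball t r) ((f y)%:E - (f t)%:E)))%E.
  rewrite integralB_EFin//; last exact: measurable_ball.
  rewrite integral_cst; last exact: measurable_ball.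
  have -> : ((f t)%:E * lebesgue_measure (ball t r) = (f t * (r *+ 2))%:E)%E.
    by rewrite lebesgue_measure_ball ?(ltW r0).
  by rewrite -EFinN -mulNr EFinM muleC leeDr.
have iB : leb.-integrable (ball t r) (fun y => ((f y)%:E - (f t)%:E)%E).
  have mB : measurable (ball t r : set T) by exact: measurable_ball.
  exact: (integrableB mB ifb icb).
apply: le_integral; first exact: measurable_ball.
- by [].
- by apply: (integrable_abse iB).
- by move=> y _; rewrite /= lee_fin ler_norm.
Unshelve. all: by end_near. Qed.

End positivity.

(** * Completeness and Fourier expansions *)

Section completeness.
Variable R : realType.
Local Notation mu := (circle_measure R).
Local Notation T := (measurableTypeR R).
Local Notation twopi := (pi *+ 2 : R).
Implicit Types (f g h : L0 R) (F : nat -> L0 R) (z w : R[i]).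

(* One-sided: it means convergence to 0 only for nonnegative sequences. *)
Definition vanishing (a : nat -> R) :=
  forall e, 0 < e -> exists N, forall n, (N <= n)%N -> a n <= e.

Lemma real_cauchy_cvg (u : nat -> R) :
  (forall e, 0 < e -> exists N, forall m n, (N <= m)%N -> (N <= n)%N -> `|u m - u n| <= e) ->
  exists l : R, u @ \oo --> l.
Proof.
move=> cu; apply/cvg_ex; apply/cauchy_cvgP/cauchyP => e e0.
have [N NP] := cu (e / 2) (divr_gt0 e0 (ltr0Sn _ _)).
exists (u N); exists N => // n /= Nn; rewrite /ball/=.
by apply: le_lt_trans (NP N n (leqnn N) Nn) _; rewrite ltr_pdivrMr// ltr_pMr// ltr1n.
Qed.

Lemma L0_ae_cvg F :
  {ae mu, forall t : T, forall e : R, 0 < e -> exists N, forall m n,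
     (N <= m)%N -> (N <= n)%N -> nm (F m t - F n t) <= e} ->
  exists f, {ae mu, forall t : T, vanishing (fun n => nm (F n t - f t))}.
Proof.
move=> cF.
(* A limit superior is measurable without any convergence, and it is the limit wherever the sequence
   is Cauchy. *)
pose lim_of (u : T -> nat -> R) := fun t => fine (limn_esup (fun n => (u t n)%:E)).
have mlim (u : T -> nat -> R) : (forall n, measurable_fun setT (u^~ n)) ->
    measurable_fun setT (lim_of u).
  move=> mu_u; apply: (measurableT_comp (fine_measurable measurableT)).
  apply: (@measurable_fun_limn_esup _ _ _ setT (fun n t => (u t n)%:E)) => n.
  exact/measurable_EFinP.
have lim_ofP (u : T -> nat -> R) t l : u t @ \oo --> l -> lim_of u t = l.
  move=> ul; rewrite /lim_of.
  have cl : (u t n)%:E @[n --> \oo] --> l%:E by apply: cvg_EFin => //; exact: nearW.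
  by rewrite (cvg_limn_einf_sup cl).
have mRe n : measurable_fun setT (fun t => Re (F n t)) by apply: measurable_ReP; exact: L0fun_measurable.
have mIm n : measurable_fun setT (fun t => Im (F n t)) by apply: measurable_ImP; exact: L0fun_measurable.
have mf := measurable_Complex (mlim (fun t n => Re (F n t)) mRe) (mlim (fun t n => Im (F n t)) mIm).
exists (L0class mf); apply: filterS2 (L0classE mf) cF => t -> ct e e0.
have [r rP] : exists l : R, (fun n => Re (F n t)) @ \oo --> l.
  apply: real_cauchy_cvg => d /ct[N NP]; exists N => m n Nm Nn.
  by rewrite -Re_N -Re_D; apply: le_trans (Re_le_nm _) _; exact: NP.
have [i iP] : exists l : R, (fun n => Im (F n t)) @ \oo --> l.
  apply: real_cauchy_cvg => d /ct[N NP]; exists N => m n Nm Nn.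
  by rewrite -Im_N -Im_D; apply: le_trans (Im_le_nm _) _; exact: NP.
rewrite (lim_ofP (fun t n => Re (F n t)) t _ rP) (lim_ofP (fun t n => Im (F n t)) t _ iP).
have e2 : 0 < e / 2 by rewrite divr_gt0.
have /cvgrPdist_le /(_ _ e2) [N1 _ N1P] := rP.
have /cvgrPdist_le /(_ _ e2) [N2 _ N2P] := iP.
exists (maxn N1 N2) => n; rewrite geq_max => /andP[n1 n2].
apply: le_trans (nm_le_ReIm _) _; rewrite Re_D Im_D Re_N Im_N /=.
by rewrite [e]splitr lerD// distrC; [exact: N1P|exact: N2P].
Qed.

Lemma Linf_complete F (a : nat -> R) : vanishing a ->
  (forall k m, (k <= m)%N -> bnd (a k) (F m - F k)) ->
  exists f, forall k, bnd (a k) (f - F k).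
Proof.
move=> va cF.
have cF' : {ae mu, forall t : T, forall k m, (k <= m)%N -> nm (F m t - F k t) <= a k}.
  apply/ae_foralln => k; apply/ae_foralln => m.
  case: (leqP k m) => km; last by apply: aeW => t /=.
  by apply: filterS2 (cF _ _ km) (L0_subE (F m) (F k)) => t + e _; rewrite e.
have [f fP] : exists f, {ae mu, forall t : T, vanishing (fun n => nm (F n t - f t))}.
  apply: L0_ae_cvg; apply: filterS cF' => t ct e e0.
  have [N NP] := va e e0; exists N => m n Nm Nn.
  have [mn|/ltnW nm'] := leqP m n.
    by rewrite nmBC; apply: le_trans (ct _ _ mn) _; exact: NP.
  by apply: le_trans (ct _ _ nm') _; exact: NP.
exists f => k; apply: filterS3 fP cF' (L0_subE f (F k)) => t ft ct ->.
apply/ler_addgt0Pr => e e0; have [N NP] := ft e e0.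
rewrite -(subrK (F (maxn N k) t) (f t)) -addrA.
apply: le_trans (nmD _ _) _; rewrite [leRHS]addrC lerD//.
  by rewrite nmBC; apply: NP; rewrite leq_maxl.
by apply: ct; rewrite leq_maxr.
Qed.

Lemma subsequence_le (a b : nat -> R) : vanishing a -> (forall j, 0 < b j) ->
  exists s : nat -> nat, (forall j, (j <= s j)%N) /\
    (forall j k, (s j <= k)%N -> a k <= b j) /\ forall j, (s j <= s j.+1)%N.
Proof.
move=> va b0; have /choice[N NP] : forall j, exists N, forall n, (N <= n)%N -> a n <= b j.
  by move=> j; exact: va.
(* Summing the thresholds makes the indices monotone while dominating each [N j]; the summand j
   makes them unbounded. *)
exists (fun j => j + \sum_(i < j.+1) N i)%N; split; first by move=> j; rewrite leq_addr.
split=> [j k h|j].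
  apply: NP; apply: leq_trans h; rewrite big_ord_recr /= addnA.
  by rewrite leq_addl.
by rewrite [in leqRHS]big_ord_recr/= addSn; apply: leqW; rewrite addnA leq_addr.
Qed.

(** The inequality |f| <= (l + |f|^2 / l) / 2 with a free weight: choosing l of the size of the L^2
    norm keeps the bound of that size. *)
Lemma L1norm_le f (l : R) : 0 < l -> L2 f ->
  \int[mu]_t L0abs f t <= (l * twopi + l^-1 * L2norm f ^+ 2) / 2.
Proof.
move=> l0 lf; have mfin : (mu setT < +oo)%E by rewrite -ge0_fin_numE ?circle_measure_fin.
have ic : mu.-integrable setT (EFin \o (fun t : T => l / 2)).
  apply/integrableP; split; first by apply/measurable_EFinP; exact: measurable_cst.
  by rewrite [X in (X < _)%E](integral_cst _ _ `|l / 2|%:E)// lte_mul_pinfty// lee_fin.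
have i2 : mu.-integrable setT (EFin \o (fun t => (l^-1 / 2) * L0abs f t ^+ 2)).
  exact: (integrableZl measurableT _ ((L2P f).1 lf)).
apply: (@le_trans _ _ (\int[mu]_t (l / 2 + (l^-1 / 2) * L0abs f t ^+ 2))).
  apply: le_ae_Rintegral.
  - by apply/L1_nm; exact: L2_L1.
  - exact: (integrableD measurableT ic i2).
  apply: aeW => t; rewrite -subr_ge0 (_ : _ - _ = l^-1 / 2 * (l - L0abs f t) ^+ 2).
    by rewrite mulr_ge0 ?sqr_ge0// divr_ge0// invr_ge0 ltW.
  by field; rewrite gt_eqF.
rewrite RintegralD// (Rintegral_cst mu measurableT) RintegralZl//; last exact/L2P.
rewrite -L2norm_sqr//.
have -> : fine (mu setT) = twopi.
  by rewrite /circle_measure/= /mrestr/= setTI lebesgue_measure_itv/= lte_fin twopi_gt0 oppr0 adde0.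
by rewrite le_eqVlt; apply/orP; left; apply/eqP; field; rewrite gt_eqF.
Qed.

Lemma geo_sum_le n : \sum_(j < n) (2 ^- j) <= 2 :> R.
Proof.
suff -> : \sum_(j < n) (2 ^- j) = 2 - 2 * 2 ^- n :> R.
  by rewrite gerBl mulr_ge0// invr_ge0 exprn_ge0.
elim: n => [|n ih]; first by rewrite big_ord0 expr0 invr1 mulr1 subrr.
by rewrite big_ord_recr /= ih exprS invfM; field; rewrite expf_neq0.
Qed.

(** The series of the |F (j+1) - F j| has finite integral by monotone convergence, so it converges
    almost everywhere and its tails dominate the differences. *)
Lemma ae_cauchy_fast F : (forall j, L2 (F j)) ->
  (forall j, L2norm (F j.+1 - F j) <= 2 ^- j) ->
  {ae mu, forall t : T, forall e : R, 0 < e -> exists N, forall m n,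
     (N <= m)%N -> (N <= n)%N -> nm (F m t - F n t) <= e}.
Proof.
move=> lF dF.
pose d j : T -> R := L0abs (F j.+1 - F j).
have ld j : L2 (F j.+1 - F j) by exact: L2_B.
have d0 j t : 0 <= d j t by exact: L0abs_ge0.
have md j : measurable_fun setT (EFin \o d j).
  by apply/measurable_EFinP; exact: measurable_L0abs.
(* The constant given by [L1norm_le] at l = 2^-j. *)
pose C : R := (twopi + 1) / 2.
have C0 : 0 < C by rewrite divr_gt0// addr_gt0// twopi_gt0.
have id j : \int[mu]_t d j t <= C * 2 ^- j.
  have p0 : 0 < 2 ^- j :> R by rewrite invr_gt0 exprn_gt0.
  apply: le_trans (L1norm_le p0 (ld j)) _; rewrite /C mulrAC ler_wpM2r//.
  rewrite mulrDl mul1r mulrC lerD2l invrK -ler_pdivlMl ?exprn_gt0//.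
  by rewrite -expr2 ler_sqr ?nnegrE ?L2norm_ge0// ltW.
have iS : (\int[mu]_t (\sum_(j <oo) (d j t)%:E) <= (C * 2)%:E)%E.
  rewrite integral_nneseries//; last by move=> n t _; rewrite lee_fin.
  apply: lime_le.
    by apply: is_cvg_nneseries => n _ _; apply: integral_ge0 => t _; rewrite lee_fin.
  apply: nearW => n; rewrite big_mkord.
  apply: (@le_trans _ _ (\sum_(j < n) (C * 2 ^- j)%:E)%E).
    apply: lee_sum => j _; rewrite -[leLHS]fineK; first by rewrite lee_fin; exact: id.
    by apply: integrable_fin_num => //; apply/L1_nm; exact: L2_L1.
  by rewrite sumEFin lee_fin -mulr_sumr ler_wpM2l ?(ltW C0)// geo_sum_le.
have Sfin : {ae mu, forall t : T, setT t -> (\sum_(j <oo) (d j t)%:E)%E \is a fin_num}.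
  apply: integrable_ae => //; apply/integrableP; split.
    by apply: ge0_emeasurable_sum => [k x _ _|k _]; [rewrite lee_fin|exact: md].
  apply: le_lt_trans (ltry (C * 2)); apply: le_trans iS; apply: ge0_le_integral => //.
  - apply: measurableT_comp => //.
    by apply: ge0_emeasurable_sum => [k x _ _|k _]; [rewrite lee_fin|exact: md].
  - by apply: ge0_emeasurable_sum => [k x _ _|k _]; [rewrite lee_fin|exact: md].
  - by move=> t _; rewrite gee0_abs//; apply: nneseries_ge0 => n _ _; rewrite lee_fin.
have dE : {ae mu, forall t : T, forall j, d j t = nm (F j.+1 t - F j t)}.
  by apply/ae_foralln => j; apply: filterS (L0_subE (F j.+1) (F j)) => t e; rewrite /d /L0abs e.
apply: filterS2 Sfin dE => t /(_ Logic.I) St dEt e e0.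
pose s n := \sum_(j < n) d j t.
have smono n m : (n <= m)%N -> s n <= s m.
  move=> /subnKC <-; rewrite /s big_split_ord /= lerDl sumr_ge0//.
have [l lP] : exists l : R, s @ \oo --> l.
  apply/cvg_ex; apply: nondecreasing_is_cvgn => //.
  exists (fine (\sum_(j <oo) (d j t)%:E)%E) => _ [n _ <-].
  rewrite -lee_fin fineK// /s -sumEFin.
  have := @nneseries_lim_ge R (fun j => (d j t)%:E) xpredT 0%N n.
  by rewrite big_mkord; apply => k _ _; rewrite lee_fin.
have FF n m : (n <= m)%N -> nm (F m t - F n t) <= s m - s n.
  move=> /subnKC <-; elim: (m - n)%N => [|k ih]; first by rewrite addn0 !subrr nm0.
  rewrite addnS -(subrK (F (n + k) t) (F _.+1 t)) -addrA; apply: le_trans (nmD _ _) _.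
  rewrite /s big_ord_recr/= -/(s (n + k)%N) [leRHS]addrAC [leLHS]addrC lerD//.
  by rewrite dEt.
have e2 : 0 < e / 2 by rewrite divr_gt0.
have /cvgrPdist_le /(_ _ e2) [N _ NP] := lP.
have key n m : (N <= n)%N -> (n <= m)%N -> nm (F m t - F n t) <= e.
  move=> Nn nm'; apply: le_trans (FF _ _ nm') _; apply: le_trans (ler_norm _) _.
  rewrite (_ : s m - s n = (l - s n) - (l - s m)); last by ring.
  apply: le_trans (ler_normB _ _) _; rewrite [e]splitr lerD//; apply: NP => //=.
  exact: leq_trans Nn nm'.
exists N => m n Nm Nn; have [mn|/ltnW mn] := leqP m n; last exact: key.
by rewrite nmBC; exact: key.
Qed.

Lemma L2norm_fatou F f (c : R) : 0 <= c -> (forall j, L2 (F j)) ->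
  (exists N, forall j, (N <= j)%N -> L2norm (F j) <= c) ->
  {ae mu, forall t : T, vanishing (fun j => nm (F j t - f t))} ->
  L2 f /\ L2norm f <= c.
Proof.
move=> c0 lF [N NP] Ff.
pose g j t : \bar R := (L0abs (F j) t ^+ 2)%:E.
have mg j : measurable_fun setT (g j).
  by apply/measurable_EFinP; apply: measurable_funX; exact: measurable_L0abs.
have g0 j t : (0 <= g j t)%E by rewrite lee_fin sqr_ge0.
have mf2 : measurable_fun setT (fun t => (L0abs f t ^+ 2)%:E).
  by apply/measurable_EFinP; apply: measurable_funX; exact: measurable_L0abs.
have fE : (\int[mu]_t (L0abs f t ^+ 2)%:E = \int[mu]_t limn_einf (g^~ t))%E.
  apply: ae_eq_integral => //.
    have -> : (fun t => limn_einf (g^~ t)) = (fun t => - limn_esup (fun j => - g j t))%E by [].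
    apply: measurableT_comp => //; apply: measurable_fun_limn_esup => n.
    exact: measurableT_comp.
  apply: filterS Ff => t ft _; apply/esym.
  have cv : L0abs (F j) t @[j --> \oo] --> L0abs f t.
    apply/cvgrPdist_le => e e0; have [M MP] := ft e e0; exists M => // n /= Mn.
    apply: le_trans (MP _ Mn); rewrite /L0abs -!/(nm _).
    rewrite ler_norml; apply/andP; split.
      rewrite lerNl opprB lerBlDr -{1}(subrK (f t) (F n t)); exact: nmD.
    rewrite lerBlDr nmBC -{1}(subrK (F n t) (f t)); exact: nmD.
  have cv2 : g j t @[j --> \oo] --> (L0abs f t ^+ 2)%:E.
    apply: cvg_EFin; first exact: nearW.
    by rewrite expr2; apply: (cvg_trans _ (cvgM cv cv)); apply: near_eq_cvg; apply: nearW => j /=; rewrite expr2.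
  by rewrite (cvg_limn_einf_sup cv2).
have le : (\int[mu]_t (L0abs f t ^+ 2)%:E <= (c ^+ 2)%:E)%E.
  rewrite fE; apply: le_trans (fatou mu measurableT mg (fun j t _ => g0 j t)) _.
  rewrite limn_einf_lim; apply: lime_le; first exact: is_cvg_einfs.
  exists N => // j /= Nj; apply: (@le_trans _ _ (\int[mu]_t g j t)%E).
    by apply: ereal_inf_lbound; exists j => //=.
  rewrite -[leLHS]fineK; last by apply: integrable_fin_num => //; exact/L2P.
  have := L2norm_sqr (lF j); rewrite /Rintegral => <-.
  by rewrite lee_fin ler_sqr ?nnegrE ?L2norm_ge0// NP.
have lf : L2 f.
  apply/L2P; apply/integrableP; split => //.
  apply: le_lt_trans (ltry (c ^+ 2)); apply: le_trans le; apply: ge0_le_integral => //.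
  - exact: measurableT_comp.
  - by move=> t _; rewrite gee0_abs// lee_fin sqr_ge0.
split => //; rewrite -ler_sqr ?nnegrE ?L2norm_ge0// L2norm_sqr//.
by rewrite -lee_fin /Rintegral fineK//; apply: integrable_fin_num => //; exact/L2P.
Qed.

(** Riesz-Fischer: a fast subsequence converges almost everywhere, and Fatou applied to
    [F (s j) - F k] hands the bound [a k] on to the limit, for every k and without loss. *)
Lemma L2_complete F (a : nat -> R) : vanishing a -> (forall k, L2 (F k)) ->
  (forall k m, (k <= m)%N -> L2norm (F m - F k) <= a k) ->
  exists2 f, L2 f & forall k, L2norm (f - F k) <= a k.
Proof.
move=> va lF cF.
have [s [sj [sa smono]]] := subsequence_le va (b := fun j => 2 ^- j)
  (fun j => ltac:(by rewrite invr_gt0 exprn_gt0)).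
have dG j : L2norm (F (s j.+1) - F (s j)) <= 2 ^- j.
  by apply: le_trans (cF _ _ (smono j)) _; exact: sa.
have [f fP] := L0_ae_cvg (ae_cauchy_fast (fun j => lF (s j)) dG).
have key k : L2 (f - F k) /\ L2norm (f - F k) <= a k.
  apply: (@L2norm_fatou (fun j => F (s j) - F k)).
  - by apply: le_trans (L2norm_ge0 _) (cF k k (leqnn k)).
  - by move=> j; exact: L2_B.
  - by exists k => j kj; apply: cF; exact: leq_trans kj (sj j).
  have eF : {ae mu, forall t : T, forall j, (F (s j) - F k : L0 R) t = F (s j) t - F k t}.
    by apply/ae_foralln => j; exact: L0_subE.
  apply: filterS3 fP eF (L0_subE f (F k)) => t ft et e2 e e0.
  have [N NP] := ft e e0; exists N => n Nn; rewrite et e2.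
  by rewrite opprB addrA subrK; exact: NP.
exists f; last by move=> k; have [] := key k.
by rewrite -(subrK (F 0%N) f); apply: L2_D => //; have [] := key 0%N.
Qed.

End completeness.

(** * Fourier coefficients, Bessel's inequality and the Hardy part of a function *)

Section fourier_expansion.
Variable R : realType.
Local Notation mu := (circle_measure R).
Local Notation T := (measurableTypeR R).
Local Notation twopi := (pi *+ 2 : R).
Local Notation "⟪ f , g ⟫" := (L2inner f g) (format "⟪ f ,  g ⟫").
Implicit Types (f g h : L0 R) (z w : R[i]) (m n : int).

Lemma L2_tpolM f s : L2 f -> L2 (f * tpol s).
Proof.
by move=> lf; rewrite mulrC; have [M bM] := bnd_tpol s; have [] := L2_bndM bM lf.
Qed.

(** The gateway from forms to values: uniqueness of Fourier coefficients and both bounds on the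
    symbol of T_f + K pass through it. *)
Lemma ae_Re_ge0_tpol f : L2 f -> (forall s, 0 <= Re ⟪f * tpol s, tpol s⟫) ->
  {ae mu, forall t : T, 0 <= Re (f t)}.
Proof.
move=> lf pf; apply: ae_ge0_tpol; first by have [] := L2_L1 lf.
move=> s; have := pf s; rewrite innerE /I /cintegral /=.
congr (_ <= _); rewrite /Rintegral; congr fine; apply: ae_eq_integral => //.
- by apply/measurable_EFinP; apply: measurable_ReP; exact: L0fun_measurable.
- apply/measurable_EFinP; apply: measurable_funM.
    by apply: measurable_ReP; exact: L0fun_measurable.
  by apply: measurable_funX; exact: (measurable_cnorm (measurable_tpolf s)).
apply: filterS (filterI (filterI (L0_mulE (f * tpol s) (L0conj (tpol s))) (L0_mulE f (tpol s)))
  (filterI (L0conjE (tpol s)) (tpolE s))) => t [[-> ->] [-> ->]] _.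
by rewrite -mulrA mul_conj Re_M /= mulr0 subr0.
Qed.

Lemma inner_mulchi f m n : ⟪f * chi R m, chi R n⟫ = ⟪f, chi R (n - m)⟫.
Proof. by rewrite !innerE !chi_conj -mulrA chiM opprB. Qed.

Lemma inner_tpol_eq0 f s1 s2 : L2 f -> (forall m, ⟪f, chi R m⟫ = 0) ->
  ⟪f * tpol s1, tpol s2⟫ = 0.
Proof.
move=> lf f0.
have key p : ⟪f * tpol s1, chi R p⟫ = 0.
  rewrite /tpol big_distrr /= inner_suml//.
  - by apply: big1 => q _; rewrite L0_scaleAr innerZl ?inner_mulchi ?f0 ?mulr0//;
      [exact: L2_mulchi|exact: L2_chi].
  - exact: L2_chi.
  - by move=> q _; rewrite L0_scaleAr; apply/L2_Z/L2_mulchi.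
have l1 := L2_tpolM s1 lf.
elim: s2 => [|p s ih]; first by rewrite /tpol big_nil inner0r.
rewrite {2}/tpol big_cons innerDr//; [|exact/L2_Z/L2_chi|exact: L2_tpol].
rewrite innerZr//; last exact: L2_chi.
by rewrite key mulr0 add0r ih.
Qed.

(** All forms <c f p, p> vanish, hence are nonnegative; the four choices c = 1, -1, i, -i pin the
    real and imaginary parts of [f] to 0. *)
Lemma L2_fourier_eq0 f : L2 f -> (forall m, ⟪f, chi R m⟫ = 0) -> f = 0.
Proof.
move=> lf f0.
have key c : {ae mu, forall t : T, 0 <= Re (c * f t)}.
  have : {ae mu, forall t : T, 0 <= Re (L0fun (c *: f) t)}.
    apply: ae_Re_ge0_tpol; first exact: L2_Z.
    move=> s; rewrite inner_tpol_eq0 ?lexx//; first exact: L2_Z.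
    by move=> m; rewrite innerZl ?f0 ?mulr0//; exact: L2_chi.
  by apply: filterS2 (L0_scaleE c f) => t ->.
apply/L0_eq; apply: filterS3 (filterI (key 1) (key (-1))) (filterI (key (0 +i* 1)) (key (0 -i* 1))) (L0_0E R).
move=> t [h1 h2] [h3 h4] ->; case: (f t) h1 h2 h3 h4 => a b /=.
move=> h1 h2 h3 h4; congr (_ +i* _); lra.
Qed.

Definition fcoef f (k : nat) : R[i] := ⟪f, chi R k%:Z⟫ * (twopi^-1)%:C.
(** Only frequencies k >= 0 occur, so for a general [f] these sums converge to its projection on H^2
    and not to [f]. *)
Definition fsum f (n : nat) : L0 R := \sum_(0 <= k < n) fcoef f k *: chi R k%:Z.

Lemma L2_lincomb (r : seq nat) (a : nat -> R[i]) : L2 (\sum_(k <- r) a k *: chi R k%:Z).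
Proof. by apply: L2_sum => k _; exact/L2_Z/L2_chi. Qed.

Lemma L2_fsum f (n : nat) : L2 (fsum f n). Proof. exact: L2_lincomb. Qed.

Lemma inner_lincomb (r : seq nat) (a : nat -> R[i]) m : uniq r ->
  ⟪\sum_(k <- r) a k *: chi R k%:Z, chi R m⟫ =
  if m \in [seq k%:Z | k <- r] then a `|m|%N * twopi%:C else 0.
Proof.
move=> ur; rewrite inner_suml; [|exact: L2_chi|by move=> k _; exact/L2_Z/L2_chi].
have E k : ⟪a k *: chi R k%:Z, chi R m⟫ = if k%:Z == m then a `|m|%N * twopi%:C else 0.
  rewrite innerZl ?inner_chi; [|exact: L2_chi|exact: L2_chi].
  by case: eqP => [<-|]; rewrite ?mulr0.
under eq_bigr do rewrite E.
case: ifPn => [/mapP[k kr ->]|mr].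
  rewrite (bigD1_seq k)//= eqxx big1 ?addr0// => j jk.
  by rewrite eqz_nat (negbTE jk).
rewrite big_seq big1// => k kr; case: eqP => // km; case/negP: mr.
by apply/mapP; exists k.
Qed.

Lemma L2norm_lincomb (r : seq nat) (a : nat -> R[i]) : uniq r ->
  L2norm (\sum_(k <- r) a k *: chi R k%:Z) ^+ 2 = \sum_(k <- r) nm (a k) ^+ 2 * twopi.
Proof.
elim: r => [_|k r ih /= /andP[kr ur]]; first by rewrite !big_nil L2norm0 expr0n.
rewrite !big_cons pythagoras; [|exact/L2_Z/L2_chi|exact: L2_lincomb|].
  rewrite ih//; congr (_ + _); rewrite L2normZ; last exact: L2_chi.
  by rewrite exprMn L2norm_chi.
rewrite inner_conj; [|exact: L2_lincomb|exact/L2_Z/L2_chi].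
rewrite innerZr; [|exact: L2_lincomb|exact: L2_chi].
rewrite inner_lincomb// ifF ?mulr0 ?rmorph0//.
apply/negbTE/mapP => -[j jr [kj]]; by rewrite kj jr in kr.
Qed.

Lemma mem_iotaZ m (i j : nat) : (m \in [seq k%:Z | k <- index_iota i j]) = (i%:Z <= m < j%:Z).
Proof.
apply/mapP/idP => [[k + ->]|]; first by rewrite mem_index_iota lez_nat ltz_nat.
move=> /andP[im mj]; have m0 : 0 <= m by apply: le_trans im.
exists `|m|%N; last by rewrite gez0_abs.
by rewrite mem_index_iota -lez_nat -ltz_nat gez0_abs// im.
Qed.

Lemma inner_fsum f (k : nat) m :
  ⟪fsum f k, chi R m⟫ = if 0 <= m < k%:Z then ⟪f, chi R m⟫ else 0.
Proof.
rewrite /fsum inner_lincomb ?iota_uniq// mem_iotaZ; case: ifP => // /andP[m0 _].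
rewrite /fcoef gez0_abs// -mulrA -rmorphM/= mulVf ?mulr1//.
by rewrite gt_eqF// twopi_gt0.
Qed.

Lemma bessel f (k : nat) : L2 f ->
  \sum_(0 <= j < k) nm (fcoef f j) ^+ 2 * twopi <= L2norm f ^+ 2.
Proof.
move=> lf; rewrite -L2norm_lincomb ?iota_uniq// -/(fsum f k).
rewrite -[in leRHS](subrK (fsum f k) f) pythagoras.
- by rewrite lerDr sqr_ge0.
- by apply: L2_B => //; exact: L2_fsum.
- exact: L2_fsum.
have lB : L2 (f - fsum f k) by apply: L2_B => //; exact: L2_fsum.
rewrite inner_conj//; last exact: L2_fsum.
rewrite {1}/fsum inner_suml//; last by move=> j _; exact/L2_Z/L2_chi.
rewrite big_nat big1 ?rmorph0// => j /andP[_ jk].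
rewrite innerZl//; last exact: L2_chi.
rewrite inner_conj ?innerBl ?inner_fsum ?lez_nat ?ltz_nat ?jk ?subrr ?rmorph0 ?mulr0//;
  by [exact: L2_chi|exact: L2_fsum].
Qed.

(** By Bessel the partial sums of squares converge, and a term is the difference of two consecutive
    ones. This is the weak convergence of chi_k to 0, which later makes compact operators
    negligible. *)
Lemma fcoef_cvg0 f : L2 f -> vanishing (fun k => nm ⟪f, chi R k%:Z⟫).
Proof.
move=> lf e e0.
have e1 : 0 < e ^+ 2 / twopi by rewrite divr_gt0 ?exprn_gt0 ?twopi_gt0.
have := twopi_gt0 R => tp0.
have [l lP] : exists l : R, (fun k => \sum_(0 <= j < k) nm (fcoef f j) ^+ 2 * twopi) @ \oo --> l.
  apply/cvg_ex; apply: nondecreasing_is_cvgn.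
    move=> i j ij; rewrite (big_cat_nat (leq0n i) ij)/= lerDl sumr_ge0// => k _.
    by rewrite mulr_ge0 ?sqr_ge0// ltW.
  by exists (L2norm f ^+ 2) => _ [k _ <-]; exact: bessel.
have e2 : 0 < e ^+ 2 / twopi / 2 by rewrite divr_gt0.
have /cvgrPdist_le /(_ _ e2) [N _ NP] := lP.
exists N => k Nk; rewrite -ler_sqr ?nnegrE ?nm_ge0 ?(ltW e0)//.
have h := ler_normB (l - \sum_(0 <= j < k) nm (fcoef f j) ^+ 2 * twopi)
  (l - \sum_(0 <= j < k.+1) nm (fcoef f j) ^+ 2 * twopi).
have := le_trans h (lerD (NP _ Nk) (NP _ (leqW Nk))).
rewrite -splitr big_nat_recr//= (_ : _ - _ - _ = nm (fcoef f k) ^+ 2 * twopi); last by ring.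
rewrite /fcoef nmM nm_real (@ger0_norm _ (twopi^-1)) ?invr_ge0 ?(ltW tp0)//.
rewrite ger0_norm; last by rewrite mulr_ge0 ?sqr_ge0// ltW.
have q0 : 0 <= nm ⟪f, chi R k%:Z⟫ / twopi by rewrite divr_ge0 ?nm_ge0// ltW.
rewrite ler_pdivlMr// => h2; apply: le_trans h2; rewrite le_eqVlt; apply/orP; left; apply/eqP.
by move: (nm _) (twopi) tp0 => A P P0; field; rewrite gt_eqF.
Qed.

Lemma hardyP f : Hardy 2%:E f <-> L2 f /\ forall m, m < 0 -> ⟪f, chi R m⟫ = 0.
Proof.
split=> [[lf f0]|[lf f0]]; split => // m m0.
  by rewrite innerE chi_conj; apply: f0; rewrite oppr_gt0.
by have := f0 (- m); rewrite innerE chi_conj opprK oppr_lt0; exact.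
Qed.

(** Along Fourier partial sums, a pairing with a fixed character is eventually constant, so no limit
    of scalars has to be formed. *)
Lemma inner_cvg f F (a : nat -> R) h : L2 f -> L2 h -> (forall k, L2 (F k)) -> vanishing a ->
  (forall k, L2norm (f - F k) <= a k) -> forall z,
  (exists N, forall k, (N <= k)%N -> ⟪F k, h⟫ = z) -> ⟪f, h⟫ = z.
Proof.
move=> lf lh lF va fF z [N NP]; apply/eqP; rewrite -subr_eq0; apply/eqP/nm_eq0/eqP.
rewrite eq_le nm_ge0 andbT; apply/ler_addgt0Pr => e e0; rewrite add0r.
have e1 : 0 < e / (L2norm h + 1) by rewrite divr_gt0// ltr_wpDl ?L2norm_ge0.
have [M MP] := va _ e1.
rewrite -(NP (maxn N M)) ?leq_maxl// -innerBl//.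
apply: le_trans (nm_inner _ _) _ => //; first exact: L2_B.
have h1 := le_trans (fF (maxn N M)) (MP _ (leq_maxr _ _)).
rewrite ler_pdivlMr in h1; last by rewrite ltr_wpDl ?L2norm_ge0.
apply: le_trans h1; rewrite ler_wpM2l ?L2norm_ge0//.
by rewrite lerDl.
Qed.

(** The limit [y] is the orthogonal projection of [f] on H^2; this is where the projection comes
    from. *)
Lemma fsum_cvg f : L2 f -> exists y a, [/\ Hardy 2%:E y, vanishing a,
  forall k, L2norm (y - fsum f k) <= a k & forall m, 0 <= m -> ⟪y, chi R m⟫ = ⟪f, chi R m⟫].
Proof.
move=> lf; have tp0 := twopi_gt0 R.
pose s k := \sum_(0 <= j < k) nm (fcoef f j) ^+ 2 * twopi.
have smono i j : (i <= j)%N -> s i <= s j.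
  move=> ij; rewrite /s (big_cat_nat (leq0n i) ij)/= lerDl sumr_ge0// => k _.
  by rewrite mulr_ge0 ?sqr_ge0// ltW.
have [l lP] : exists l : R, s @ \oo --> l.
  apply/cvg_ex; apply: nondecreasing_is_cvgn => //.
  by exists (L2norm f ^+ 2) => _ [k _ <-]; exact: bessel.
have sl k : s k <= l.
  by rewrite -(cvg_lim _ lP)//; apply: nondecreasing_cvgn_le => //; apply/cvg_ex; exists l.
(* The root of the tail of the Bessel series, which is the rate that Pythagoras gives. *)
pose a k := Num.sqrt (l - s k).
have va : vanishing a.
  move=> e e0; have /cvgrPdist_le /(_ _ (exprn_gt0 2 e0)) [N _ NP] := lP.
  exists N => k Nk; rewrite /a -(ger0_norm (ltW e0)) -sqrtr_sqr ler_wsqrtr//.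
  by apply: le_trans (NP _ Nk); rewrite ler_norm.
have cF k (m : nat) : (k <= m)%N -> L2norm (fsum f m - fsum f k) <= a k.
  move=> km; rewrite /fsum (big_cat_nat (leq0n k) km)/= addrAC subrr add0r.
  rewrite -(ger0_norm (L2norm_ge0 _)) -sqrtr_sqr ler_wsqrtr// L2norm_lincomb ?iota_uniq//.
  have : s m <= l by [].
  by rewrite /s (big_cat_nat (leq0n k) km)/= -/(s k) -lerBrDl.
have [y ly yP] := L2_complete va (L2_fsum f) cF.
have yE m : ⟪y, chi R m⟫ = if 0 <= m then ⟪f, chi R m⟫ else 0.
  apply: (inner_cvg ly (L2_chi R m) (L2_fsum f) va yP).
  exists `|m|.+1 => k mk; rewrite inner_fsum.
  case: ifP => [/andP[-> _]//|]; case: ifP => //= m0 /negbT; rewrite -leNgt => h.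
  by move: mk; rewrite -ltz_nat gez0_abs// ltNge h.
exists y, a; split => //.
  by apply/hardyP; split => // m; rewrite yE ltNge => /negbTE ->.
by move=> m m0; rewrite yE m0.
Qed.

Lemma hardy_fsum f : Hardy 2%:E f -> vanishing (fun k => L2norm (f - fsum f k)).
Proof.
move=> hf; have [lf f0] := (hardyP f).1 hf.
have [y [a [/hardyP[ly y0] va yP yE]]] := fsum_cvg lf.
have -> : f = y.
  apply/eqP; rewrite -subr_eq0; apply/eqP/L2_fourier_eq0; first exact: L2_B.
  move=> m; rewrite innerBl//; last exact: L2_chi.
  by case: (ltP m 0) => m0; [rewrite f0// y0// subrr|rewrite yE// subrr].
move=> e /va[N NP]; exists N => k Nk; apply: le_trans (NP _ Nk).
suff -> : fsum y k = fsum f k by exact: yP.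
by rewrite /fsum; apply: eq_bigr => j _; rewrite /fcoef yE.
Qed.

Lemma inner_hardy_eq0 f h : L2 f -> Hardy 2%:E h ->
  (forall m, 0 <= m -> ⟪f, chi R m⟫ = 0) -> ⟪f, h⟫ = 0.
Proof.
move=> lf hh f0; have [lh _] := (hardyP h).1 hh.
rewrite inner_conj// (@inner_cvg h (fsum h) _ f lh lf (L2_fsum h) (hardy_fsum hh) (fun k => lexx _) 0).
  by rewrite rmorph0.
exists 0%N => k _; rewrite inner_suml//; last by move=> j _; exact/L2_Z/L2_chi.
apply: big1 => j _; rewrite innerZl//; last exact: L2_chi.
by rewrite inner_conj ?f0 ?rmorph0 ?mulr0//; exact: L2_chi.
Qed.

End fourier_expansion.

(** * The Hardy space and Toeplitz operators *)

Section hardy_space.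
Variable R : realType.
Local Notation "⟪ f , g ⟫" := (L2inner f g) (format "⟪ f ,  g ⟫").
Implicit Types (f g h : L0 R) (x y : H2 R) (z w c : R[i]).

Definition hnorm x : R := L2norm (H2val x).
Definition hip x y : R[i] := ⟪H2val x, H2val y⟫.

Lemma H2normE x : `|x| = (hnorm x)%:C. Proof. by []. Qed.

Lemma L2_H2 x : L2 (H2val x). Proof. by have [] := H2valP x. Qed.

Lemma H2valD x y : H2val (x + y) = H2val x + H2val y. Proof. by []. Qed.
Lemma H2valZ c x : H2val (c *: x) = c *: H2val x. Proof. by []. Qed.
Lemma H2valN x : H2val (- x) = - H2val x. Proof. by []. Qed.
Lemma H2valB x y : H2val (x - y) = H2val x - H2val y. Proof. by []. Qed.
Lemma H2val0 : H2val (0 : H2 R) = 0. Proof. by []. Qed.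
Lemma H2val_inj : injective (@H2val R). Proof. exact: val_inj. Qed.

Lemma hnorm_ge0 x : 0 <= hnorm x. Proof. exact: L2norm_ge0. Qed.
Lemma hnorm0 : hnorm 0 = 0. Proof. exact: L2norm0. Qed.
Lemma hnormD x y : hnorm (x + y) <= hnorm x + hnorm y.
Proof. exact: (L2normD (L2_H2 x) (L2_H2 y)). Qed.
Lemma hnormZ c x : hnorm (c *: x) = nm c * hnorm x.
Proof. exact: (L2normZ c (L2_H2 x)). Qed.
Lemma hnormN x : hnorm (- x) = hnorm x.
Proof. exact: (L2normN (L2_H2 x)). Qed.
Lemma hnormBC x y : hnorm (x - y) = hnorm (y - x).
Proof. by rewrite -hnormN opprB. Qed.
Lemma hnormB x y : hnorm (x - y) <= hnorm x + hnorm y.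
Proof. by rewrite -(hnormN y); exact: hnormD. Qed.
Lemma hnorm_triangle x y u : hnorm (x - y) <= hnorm (x - u) + hnorm (u - y).
Proof. by rewrite -[x - y](subrKA u); exact: hnormD. Qed.
Lemma hnorm_eq0 x : hnorm x = 0 -> x = 0.
Proof. by move=> h; apply: H2val_inj; exact: (L2norm_eq0 (L2_H2 x) h). Qed.

Lemma hip_conj x y : hip y x = (hip x y)^*.
Proof. exact: (inner_conj (L2_H2 x) (L2_H2 y)). Qed.
Lemma hip_self x : hip x x = (hnorm x ^+ 2)%:C.
Proof. exact: inner_self (L2_H2 x). Qed.
Lemma nm_hip x y : nm (hip x y) <= hnorm x * hnorm y.
Proof. exact: (nm_inner (L2_H2 x) (L2_H2 y)). Qed.
Lemma hipDl x y u : hip (x + y) u = hip x u + hip y u.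
Proof. by apply: innerDl; exact: L2_H2. Qed.
Lemma hipZl c x u : hip (c *: x) u = c * hip x u.
Proof. by apply: innerZl; exact: L2_H2. Qed.
Lemma hipBl x y u : hip (x - y) u = hip x u - hip y u.
Proof. by apply: innerBl; exact: L2_H2. Qed.
Lemma hipDr x y u : hip u (x + y) = hip u x + hip u y.
Proof. by apply: innerDr; exact: L2_H2. Qed.
Lemma hipZr c x u : hip u (c *: x) = conjc c * hip u x.
Proof. by apply: innerZr; exact: L2_H2. Qed.
Lemma hipBr x y u : hip u (x - y) = hip u x - hip u y.
Proof. by apply: innerBr; exact: L2_H2. Qed.
Lemma hip0l x : hip 0 x = 0. Proof. exact: inner0l. Qed.
Lemma hip0r x : hip x 0 = 0. Proof. exact: inner0r. Qed.

Lemma hip_ext x y : (forall u, hip x u = hip y u) -> x = y.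
Proof.
move=> xy; apply/eqP; rewrite -subr_eq0; apply/eqP/hnorm_eq0.
apply/eqP; rewrite -sqrf_eq0; apply/eqP/(@complexI R).
by rewrite -hip_self hipBl xy subrr.
Qed.

Definition toH2 f (hf : Hardy 2%:E f) : H2 R := MkH2 (mem_set hf).

Lemma H2_complete (F : nat -> H2 R) (a : nat -> R) : vanishing a ->
  (forall k m, (k <= m)%N -> hnorm (F m - F k) <= a k) ->
  exists x, forall k, hnorm (x - F k) <= a k.
Proof.
move=> va cF.
have [f lf fP] := L2_complete va (fun k => L2_H2 (F k)) cF.
suff hf : Hardy 2%:E f by exists (toH2 hf).
apply/hardyP; split => // m m0.
apply: (inner_cvg lf (L2_chi R m) (fun k => L2_H2 (F k)) va fP).
by exists 0%N => k _; have [_] := (hardyP _).1 (H2valP (F k)); apply.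
Qed.

Lemma hardy_proj f : L2 f -> exists y, forall u, ⟪f - H2val y, H2val u⟫ = 0.
Proof.
move=> lf; have [y [a [hy _ _ yE]]] := fsum_cvg lf.
have ly := ((hardyP y).1 hy).1.
exists (toH2 hy) => u; apply: inner_hardy_eq0; [exact: L2_B|exact: H2valP|].
by move=> m m0; rewrite innerBl ?yE ?subrr//; exact: L2_chi.
Qed.

Lemma H2projP f : L2 f -> forall u, ⟪f - H2val (H2proj f), H2val u⟫ = 0.
Proof.
by move=> /hardy_proj[y yP]; apply: (@xgetPex _ 0 [set y : H2 R |
  forall z : H2 R, L2inner (f - H2val y) (H2val z) = 0]); exists y.
Qed.

Lemma hip_proj f u : L2 f -> hip (H2proj f) u = ⟪f, H2val u⟫.
Proof.
move=> lf; have := H2projP lf u; rewrite innerBl//; [|exact: L2_H2|exact: L2_H2].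
by move/eqP; rewrite subr_eq0 => /eqP.
Qed.

Lemma H2proj_lin c f g : L2 f -> L2 g ->
  H2proj (c *: f + g) = c *: H2proj f + H2proj g.
Proof.
move=> lf lg; apply: hip_ext => u.
rewrite hip_proj; last exact: L2_lin.
by rewrite hipDl hipZl !hip_proj// inner_lin//; exact: L2_H2.
Qed.

Lemma hnorm_proj f : L2 f -> hnorm (H2proj f) <= L2norm f.
Proof.
move=> lf; have [->|n0] := eqVneq (hnorm (H2proj f)) 0; first exact: L2norm_ge0.
have np : 0 < hnorm (H2proj f) by rewrite lt_def n0 hnorm_ge0.
rewrite -(ler_pM2r np) -expr2.
have -> : hnorm (H2proj f) ^+ 2 = nm (hip (H2proj f) (H2proj f)).
  by rewrite hip_self nm_real ger0_norm ?sqr_ge0.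
by rewrite hip_proj//; apply: nm_inner => //; exact: L2_H2.
Qed.

Lemma H2proj_id x : H2proj (H2val x) = x.
Proof. by apply: hip_ext => u; rewrite hip_proj//; exact: L2_H2. Qed.

Section toeplitz_theory.
Variables (M : R) (f : L0 R).
Hypothesis bf : bnd M f.

Let lfx x : L2 (f * H2val x). Proof. by have [] := L2_bndM bf (L2_H2 x). Qed.

Lemma hip_toeplitz x y : hip (toeplitz f x) y = ⟪f * H2val x, H2val y⟫.
Proof. exact: hip_proj. Qed.

Lemma toeplitz_lin c x y : toeplitz f (c *: x + y) = c *: toeplitz f x + toeplitz f y.
Proof. by rewrite /toeplitz H2valD H2valZ mulrDr L0_scaleAr H2proj_lin. Qed.

Lemma hnorm_toeplitz x : hnorm (toeplitz f x) <= M * hnorm x.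
Proof. by apply: le_trans (hnorm_proj (lfx x)) _; have [] := L2_bndM bf (L2_H2 x). Qed.

Lemma toeplitz_adj x y : hip (toeplitz f x) y = hip x (toeplitz (L0conj f) y).
Proof.
rewrite hip_toeplitz inner_mull hip_conj.
have lc : L2 (L0conj f * H2val y) by have [] := L2_bndM (bnd_conj bf) (L2_H2 y).
by rewrite hip_proj// (inner_conj lc)//; exact: L2_H2.
Qed.

End toeplitz_theory.

Lemma toeplitzD M N f g x : bnd M f -> bnd N g -> toeplitz (f + g) x = toeplitz f x + toeplitz g x.
Proof.
move=> bf bg; apply: hip_ext => u; have bfg := bndD bf bg.
rewrite hipDl (hip_toeplitz bf) (hip_toeplitz bg) (hip_toeplitz bfg) mulrDl innerDl//.
- by have [] := L2_bndM bf (L2_H2 x).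
- by have [] := L2_bndM bg (L2_H2 x).
- exact: L2_H2.
Qed.

Lemma toeplitzZ M c f x : bnd M f -> toeplitz (c *: f) x = c *: toeplitz f x.
Proof.
move=> bf; apply: hip_ext => u; have bcf := bndZ c bf.
rewrite hipZl (hip_toeplitz bf) (hip_toeplitz bcf) L0_scaleAl innerZl//.
  by have [] := L2_bndM bf (L2_H2 x).
exact: L2_H2.
Qed.

Lemma toeplitz1 x : toeplitz 1 x = x.
Proof. by rewrite /toeplitz mul1r H2proj_id. Qed.

Lemma toeplitz0 x : toeplitz 0 x = 0.
Proof. by rewrite -(scale0r 0) (toeplitzZ 0 x (bnd0 R)) scale0r. Qed.

Lemma toeplitzN M f x : bnd M f -> toeplitz (- f) x = - toeplitz f x.
Proof. by move=> bf; rewrite -scaleN1r (toeplitzZ _ _ bf) scaleN1r. Qed.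

Lemma toeplitzB M N f g x : bnd M f -> bnd N g -> toeplitz (f - g) x = toeplitz f x - toeplitz g x.
Proof. by move=> bf bg; rewrite (toeplitzD x bf (bndN bg)) (toeplitzN x bg). Qed.

Lemma near_hnormP x (U : set (H2 R)) :
  nbhs x U <-> exists2 e : R, 0 < e & forall y, hnorm (x - y) < e -> U y.
Proof.
split.
  move=> /nbhs_normP[e /= e0 eU]; exists (Re e).
    by move: e0; rewrite ltcE => /andP[].
  move=> y xy; apply: eU => /=; rewrite H2normE ltcE /=.
  by move: e0; rewrite ltcE /= => /andP[/eqP -> _]; rewrite eqxx.
move=> [e e0 eU]; apply/nbhs_normP; exists e%:C => /=; first by rewrite ltcR.
by move=> y /=; rewrite H2normE ltcR; exact: eU.
Qed.

Lemma closure_hnormP (S : set (H2 R)) x :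
  closure S x <-> forall e : R, 0 < e -> exists2 y, S y & hnorm (x - y) < e.
Proof.
split=> [cS e e0|h U /near_hnormP[e e0 eU]].
  have [|y [Sy xy]] := cS [set y | hnorm (x - y) < e]; last by exists y.
  by apply/near_hnormP; exists e.
by have [y Sy xy] := h e e0; exists y; split => //; exact: eU.
Qed.

(** Total boundedness of the image of the unit ball. The centres need not lie in the image, so nets
    can be transported through sums, compositions and norm limits. *)
Definition fin_net (A : H2 R -> H2 R) := forall e : R, 0 < e ->
  exists s : seq (H2 R), forall x, hnorm x <= 1 -> exists2 y, y \in s & hnorm (A x - y) <= e.

Lemma compact_fin_net A : compact_operator A -> linear A /\ fin_net A.
Proof.
move=> [lA]; rewrite precompactE compact_cover => cA; split => // e e0.
have [||D _ DP] := cA _ setT (fun y => [set z | hnorm (z - y) < e]).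
- move=> y _; rewrite openE => z /= zy; apply/near_hnormP.
  exists (e - hnorm (z - y)); first by rewrite subr_gt0.
  move=> u zu /=; apply: le_lt_trans (hnorm_triangle _ _ z) _.
  by rewrite hnormBC -ltrBrDr.
- move=> z _; exists z => //=; by rewrite subrr hnorm0.
exists (finmap.enum_fset D) => x x1.
have [|y /= Dy xy] := DP (A x).
  apply: subset_closure; exists x => //=; by rewrite H2normE lecR.
by exists y => //; exact: ltW.
Qed.

Lemma ultra_seq (F : set_system (H2 R)) (s : seq (H2 R)) (B : H2 R -> set (H2 R)) :
  UltraFilter F -> F (fun z : H2 R => exists2 y, y \in s & B y z) ->
  exists2 y, y \in s & F (B y).
Proof.
move=> uF; elim: s => [|y s ih] Fs.
  by have /filter_ex[z []] : F (fun z : H2 R => exists2 y, y \in [::] & B y z) by [].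
have [FB|FB] := in_ultra_setVsetC (B y) uF.
  by exists y => //; rewrite mem_head.
have [|u us Fu] := ih; last by exists u => //; rewrite inE us orbT.
apply: filterS2 Fs FB => z [u]; rewrite inE => /orP[/eqP -> //|us] Bu _.
by exists u.
Qed.

Lemma vanishing_geo (c : R) : 0 <= c -> vanishing (fun n => c * 2 ^- n).
Proof.
move=> c0 e e0; exists (Num.truncn (c / e)).+1 => n Nn.
rewrite ler_pdivrMr ?exprn_gt0//.
have h1 : c / e < n%:R by apply: lt_le_trans (truncnS_gt _) _; rewrite ler_nat.
have h2 : n%:R <= 2 ^+ n :> R by rewrite -natrX ler_nat ltnW// ltn_expl.
rewrite ltr_pdivrMr// in h1; apply: le_trans (ltW h1) _.
by rewrite mulrC ler_pM2l.
Qed.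

(** An ultrafilter on the image selects one ball of the net at each scale 2^-n. Any two selected
    balls meet, so the centres form a Cauchy sequence, and its limit is the limit of the
    ultrafilter. *)
Lemma fin_net_compact A : linear A -> fin_net A -> compact_operator A.
Proof.
move=> lA nA; split => //; rewrite precompactE compact_ultra => F uF FS.
set S := A @` _ in FS *.
have r0 n : 0 < 2 ^- n :> R by rewrite invr_gt0 exprn_gt0.
have /choice[s sP] : forall n : nat, exists s : seq (H2 R), forall x, hnorm x <= 1 ->
    exists2 y, y \in s & hnorm (A x - y) <= 2 ^- n.
  by move=> n; exact: nA.
(* The radius is doubled because the ultrafilter lives on the closure of the image. *)
have /choice[y yP] : forall n : nat, exists y, F [set z | hnorm (z - y) <= 2 * 2 ^- n].
  move=> n; have [|y _ Fy] := @ultra_seq F (s n) (fun y => [set z | hnorm (z - y) <= 2 * 2 ^- n]) uF.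
    apply: filterS FS => z /closure_hnormP/(_ _ (r0 n))[_ [x x1 <-] zAx].
    rewrite /= H2normE lecR in x1.
    have [u us Axu] := sP n x x1; exists u => //=.
    apply: le_trans (hnorm_triangle _ _ (A x)) _.
    by rewrite mulr_natl mulr2n lerD// ltW.
  by exists y.
have yy k m : (k <= m)%N -> hnorm (y m - y k) <= 4 * 2 ^- k.
  move=> km; have FI : F ([set z | hnorm (z - y m) <= 2 * 2 ^- m] `&` [set z | hnorm (z - y k) <= 2 * 2 ^- k]) by exact: filterI.
  have [z [h1 h2]] := filter_ex FI.
  apply: le_trans (hnorm_triangle _ _ z) _; rewrite hnormBC.
  apply: le_trans (lerD h1 h2) _.
  have : 2 ^- m <= 2 ^- k :> R by rewrite lef_pV2 ?posrE ?exprn_gt0// ler_eXn2l// ltr1n.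
  lra.
have [x xP] := H2_complete (vanishing_geo (ler0n _ 4)) yy.
have Fx : F --> x.
  move=> U /near_hnormP[e e0 eU].
  have [n nP] := vanishing_geo (ler0n R 6) (divr_gt0 e0 (ltr0Sn R 1)).
  apply: filterS (yP n) => z zy; apply: eU.
  apply: le_lt_trans (hnorm_triangle _ _ (y n)) _.
  rewrite [hnorm (y n - z)]hnormBC; apply: le_lt_trans (lerD (xP n) zy) _.
  have := nP n (leqnn n).
  have : e / 2 < e by rewrite ltr_pdivrMr// ltr_pMr// ltr1n.
  lra.
exists x; split; last exact: Fx.
apply: (@closed_closure _ S) => U /Fx FU.
have FI : F (closure S `&` U) by exact: filterI.
by have [z [h1 h2]] := filter_ex FI; exists z.
Qed.

End hardy_space.

(** * H^infty + C and QC *)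

Section QC_algebra.
Variable R : realType.
Local Notation mu := (circle_measure R).
Local Notation T := (measurableTypeR R).
Local Notation twopi := (pi *+ 2 : R).
Local Notation "⟪ f , g ⟫" := (L2inner f g) (format "⟪ f ,  g ⟫").
Implicit Types (f g h : L0 R) (x y : H2 R) (z w c : R[i]) (m : int).

Definition CP (g : R -> R[i]^o) := continuous g /\ periodic g twopi.

Lemma CP_lin c (g k : R -> R[i]^o) : CP g -> CP k -> CP (fun t => c * g t + k t).
Proof.
move=> [/continuous_nmP cg pg] [/continuous_nmP ck pk]; split; last by move=> t; rewrite pg pk.
apply/continuous_nmP => x e e0.
have e1 : 0 < e / (2 * (nm c + 1)) by rewrite divr_gt0// mulr_gt0// ltr_wpDl ?nm_ge0.
have e2 : 0 < e / 2 by rewrite divr_gt0.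
apply: filterS2 (cg x _ e1) (ck x _ e2) => y gy ky.
have -> : c * g x + k x - (c * g y + k y) = c * (g x - g y) + (k x - k y).
  by rewrite mulrBr opprD !addrA; congr (_ + _); rewrite addrAC.
apply: le_lt_trans (nmD _ _) _; rewrite [e]splitr ler_ltD// nmM.
rewrite ltr_pdivlMr in gy; last by rewrite mulr_gt0// ltr_wpDl ?nm_ge0.
rewrite ler_pdivlMr//; apply: le_trans (ltW gy).
have := nm_ge0 (g x - g y); have := nm_ge0 c.
by move: (nm c) (nm _) => A B A0 B0; nra.
Qed.

Lemma CP_mul (g k : R -> R[i]^o) : CP g -> CP k -> CP (fun t => (g t : R[i]) * k t).
Proof.
move=> [/continuous_nmP cg pg] [/continuous_nmP ck pk]; split; last by move=> t; rewrite pg pk.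
apply/continuous_nmP => x e e0.
pose a := nm (g x); pose b := nm (k x).
have a0 : 0 <= a := nm_ge0 _; have b0 : 0 <= b := nm_ge0 _.
have e1 : 0 < e / (2 * (b + 1)) by rewrite divr_gt0// mulr_gt0// ltr_wpDl.
have e2 : 0 < e / (2 * (a + 1)) by rewrite divr_gt0// mulr_gt0// ltr_wpDl.
apply: filterS3 (cg x _ e1) (ck x _ e2) (ck x _ ltr01) => y gy ky k1.
have -> : (g x : R[i]) * k x - (g y : R[i]) * k y = (g x : R[i]) * (k x - k y) + (g x - g y : R[i]) * k y.
  by rewrite mulrBr mulrBl addrA subrK.
apply: le_lt_trans (nmD _ _) _; rewrite !nmM -/a.
rewrite ltr_pdivlMr in gy; last by rewrite mulr_gt0// ltr_wpDl.
rewrite ltr_pdivlMr in ky; last by rewrite mulr_gt0// ltr_wpDl.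
have kb : nm (k y) <= b + 1.
  have -> : nm (k y) = nm (k x - (k x - k y)) by congr nm; rewrite opprB addrC subrK.
  by apply: le_trans (nmD _ _) _; rewrite nmN lerD// ltW.
have n1 := nm_ge0 (g x - g y); have n2 := nm_ge0 (k x - k y); have n3 := nm_ge0 (k y).
move: n1 n2 n3 gy ky kb; move: (nm (g x - g y)) (nm (k x - k y)) (nm (k y)) => A B D.
move=> A0 B0 D0 h1 h2 h3.
have : A * D <= A * (b + 1) by rewrite ler_wpM2l.
nra.
Qed.

Lemma CP_cst c : CP (fun _ => c).
Proof. by split => // t; exact: cvg_cst. Qed.

Lemma CP_tpolf s : CP (tpolf s).
Proof.
elim: s => [|p s ih].
  rewrite (_ : tpolf _ = fun _ => 0); first exact: CP_cst.
  by apply/funext => t; rewrite /tpolf big_nil.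
rewrite (_ : tpolf _ = fun t => p.1 * cexp (p.2%:~R * t) + tpolf s t); last first.
  by apply/funext => t; rewrite /tpolf big_cons.
apply: (@CP_lin p.1 (fun t => cexp (p.2%:~R * t))) => //; split; last first.
  by move=> t; rewrite mulrDr cexpD cexp_per mulr1.
apply/continuous_nmP => t e e0; have e2 : 0 < e / 2 by rewrite divr_gt0.
have cl : continuous (fun y : R => p.2%:~R * y).
  by move=> y; apply: cvgM; [exact: cvg_cst|exact: cvg_id].
have c1 : continuous (fun y : R => cos (p.2%:~R * y)).
  by move=> y; apply: (@continuous_comp _ _ _ (fun y : R => p.2%:~R * y) cos); [exact: cl|exact: continuous_cos].
have c2 : continuous (fun y : R => sin (p.2%:~R * y)).
  by move=> y; apply: (@continuous_comp _ _ _ (fun y : R => p.2%:~R * y) sin); [exact: cl|exact: continuous_sin].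
have /cvgrPdist_lt /(_ _ e2) h1 := c1 t.
have /cvgrPdist_lt /(_ _ e2) h2 := c2 t.
apply: filterS2 h1 h2 => y h1 h2.
apply: le_lt_trans (nm_le_ReIm _) _; rewrite [e]splitr.
by rewrite Re_D Im_D Re_N Im_N /= ltrD.
Qed.

Lemma CTP f : CT f <-> exists2 g : R -> R[i]^o, CP g & {ae mu, forall t : T, f t = g t}.
Proof.
by split=> [[g [cg pg fg]]|[g [cg pg] fg]]; exists g.
Qed.

Lemma CT_class (g : R -> R[i]^o) (cg : CP g) : CT (L0class (measurable_continuous cg.1)).
Proof. by apply/CTP; exists g => //; exact: L0classE. Qed.

Lemma CT_lin c f g : CT f -> CT g -> CT (c *: f + g).
Proof.
move=> /CTP[u cu fu] /CTP[v cv gv]; apply/CTP; exists (fun t => c * u t + v t).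
  exact: CP_lin.
by apply: filterS3 (L0_linE c f g) fu gv => t -> -> ->.
Qed.

Lemma CT_mul f g : CT f -> CT g -> CT (f * g).
Proof.
move=> /CTP[u cu fu] /CTP[v cv gv]; apply/CTP; exists (fun t => (u t : R[i]) * v t).
  exact: CP_mul.
by apply: filterS3 (L0_mulE f g) fu gv => t -> -> ->.
Qed.

Lemma CT_tpol (s : seq (R[i] * int)) : CT (tpol s).
Proof. by apply/CTP; exists (tpolf s); [exact: CP_tpolf|exact: tpolE]. Qed.

Lemma CT_0 : CT (0 : L0 R).
Proof. by have := CT_tpol [::]; rewrite /tpol big_nil. Qed.

Lemma CT_bnd f : CT f -> exists2 M, 0 <= M & bnd M f.
Proof.
move=> /CTP[g [cg _] fg]; have [M M0 MP] := bounded_segment cg.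
by exists M => //; apply: filterS2 fg (ae_circle_le R) => t -> /MP.
Qed.

Lemma chi_tpol m : chi R m = tpol [:: (1, m)].
Proof. by rewrite /tpol big_seq1 scale1r. Qed.

Lemma CT_approx f (e : R) : CT f -> 0 < e -> exists s, bnd e (f - tpol s).
Proof.
move=> /CTP[g [cg pg] fg] e0; have [s sP] := CT_tpol_approx cg pg e0.
exists s; apply: filterS (filterI (filterI fg (ae_circle_le R)) (filterI (L0_subE f (tpol s)) (tpolE s))).
by move=> t [[fgt t01] [-> ->]]; rewrite fgt nmBC; exact: sP.
Qed.

Definition Hinf f := Hardy +oo%E f.

Lemma HinfP f : Hinf f <-> (exists M, bnd M f) /\ forall m, m < 0 -> ⟪f, chi R m⟫ = 0.
Proof.
split=> [[/LinfP[M M0 bM] f0]|[[M bM] f0]].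
  split=> [|m m0]; first by exists M.
  by rewrite innerE chi_conj; apply: f0; rewrite oppr_gt0.
split; first by apply/LinfP; exists M => //; exact: bnd_ge0 bM.
by move=> m m0; have := f0 (- m); rewrite innerE chi_conj opprK oppr_lt0; exact.
Qed.

Lemma Hinf_hardy f : Hinf f -> Hardy 2%:E f.
Proof. by move=> /HinfP[[M bM] f0]; apply/hardyP; split => //; exact: L2_bnd bM. Qed.

Lemma Hinf_L2 f : Hinf f -> L2 f.
Proof. by move=> /Hinf_hardy[]. Qed.

Lemma Hinf_lin c f g : Hinf f -> Hinf g -> Hinf (c *: f + g).
Proof.
move=> /[dup] /Hinf_L2 lf /HinfP[[M bM] f0] /[dup] /Hinf_L2 lg /HinfP[[N bN] g0]; apply/HinfP; split.
  by exists (nm c * M + N); apply: bndD => //; exact: bndZ.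
by move=> m m0; rewrite inner_lin ?f0 ?g0 ?mulr0 ?addr0//; exact: L2_chi.
Qed.

Lemma Hinf_0 : Hinf 0.
Proof. by apply/HinfP; split; [exists 0; exact: bnd0|move=> m _; exact: inner0l]. Qed.

Lemma Hinf_D f g : Hinf f -> Hinf g -> Hinf (f + g).
Proof. by move=> hf hg; rewrite -[f]scale1r; exact: Hinf_lin. Qed.

Lemma Hinf_B f g : Hinf f -> Hinf g -> Hinf (f - g).
Proof. by move=> hf hg; rewrite addrC -scaleN1r; exact: Hinf_lin. Qed.

Lemma Hinf_chi (k : nat) : Hinf (chi R k).
Proof.
apply/HinfP; split; first by exists 1; exact: bnd_chi.
by move=> m m0; rewrite inner_chi; case: eqP => // km; move: m0; rewrite -km.
Qed.

Lemma Hinf_closed f : (forall e : R, 0 < e -> exists2 h, Hinf h & bnd e (f - h)) -> Hinf f.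
Proof.
move=> cf; have [h0 /HinfP[[M bM] _] b0] := cf 1 ltr01.
have bf : bnd (1 + M) f by rewrite -(subrK h0 f); exact: bndD.
have lf := L2_bnd bf.
apply/HinfP; split => [|m m0]; first by exists (1 + M).
have r0 n : 0 < 2 ^- n :> R by rewrite invr_gt0 exprn_gt0.
have /choice[h hP] : forall n : nat, exists h, Hinf h /\ bnd (2 ^- n) (f - h).
  by move=> n; have [h hh bh] := cf _ (r0 n); exists h.
apply: (@inner_cvg R f h (fun n => L2norm (1 : L0 R) * 2 ^- n) (chi R m) lf (L2_chi R m)).
- by move=> k; apply: Hinf_L2; have [] := hP k.
- by apply: vanishing_geo; exact: L2norm_ge0.
- move=> k; have [_ bk] := hP k; have [_] := L2_bndM bk (L2_1 R).
  by rewrite mulr1 mulrC.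
- by exists 0%N => k _; have [/HinfP[_ ->]] := hP k.
Qed.

(** For a partial sum of [g], the coefficient at m < 0 of the product is a combination of
    coefficients of [f] at m - k with k >= 0, all of them zero. *)
Lemma Hinf_hardyM f g : Hinf f -> Hardy 2%:E g -> Hardy 2%:E (f * g).
Proof.
move=> /HinfP[[M bM] f0] hg; have lg := hg.1.
apply/hardyP; split; first by have [] := L2_bndM bM lg.
move=> m m0; rewrite inner_mull.
have lc : L2 (L0conj f * chi R m) by have [] := L2_bndM (bnd_conj bM) (L2_chi R m).
apply: (@inner_cvg R g (fsum g) _ _ lg lc (L2_fsum g) (hardy_fsum hg) (fun k => lexx _)).
exists 0%N => k _; rewrite inner_suml//; last by move=> j _; exact/L2_Z/L2_chi.
apply: big1 => j _; rewrite innerZl//; last exact: L2_chi.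
rewrite -inner_mull inner_mulchi f0 ?mulr0//.
by rewrite subr_lt0 (lt_le_trans m0).
Qed.

Lemma Hinf_mul f g : Hinf f -> Hinf g -> Hinf (f * g).
Proof.
move=> hf hg; have [[M bM] _] := (HinfP f).1 hf; have [[N bN] _] := (HinfP g).1 hg.
apply/HinfP; split; first by exists (M * N); exact: bndM.
by have [_] := (hardyP _).1 (Hinf_hardyM hf (Hinf_hardy hg)).
Qed.

Lemma Hinf_tpol s : (forall p, p \in s -> p.2 < 0 -> p.1 = 0) -> Hinf (tpol s).
Proof.
elim: s => [_|p s ih sp]; first by rewrite /tpol big_nil; exact: Hinf_0.
rewrite /tpol big_cons; apply: Hinf_D; last first.
  by apply: ih => q qs; apply: sp; rewrite inE qs orbT.
have [p0|p0] := ltP p.2 0.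
  by rewrite sp ?mem_head// scale0r; exact: Hinf_0.
rewrite -[_ *: _]addr0; apply: Hinf_lin; last exact: Hinf_0.
by rewrite -[p.2]gez0_abs//; exact: Hinf_chi.
Qed.

Lemma Hinf_fejer n f : Hinf f -> Hinf (tpol (fejer_seq n f)).
Proof.
move=> /HinfP[_ f0]; apply: Hinf_tpol => p /allpairsP[[j k] [_ _ ->]] /= jk.
by have := f0 _ jk; rewrite innerE chi_conj opprB => ->; rewrite mulr0.
Qed.

Lemma tpol_fejerD n f g : L1 f -> L1 g ->
  tpol (fejer_seq n (f + g)) = tpol (fejer_seq n f) + tpol (fejer_seq n g).
Proof.
move=> lf lg; rewrite /tpol /fejer_seq !big_allpairs_dep/= -big_split/=.
apply: eq_bigr => j _; rewrite -big_split/=; apply: eq_bigr => k _.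
rewrite mulrDl I_D ?mulrDr ?scalerDl//; rewrite mulrC; exact: L1_bndM (bnd_chi _ _) _.
Qed.

Lemma Hinf_L1 f : Hinf f -> L1 f. Proof. by move=> /Hinf_L2; exact: L2_L1. Qed.

Lemma periodic_int (g : R -> R[i]) t m : periodic g twopi -> g (t + m%:~R * twopi) = g t.
Proof.
move=> pg; case: m => k; first by rewrite [_%:~R * _]mulr_natl periodicn.
have := periodicn pg k.+1 (t + (Negz k)%:~R * twopi).
by rewrite NegzE mulrNz mulNr -pmulrn mulr_natl subrK => ->.
Qed.

Lemma periodic_reduce (g : R -> R[i]) t : periodic g twopi ->
  exists2 s : R, 0 <= s <= twopi & g t = g s.
Proof.
move=> pg; have tp0 := twopi_gt0 R.
exists (t + (- Num.floor (t / twopi))%:~R * twopi); last by rewrite periodic_int.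
have /andP[h1 h2] := floor_itv (t / twopi).
rewrite rmorphN mulNr subr_ge0 lerBlDr -ler_pdivlMr// h1/=.
rewrite -[X in _ <= X + _]mul1r -mulrDl -ler_pdivrMr// addrC ltW//.
by move: h2; rewrite rmorphD.
Qed.

(* Zalcman-Rudin: the bound on [f] passes to the continuous summand, because
   Fejer means contract the sup norm and preserve [H^oo]. *)
Lemma HinfC_split f (M e : R) : HinfC f -> bnd M f -> 0 < e ->
  exists g : R -> R[i]^o, exists cg : CP g, (forall t, nm (g t) <= M + e) /\
    Hinf (f - L0class (measurable_continuous cg.1)).
Proof.
move=> [h hh [c Cc] hcf] bM e0.
have /CTP[g0 cg0 cg] := Cc.
have [N NP] := fejer_cvg cg0.1 cg0.2 cg e0.
(* Writing s_N for the Fejer mean, g = c - s_N c + s_N f. The first two terms nearly cancel, the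
   last is bounded by M, and f - g = h - s_N h stays in H^infty. *)
pose g t : R[i] := (-1) * tpolf (fejer_seq N c) t + g0 t + tpolf (fejer_seq N f) t.
have cpg : CP g.
  have := CP_lin 1 (CP_lin (-1) (CP_tpolf (fejer_seq N c)) cg0) (CP_tpolf (fejer_seq N f)).
  by rewrite /g; congr CP; apply/funext => t; rewrite mul1r.
exists g, cpg; split.
  move=> t; have [s s01 ->] := periodic_reduce t cpg.2.
  rewrite /g addrC; apply: le_trans (nmD _ _) _; rewrite lerD//.
    exact: fejer_bnd bM.
  by rewrite mulN1r addrC nmBC; exact: NP (leqnn N) s s01.
have [Mc _ bc] := CT_bnd Cc.
suff -> : f - L0class (measurable_continuous cpg.1) = h - tpol (fejer_seq N h).
  by apply: Hinf_B => //; exact: Hinf_fejer.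
have fD := tpol_fejerD N (Hinf_L1 hh) (L2_L1 (L2_bnd bc)).
rewrite hcf in fD.
have fE : {ae mu, forall t : T, f t = h t + c t} by rewrite -hcf; exact: L0_addE.
have -> : tpol (fejer_seq N h) = tpol (fejer_seq N f) - tpol (fejer_seq N c) by rewrite fD addrK.
rewrite opprB [h + _]addrA [_ - tpol _]addrC.
apply/L0_eq.
set u := L0class _.
apply: filterS (filterI (filterI (filterI (L0_subE f u) fE) (filterI (L0classE (measurable_continuous cpg.1)) cg))
  (filterI (filterI (L0_addE (- tpol (fejer_seq N f)) (h + tpol (fejer_seq N c))) (L0_oppE (tpol (fejer_seq N f))))
  (filterI (L0_addE h (tpol (fejer_seq N c))) (filterI (tpolE (fejer_seq N c)) (tpolE (fejer_seq N f)))))).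
move=> t [[[e1 e2] [e3 e4]] [[e5 e6] [e7 [e8 e9]]]].
rewrite e1 e5 e6 e7 e8 e9 /u e3 e2 e4 /g.
by move: (tpolf _ t) (tpolf _ t) (h t) (g0 t) => A B C D; ring.
Qed.

Lemma complex_cauchy_cvg (u : nat -> R[i]) (a : nat -> R) : vanishing a ->
  (forall k m : nat, (k <= m)%N -> nm (u m - u k) <= a k) -> exists l, forall k : nat, nm (l - u k) <= a k.
Proof.
move=> va cu.
have cauchy (p : R[i] -> R) : (forall z w, `|p z - p w| <= nm (z - w)) ->
    exists l : R, (fun n => p (u n)) @ \oo --> l.
  move=> pn; apply: real_cauchy_cvg => e /va[N NP]; exists N => m n Nm Nn.
  apply: le_trans (pn _ _) _; have [mn|/ltnW mn] := leqP m n.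
    by rewrite nmBC; apply: le_trans (cu _ _ mn) _; exact: NP.
  by apply: le_trans (cu _ _ mn) _; exact: NP.
have [r rP] := cauchy (@Re R) (fun z w => ltac:(by rewrite -Re_N -Re_D; exact: Re_le_nm)).
have [i iP] := cauchy (@Im R) (fun z w => ltac:(by rewrite -Im_N -Im_D; exact: Im_le_nm)).
exists (r +i* i) => k; apply/ler_addgt0Pr => e e0; have e2 : 0 < e / 2 by rewrite divr_gt0.
have /cvgrPdist_le /(_ _ e2) [N1 _ N1P] := rP.
have /cvgrPdist_le /(_ _ e2) [N2 _ N2P] := iP.
pose N := maxn k (maxn N1 N2).
rewrite -(subrK (u N) (r +i* i)) -addrA; apply: le_trans (nmD _ _) _.
rewrite [leRHS]addrC lerD//; last by apply: cu; rewrite leq_maxl.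
apply: le_trans (nm_le_ReIm _) _; rewrite Re_D Im_D Re_N Im_N [e]splitr lerD//=.
  by apply: N1P => /=; rewrite !leq_max leqnn orbT.
by apply: N2P => /=; rewrite !leq_max leqnn !orbT.
Qed.

Lemma vanishing_le0 (a : nat -> R) (b : R) : vanishing a -> (forall n, b <= a n) -> b <= 0.
Proof.
move=> va ba; apply/ler_addgt0Pr => e /va[N NP]; rewrite add0r.
exact: le_trans (ba N) (NP N (leqnn N)).
Qed.

Lemma CP_series (g : nat -> R -> R[i]^o) (C : R) : 0 <= C -> (forall k, CP (g k)) ->
  (forall k t, nm (g k t) <= C * 2 ^- k) ->
  exists2 G : R -> R[i]^o, CP G & forall n t, nm (G t - \sum_(k < n) (g k t : R[i])) <= 2 * C * 2 ^- n.
Proof.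
move=> C0 cg gb; have va : vanishing (fun n => 2 * C * 2 ^- n) by apply: vanishing_geo; rewrite mulr_ge0.
have cu t (k m : nat) : (k <= m)%N ->
    nm (\sum_(j < m) (g j t : R[i]) - \sum_(j < k) (g j t : R[i])) <= 2 * C * 2 ^- k.
  move=> km; apply: (@le_trans _ _ (2 * C * 2 ^- k - 2 * C * 2 ^- m)); last first.
    by rewrite gerBl !mulr_ge0// invr_ge0 exprn_ge0.
  move: km => /subnKC <-; elim: (m - k)%N => [|j ih]; first by rewrite addn0 !subrr nm0.
  rewrite addnS big_ord_recr/= addrAC; apply: le_trans (nmD _ _) _.
  apply: le_trans (lerD ih (gb _ _)) _.
  by rewrite exprS invfM; move: (2 ^- k) (2 ^- (k + j)) => A B; lra.
have /choice[G GP] : forall t, exists l : R[i], forall n, nm (l - \sum_(j < n) (g j t : R[i])) <= 2 * C * 2 ^- n.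
  by move=> t; exact: complex_cauchy_cvg va (cu t).
have csum n : CP (fun t => \sum_(j < n) (g j t : R[i])).
  elim: n => [|n ih].
    rewrite (_ : (fun t => _) = fun _ => 0); first exact: CP_cst.
    by apply/funext => t; rewrite big_ord0.
  have := CP_lin 1 ih (cg n); congr CP; apply/funext => t.
  by rewrite big_ord_recr/= mul1r.
exists G => //; split.
  apply/continuous_nmP => x e e0; have e4 : 0 < e / 4 by rewrite divr_gt0.
  have [N NP] := va _ e4; have [/continuous_nmP cN _] := csum N.
  apply: filterS (cN x _ e4) => y xy.
  rewrite (_ : G x - G y = (G x - \sum_(j < N) (g j x : R[i])) +
    ((\sum_(j < N) (g j x : R[i]) - \sum_(j < N) (g j y : R[i])) + (\sum_(j < N) (g j y : R[i]) - G y))); last first.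
    by rewrite !subrKA.
  apply: le_lt_trans (nmD _ _) _.
  have h1 := le_trans (GP x N) (NP N (leqnn N)).
  have h2 := le_trans (GP y N) (NP N (leqnn N)).
  have h3 := nmD (\sum_(j < N) (g j x : R[i]) - \sum_(j < N) (g j y : R[i])) (\sum_(j < N) (g j y : R[i]) - G y).
  rewrite nmBC in h2; lra.
move=> t; apply/eqP; rewrite -subr_eq0; apply/eqP/nm_eq0/eqP; rewrite eq_le nm_ge0 andbT.
apply: (@vanishing_le0 (fun n => 4 * C * 2 ^- n)); first by apply: vanishing_geo; rewrite mulr_ge0.
move=> n; have := GP (t + twopi) n; rewrite (csum n).2 => h1; have h2 := GP t n.
rewrite -(subrK (\sum_(j < n) (g j t : R[i])) (G (t + twopi))) -addrA; apply: le_trans (nmD _ _) _.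
by rewrite [X in _ + X]nmBC; lra.
Qed.

End QC_algebra.

(** * Closedness of H^infty + C, products and inverses *)

Section QC_closed.
Variable R : realType.
Local Notation mu := (circle_measure R).
Local Notation T := (measurableTypeR R).
Implicit Types (f g h : L0 R) (z w c : R[i]) (m : int).

Lemma HinfC_Hinf h : Hinf h -> HinfC h.
Proof. by move=> hh; exists h => //; exists 0; [exact: CT_0|rewrite addr0]. Qed.

Lemma HinfC_CT f : CT f -> HinfC f.
Proof. by move=> cf; exists 0; [exact: Hinf_0|exists f => //; rewrite add0r]. Qed.

Lemma HinfC_lin c f g : HinfC f -> HinfC g -> HinfC (c *: f + g).
Proof.
move=> [h hh [u cu <-]] [k hk [v cv <-]].
exists (c *: h + k); first exact: Hinf_lin.
by exists (c *: u + v); [exact: CT_lin|rewrite scalerDr addrACA].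
Qed.

Lemma HinfC_D f g : HinfC f -> HinfC g -> HinfC (f + g).
Proof. by move=> hf hg; rewrite -[f]scale1r; exact: HinfC_lin. Qed.

Lemma HinfC_B f g : HinfC f -> HinfC g -> HinfC (f - g).
Proof. by move=> hf hg; rewrite addrC -scaleN1r; exact: HinfC_lin. Qed.

Lemma HinfC_bnd f : HinfC f -> exists2 M, 0 <= M & bnd M f.
Proof.
move=> [h /HinfP[[M bM] _] [c /CT_bnd[N N0 bN] <-]]; exists (M + N).
  by rewrite addr_ge0// (bnd_ge0 bM).
exact: bndD.
Qed.

(** The increments of a fast approximating sequence are split with small continuous parts. These sum
    uniformly to a continuous [c], and [f - F 0 - c] is then a uniform limit of sums of the H^infty
    parts. *)
Lemma HinfC_closed f : (forall e : R, 0 < e -> exists2 g, HinfC g & bnd e (f - g)) -> HinfC f.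
Proof.
move=> cf; have r0 n : 0 < 2 ^- n :> R by rewrite invr_gt0 exprn_gt0.
have /choice[F FP] : forall n : nat, exists g, HinfC g /\ bnd (2 ^- n) (f - g).
  by move=> n; have [g hg bg] := cf _ (r0 n); exists g.
have bd k : bnd (2 * 2 ^- k) (F k.+1 - F k).
  have -> : F k.+1 - F k = (f - F k) - (f - F k.+1) by rewrite opprB [RHS]addrC subrKA.
  apply: bnd_mono (bndB (FP k).2 (FP k.+1).2).
  by have := r0 k; rewrite exprS invfM; move: (2 ^- k) => A; lra.
have /choice[g gP] : forall k, exists g : R -> R[i]^o, exists cg : CP g, (forall t, nm (g t) <= 2 * 2 ^- k + 2 ^- k) /\
    Hinf (F k.+1 - F k - L0class (measurable_continuous cg.1)).
  move=> k; apply: HinfC_split (bd k) (r0 k).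
  by apply: HinfC_B; [exact: (FP k.+1).1|exact: (FP k).1].
have cg k : CP (g k) by have [cg _] := gP k.
have gb k t : nm (g k t) <= 3 * 2 ^- k.
  have [_ [gb _]] := gP k; apply: le_trans (gb t) _.
  by move: (2 ^- k) => A; lra.
have [G cG GP] := CP_series (ler0n R 3) cg gb.
pose c := L0class (measurable_continuous cG.1).
have Cc : CT c by exact: CT_class.
suff hh : Hinf (f - F 0%N - c).
  have -> : f = (f - F 0%N - c) + (F 0%N + c) by rewrite [F 0%N + c]addrC addrA !subrK.
  by apply: HinfC_D; [exact: HinfC_Hinf|apply: HinfC_D; [exact: (FP 0%N).1|exact: HinfC_CT]].
have /choice[ck ckP] : forall k, exists v : L0 R, {ae mu, forall t : T, L0fun v t = g k t} /\ Hinf (F k.+1 - F k - v).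
  move=> k; have [cgk [_ hk]] := gP k; exists (L0class (measurable_continuous cgk.1)); split => //.
  exact: L0classE.
apply: Hinf_closed => e e0.
(* 7 = 1 + 6: the distance from [f] to [F N], plus the tail 2 * 3 of the series bounded by 3 *
   2^-k. *)
have [N NP] := vanishing_geo (ler0n R 7) e0.
exists (\sum_(k < N) (F k.+1 - F k - ck k)).
  by apply: (big_ind (@Hinf R)) => [|x y|k _]; [exact: Hinf_0|exact: Hinf_D|exact: (ckP k).2].
apply: bnd_mono (NP N (leqnn N)) _.
have -> : \sum_(k < N) (F k.+1 - F k - ck k) = F N - F 0%N - \sum_(k < N) ck k.
  elim: (N) => [|n ih]; first by rewrite !big_ord0 !subrr.
  rewrite !big_ord_recr /= ih.
  by move: (F n) (F 0%N) (F n.+1) (\sum_(k < n) ck k) (ck n) => A B D E K; ring.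
have sE : {ae mu, forall t : T, L0fun (\sum_(k < N) ck k) t = \sum_(k < N) (g k t : R[i])}.
  elim: (N) => [|n ih]; first by apply: filterS (L0_0E R) => t; rewrite !big_ord0.
  rewrite big_ord_recr /=; apply: filterS3 ih (L0_addE (\sum_(k < n) ck k) (ck n)) (ckP n).1.
  by move=> t -> -> ->; rewrite big_ord_recr.
have -> : f - F 0%N - c - (F N - F 0%N - \sum_(k < N) ck k) = (f - F N) - (c - \sum_(k < N) ck k).
  move: (F N) (F 0%N) (\sum_(k < N) ck k) => A B D.
  by ring.
apply: (@bnd_mono _ (2 ^- N + 6 * 2 ^- N)); first by move: (2 ^- N) => A; lra.
apply: bndB; first exact: (FP N).2.
apply: filterS3 (L0_subE c (\sum_(k < N) ck k)) sE (L0classE (measurable_continuous cG.1)).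
move=> t -> -> e3; rewrite /c e3; apply: le_trans (GP N t) _.
by move: (2 ^- N) => A; lra.
Qed.

(** For m = -N, the part of [h] with frequencies below N becomes a trigonometric polynomial after
    the shift, while the rest stays in H^infty. *)
Lemma Hinf_mulchi h m : Hinf h -> HinfC (h * chi R m).
Proof.
move=> hh; have [[M bM] h0] := (HinfP h).1 hh; have lh := Hinf_L2 hh.
case: m => n; first by apply: HinfC_Hinf; apply: Hinf_mul => //; exact: Hinf_chi.
rewrite NegzE; set N := n.+1.
have [K bK] : exists K, bnd K (fsum h N).
  rewrite /fsum; apply: (big_ind (fun f => exists K, bnd K f)).
  - by exists 0; exact: bnd0.
  - by move=> f g [A bA] [B bB]; exists (A + B); exact: bndD.
  - by move=> j _; exists (nm (fcoef h j) * 1); exact/bndZ/bnd_chi.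
exists ((h - fsum h N) * chi R (- N%:Z)).
  apply/HinfP; split.
    by exists ((M + K) * 1); apply: bndM; [exact: bndB|exact: bnd_chi].
  move=> m m0; rewrite inner_mulchi opprK innerBl ?inner_fsum//; [|exact: L2_fsum|exact: L2_chi].
  have [mN|mN] := ltP (m + N%:Z) 0; first by rewrite h0// subrr.
  by rewrite gtrDr m0 subrr.
exists (fsum h N * chi R (- N%:Z)); last by rewrite -mulrDl subrK.
rewrite /fsum big_distrl /=.
apply: (big_ind (@CT R)) => [|x y cx cy|j _]; first exact: CT_0.
  by rewrite -[x]scale1r; exact: CT_lin.
rewrite L0_scaleAl chiM chi_tpol -[_ *: _]addr0; apply: CT_lin; last exact: CT_0.
exact: CT_tpol.
Qed.

Lemma HinfC_mulchi f m : HinfC f -> HinfC (f * chi R m).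
Proof.
move=> [h hh [c cc <-]]; rewrite mulrDl; apply: HinfC_D; first exact: Hinf_mulchi.
by apply: HinfC_CT; apply: CT_mul => //; rewrite chi_tpol; exact: CT_tpol.
Qed.

(** Multiplication by characters is explicit; uniform approximation and [HinfC_closed] extend it to
    a continuous factor, which leaves only the product of two H^infty functions. *)
Lemma HinfC_mul f g : HinfC f -> HinfC g -> HinfC (f * g).
Proof.
move=> /[dup] hf [h hh [c cc fE]] [k hk [d cd <-]].
have CTcase f' u : HinfC f' -> CT u -> HinfC (f' * u).
  move=> hf' cu; have [M M0 bM] := HinfC_bnd hf'; apply: HinfC_closed => e e0.
  have M1 : 0 < M + 1 by rewrite ltr_wpDl.
  have [s sP] := CT_approx cu (divr_gt0 e0 M1).
  exists (f' * tpol s).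
    rewrite /tpol big_distrr /=; apply: (big_ind (@HinfC R)) => [|x y|p _].
    - by apply: HinfC_CT; exact: CT_0.
    - exact: HinfC_D.
    rewrite L0_scaleAr -[_ *: _]addr0; apply: HinfC_lin; first exact: HinfC_mulchi.
    by apply: HinfC_CT; exact: CT_0.
  rewrite -mulrBr; apply: bnd_mono (bndM bM sP).
  by rewrite mulrCA ler_piMr ?(ltW e0)// ler_pdivrMr// mul1r lerDl.
rewrite mulrDr; apply: HinfC_D; last exact: CTcase.
rewrite -fE mulrDl; apply: HinfC_D; first by apply: HinfC_Hinf; exact: Hinf_mul.
by rewrite mulrC; apply: CTcase => //; exact: HinfC_Hinf.
Qed.

Lemma QCP f : QC f <-> HinfC f /\ HinfC (L0conj f).
Proof.
split=> [[hf [g hg gf]]|[hf hc]]; split => //; first by rewrite -gf L0conjK.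
by exists (L0conj f) => //; rewrite L0conjK.
Qed.

Lemma QC_conj f : QC f -> QC (L0conj f).
Proof. by move=> /QCP[h1 h2]; apply/QCP; rewrite L0conjK. Qed.

Lemma QC_lin c f g : QC f -> QC g -> QC (c *: f + g).
Proof.
move=> /QCP[f1 f2] /QCP[g1 g2]; apply/QCP; split; first exact: HinfC_lin.
by rewrite L0conjD L0conjZ; exact: HinfC_lin.
Qed.

Lemma QC_mul f g : QC f -> QC g -> QC (f * g).
Proof.
move=> /QCP[f1 f2] /QCP[g1 g2]; apply/QCP; split; first exact: HinfC_mul.
by rewrite L0conjM; exact: HinfC_mul.
Qed.

Lemma QC_chi m : QC (chi R m).
Proof.
by apply/QCP; rewrite chi_conj !chi_tpol; split; apply: HinfC_CT; exact: CT_tpol.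
Qed.

Lemma QC_1 : QC (1 : L0 R). Proof. by rewrite -chi0; exact: QC_chi. Qed.

Lemma QC_0 : QC (0 : L0 R).
Proof. by have := QC_lin (-1) QC_1 QC_1; rewrite scaleN1r addNr. Qed.

Lemma QC_D f g : QC f -> QC g -> QC (f + g).
Proof. by move=> hf hg; rewrite -[f]scale1r; exact: QC_lin. Qed.

Lemma QC_Z c f : QC f -> QC (c *: f).
Proof. by move=> hf; rewrite -[_ *: _]addr0; apply: QC_lin => //; exact: QC_0. Qed.

Lemma QC_bnd f : QC f -> exists2 M, 0 <= M & bnd M f.
Proof. by move=> /QCP[/HinfC_bnd]. Qed.

Lemma QC_closed f : (forall e : R, 0 < e -> exists2 g, QC g & bnd e (f - g)) -> QC f.
Proof.
move=> cf; apply/QCP; split; apply: HinfC_closed => e /cf[g /QCP[g1 g2] bg].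
  by exists g.
by exists (L0conj g) => //; rewrite -L0conjB; exact: bnd_conj.
Qed.

Lemma vanishing_expr (r c : R) : 0 <= r < 1 -> 0 <= c -> vanishing (fun n => r ^+ n * c).
Proof.
move=> /andP[r0 r1] c0 e e0.
have c1 : 0 < c + 1 by rewrite ltr_wpDl.
have rn : `|r| < 1 by rewrite ger0_norm.
have /cvgrPdist_le /(_ _ (divr_gt0 e0 c1)) [N _ NP] := cvg_expr rn.
exists N => n /NP; rewrite sub0r normrN ger0_norm ?exprn_ge0// ler_pdivlMr// => h.
by apply: le_trans h; rewrite ler_wpM2l ?exprn_ge0// lerDl.
Qed.

(* The inverse of [|f|^2] is a Neumann series in [1 - |f|^2 / M^2]. *)
Lemma QC_inverse f (d : R) : QC f -> 0 < d -> {ae mu, forall t : T, d <= nm (f t)} ->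
  exists2 g, QC g & f * g = 1.
Proof.
move=> qf d0 df; have [M M0 bM] := QC_bnd qf.
have dM : d <= M by have [t [h1 h2]] := ae_exists (filterI df bM); exact: le_trans h1 h2.
have M1 : 0 < M by exact: lt_le_trans dM.
pose k : R[i] := (M ^- 2)%:C.
pose u : L0 R := 1 - k *: (L0conj f * f).
(* Since d <= |f| <= M, the values of [u] lie in [0, r]. *)
pose r := 1 - (d / M) ^+ 2.
have dm1 : 0 < d / M <= 1 by rewrite divr_gt0// ler_pdivrMr// mul1r.
have r01 : 0 <= r < 1.
  by move: dm1 => /andP[h1 h2]; rewrite /r; apply/andP; split; nra.
have bu : bnd r u.
  apply: filterS (filterI (filterI df bM) (filterI (filterI (L0_subE 1 (k *: (L0conj f * f))) (L0_1E R))
    (filterI (L0_scaleE k (L0conj f * f)) (filterI (L0_mulE (L0conj f) f) (L0conjE f)))));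
    move=> t [[h1 h2] [[-> ->] [-> [-> ->]]]].
  rewrite [_^* * _]mulrC mul_conj /k -rmorphM -(rmorph1 (real_complex R)) -rmorphB nm_real.
  have -> : M ^- 2 * nm (f t) ^+ 2 = (nm (f t) / M) ^+ 2 by field; rewrite gt_eqF.
  have h3 : d / M <= nm (f t) / M by rewrite ler_pM2r ?invr_gt0.
  have h4 : nm (f t) / M <= 1 by rewrite ler_pdivrMr// mul1r.
  move: dm1 => /andP[h5 h6]; rewrite /r.
  by rewrite ger0_norm; nra.
have qu : QC u.
  have := QC_lin (- k) (QC_mul (QC_conj qf) qf) QC_1.
  by rewrite /u addrC scaleNr.
have bX n : bnd (r ^+ n) (u ^+ n).
  elim: n => [|n ih]; first by rewrite !expr0; exact: bnd1.
  by rewrite !exprS; exact: bndM.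
have qX n : QC (u ^+ n).
  by elim: n => [|n ih]; [rewrite expr0; exact: QC_1|rewrite exprS; exact: QC_mul].
move: (r01) => /andP[r0 r1].
have r1' : 0 < 1 - r by rewrite subr_gt0.
pose S n := \sum_(j < n) u ^+ j.
have qS n : QC (S n).
  by apply: (big_ind (@QC R)) => [|x y|j _]; [exact: QC_0|exact: QC_D|exact: qX].
(* The bound is a difference of two geometric terms so that the induction closes; the negative term
   is dropped afterwards. *)
have geo n (m' : nat) : bnd (r ^+ n * (1 - r)^-1 - r ^+ (n + m') * (1 - r)^-1) (S (n + m')%N - S n).
  elim: m' => [|m' ih]; first by rewrite addn0 !subrr; exact: bnd0.
  rewrite addnS /S big_ord_recr /= addrAC.
  apply: bnd_mono (bndD ih (bX _)); rewrite exprS.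
  by rewrite le_eqVlt; apply/orP; left; apply/eqP; field; rewrite gt_eqF.
have va := vanishing_expr r01 (ltW (_ : 0 < (1 - r)^-1)).
have {}va : vanishing (fun n => r ^+ n * (1 - r)^-1) by apply: va; rewrite invr_gt0.
have bS n (m' : nat) : (n <= m')%N -> bnd (r ^+ n * (1 - r)^-1) (S m' - S n).
  move=> /subnKC <-; apply: bnd_mono (geo n _).
  by rewrite gerBl mulr_ge0 ?exprn_ge0// invr_ge0 ltW.
have [g gP] := Linf_complete va bS.
have qg : QC g.
  by apply: QC_closed => e /va[N NP]; exists (S N) => //; exact: bnd_mono (NP N (leqnn N)) (gP N).
have ug : (1 - u) * g = 1.
  apply/eqP; rewrite -subr_eq0; apply/eqP/bnd_eq0 => e e0.
  have [N NP] := va _ (divr_gt0 e0 (ltr0Sn R 2)).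
  have := NP N (leqnn N) => hN.
  have -> : (1 - u) * g - 1 = (1 - u) * (g - S N) - u ^+ N.
    have -> : u ^+ N = 1 - (1 - u) * S N.
      by have := subrX1 u N; rewrite -/(S N) => /eqP; rewrite subr_eq => /eqP ->; rewrite -opprB mulNr opprB addrC.
    by rewrite mulrBr; ring.
  have b1 : bnd (1 + r) (1 - u) by apply: bndB => //; exact: bnd1.
  apply: bnd_mono (bndB (bndM b1 (gP N)) (bX N)).
  have h : r ^+ N <= r ^+ N * (1 - r)^-1.
    by rewrite ler_peMr ?exprn_ge0// invf_ge1// gerBl.
  have p0 : 0 <= r ^+ N * (1 - r)^-1 by rewrite mulr_ge0 ?exprn_ge0// invr_ge0 ltW.
  by nra.
(* [g] inverts 1 - u = |f|^2 / M^2. *)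
exists (k *: (L0conj f * g)); first by apply: QC_Z; apply: QC_mul => //; exact: QC_conj.
rewrite -ug /u opprB addrC subrK L0_scaleAr L0_scaleAl; congr (_ *: _).
by rewrite mulrA [f * _]mulrC.
Qed.

End QC_closed.

(** * Compact operators and symbols *)

Section compact_operators.
Variable R : realType.
Local Notation "⟪ f , g ⟫" := (L2inner f g) (format "⟪ f ,  g ⟫").
Implicit Types (f g h : L0 R) (x y u v : H2 R) (z w c : R[i]) (A B K : H2 R -> H2 R).

Definition bop (M : R) A := forall x, hnorm (A x) <= M * hnorm x.

Section linear_facts.
Variable A : H2 R -> H2 R.
Hypothesis lA : linear A.

Lemma lin_D x y : A (x + y) = A x + A y.
Proof. by rewrite -[x in LHS]scale1r lA scale1r. Qed.

Lemma lin_0 : A 0 = 0.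
Proof. by apply: (addIr (A 0)); rewrite -lin_D !add0r. Qed.

Lemma lin_Z c x : A (c *: x) = c *: A x.
Proof. by rewrite -[c *: x]addr0 lA lin_0 addr0. Qed.

Lemma lin_N x : A (- x) = - A x.
Proof. by rewrite -scaleN1r lin_Z scaleN1r. Qed.

Lemma lin_B x y : A (x - y) = A x - A y.
Proof. by rewrite lin_D lin_N. Qed.

Lemma lin_sum J (r : seq J) (F : J -> H2 R) : A (\sum_(j <- r) F j) = \sum_(j <- r) A (F j).
Proof. exact: (big_morph _ lin_D lin_0). Qed.

Lemma lin_homogeneous (p : H2 R -> R) (e : R) : (forall c x, p (c *: x) = nm c * p x) ->
  (forall x, hnorm x <= 1 -> p (A x) <= e) -> forall x, p (A x) <= e * hnorm x.
Proof.
move=> pZ pe x; have [x0|x0] := eqVneq (hnorm x) 0.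
  by rewrite (hnorm_eq0 x0) lin_0 hnorm0 mulr0 -(scale0r 0) pZ nm0 mul0r.
have xp : 0 < hnorm x by rewrite lt_def x0 hnorm_ge0.
have := pe (((hnorm x)^-1)%:C *: x).
rewrite hnormZ nm_real ger0_norm ?invr_ge0 ?(ltW xp)// mulVf// lexx => /(_ isT).
rewrite lin_Z pZ nm_real ger0_norm ?invr_ge0 ?(ltW xp)//.
by rewrite mulrC ler_pdivrMr.
Qed.

End linear_facts.

Lemma bounded_operatorP A : bounded_operator A <-> linear A /\ exists2 M, 0 <= M & bop M A.
Proof.
split=> [[lA [M bM]]|[lA [M M0 bM]]]; split => //.
  exists (nm M) => [|x]; first exact: nm_ge0.
  have := bM x; rewrite !H2normE => h.
  have h0 : 0 <= M * (hnorm x)%:C by apply: le_trans h; rewrite lecR hnorm_ge0.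
  have := h; rewrite -(ger0_norm h0) normC_nm lecR nmM nm_real ger0_norm ?hnorm_ge0//.
by exists M%:C => x; rewrite !H2normE -rmorphM lecR.
Qed.

Lemma compactP A : compact_operator A <-> linear A /\ fin_net A.
Proof. by split=> [/compact_fin_net//|[lA nA]]; exact: fin_net_compact. Qed.

Lemma bop_mono M N A : M <= N -> bop M A -> bop N A.
Proof. by move=> MN bM x; apply: le_trans (bM x) _; rewrite ler_wpM2r ?hnorm_ge0. Qed.

Lemma fin_net_bop A : linear A -> fin_net A -> exists2 M, 0 <= M & bop M A.
Proof.
move=> lA nA; have [s sP] := nA 1 ltr01.
exists (1 + \sum_(y <- s) hnorm y).
  by rewrite addr_ge0// sumr_ge0// => y _; exact: hnorm_ge0.
apply: (lin_homogeneous lA) => [c x|x x1]; first exact: hnormZ.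
have [y ys xy] := sP x x1.
rewrite -(subrK y (A x)); apply: le_trans (hnormD _ _) _; rewrite lerD//.
have : hnorm y <= \sum_(u <- s | u == y) hnorm u.
  elim: (s) ys => // u s' ih; rewrite inE big_cons eq_sym.
  case: eqP => [->|_] /=; first by rewrite lerDl sumr_ge0// => i _; exact: hnorm_ge0.
  exact: ih.
move=> /le_trans; apply; rewrite [leRHS](bigID (fun u => u == y))/= lerDl.
by rewrite sumr_ge0// => i _; exact: hnorm_ge0.
Qed.

Lemma fin_net_scaled A (r e : R) : linear A -> fin_net A -> 0 < e ->
  exists s : seq (H2 R), forall x, hnorm x <= r -> exists2 y, y \in s & hnorm (A x - y) <= e.
Proof.
move=> lA nA e0; pose q := `|r| + 1.
have q0 : 0 < q by rewrite ltr_wpDl.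
have [s sP] := nA _ (divr_gt0 e0 q0).
exists [seq q%:C *: y | y <- s] => x xr.
have [|y ys xy] := sP ((q^-1)%:C *: x).
  rewrite hnormZ nm_real ger0_norm ?invr_ge0 ?(ltW q0)// mulrC ler_pdivrMr// mul1r.
  by apply: le_trans xr _; apply: le_trans (ler_norm r) _; rewrite lerDl.
exists (q%:C *: y); first exact: map_f.
have -> : A x - q%:C *: y = q%:C *: (A ((q^-1)%:C *: x) - y).
  rewrite scalerBr -(lin_Z lA) scalerA -rmorphM mulfV ?scale1r//.
  by rewrite gt_eqF.
by rewrite hnormZ nm_real ger0_norm ?(ltW q0)// mulrC -ler_pdivlMr.
Qed.

Lemma fin_net_lin c A B : fin_net A -> fin_net B -> fin_net (fun x => c *: A x + B x).
Proof.
move=> nA nB e e0; have c0 : 0 < nm c + 1 by rewrite ltr_wpDl ?nm_ge0.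
have e2 : 0 < e / 2 by rewrite divr_gt0.
have [s sP] := nA _ (divr_gt0 e2 c0).
have [t tP] := nB _ e2.
exists [seq c *: y + u | y <- s, u <- t] => x x1.
have [y ys xy] := sP x x1; have [u ut xu] := tP x x1.
exists (c *: y + u); first exact: allpairs_f.
have -> : c *: A x + B x - (c *: y + u) = c *: (A x - y) + (B x - u).
  by rewrite scalerBr opprD addrACA.
apply: le_trans (hnormD _ _) _; rewrite [e]splitr lerD// hnormZ.
rewrite ler_pdivlMr// in xy; apply: le_trans xy.
by rewrite mulrC ler_wpM2l ?hnorm_ge0// lerDl.
Qed.

Lemma fin_net_limit A : (forall e : R, 0 < e -> exists2 B, fin_net B & bop e (fun x => A x - B x)) ->
  fin_net A.
Proof.
move=> lim e e0; have e2 : 0 < e / 2 by rewrite divr_gt0.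
have [B nB AB] := lim _ e2; have [s sP] := nB _ e2; exists s => x x1.
have [y ys xy] := sP x x1; exists y => //.
apply: le_trans (hnorm_triangle _ _ (B x)) _; rewrite [e]splitr lerD//.
by apply: le_trans (AB x) _; rewrite ler_piMr// ltW.
Qed.

Lemma fin_net_compl M A B : linear B -> bop M B -> fin_net A -> fin_net (B \o A).
Proof.
move=> lB bB nA e e0; have M1 : 0 < `|M| + 1 by rewrite ltr_wpDl.
have [s sP] := nA _ (divr_gt0 e0 M1); exists [seq B y | y <- s] => x x1.
have [y ys xy] := sP x x1; exists (B y); first exact: map_f.
rewrite /= -lin_B//; apply: le_trans (bB _) _.
rewrite ler_pdivlMr// in xy; apply: le_trans xy; rewrite mulrC ler_wpM2l ?hnorm_ge0//.
by apply: le_trans (ler_norm M) _; rewrite lerDl.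
Qed.

Lemma fin_net_compr M A B : linear A -> bop M B -> fin_net A -> fin_net (A \o B).
Proof.
move=> lA bB nA e e0.
have [s sP] := fin_net_scaled `|M| lA nA e0; exists s => x x1; apply: sP.
apply: le_trans (bB x) _; apply: (@le_trans _ _ (`|M| * hnorm x)).
  by rewrite ler_wpM2r ?hnorm_ge0// ler_norm.
by rewrite ler_piMr.
Qed.

Lemma fin_net_0 : fin_net (fun _ : H2 R => 0 : H2 R).
Proof. by move=> e e0; exists [:: 0] => x _; exists 0; rewrite ?inE// subrr hnorm0 ltW. Qed.

Lemma disc_net (M e : R) : 0 < e ->
  exists s : seq R[i], forall z, nm z <= M -> exists2 w, w \in s & nm (z - w) <= e.
Proof.
move=> e0; pose d := e / 2; have d0 : 0 < d by rewrite divr_gt0.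
pose N := (Num.truncn (`|M| / d)).+1.
pose pts := [seq (k%:R - N%:R) * d | k <- iota 0 (N + N)] : seq R.
have net (a : R) : `|a| <= M -> exists2 b, b \in pts & `|a - b| <= d.
  move=> aM.
  have aN : `|a / d| < N%:R.
    apply: le_lt_trans (truncnS_gt _); rewrite normrM (ger0_norm (_ : 0 <= d^-1)) ?invr_ge0 ?(ltW d0)//.
    by rewrite ler_wpM2r ?invr_ge0 ?(ltW d0)// (le_trans aM)// ler_norm.
  have h0 : 0 <= a / d + N%:R by move: aN; rewrite ltr_norml => /andP[h _]; lra.
  exists (((Num.truncn (a / d + N%:R))%:R - N%:R) * d).
    apply/mapP; exists (Num.truncn (a / d + N%:R)) => //; rewrite mem_iota add0n/=.
    rewrite -(ltr_nat R); apply: (@le_lt_trans _ _ (a / d + N%:R)); first by rewrite truncn_le.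
    rewrite natrD.
    by move: aN; rewrite ltr_norml => /andP[_ h]; lra.
  have := truncn_itv h0 => /andP[h1 h2].
  have dn : d != 0 by rewrite gt_eqF.
  rewrite -[X in `|X - _|](divfK dn) -mulrBl normrM (ger0_norm (ltW d0)).
  rewrite ler_piMl// ?(ltW d0)// ler_norml; apply/andP; split; last by rewrite -natr1 in h2; lra.
  lra.
exists [seq a +i* b | a <- pts, b <- pts] => -[a b] zM.
have [a' a's aa'] := net a (le_trans (Re_le_nm (a +i* b)) zM).
have [b' b's bb'] := net b (le_trans (Im_le_nm (a +i* b)) zM).
exists (a' +i* b'); first exact: allpairs_f.
by apply: le_trans (nm_le_ReIm _) _; rewrite [e]splitr /= lerD.
Qed.

Lemma fin_net_rank1 (phi : H2 R -> R[i]) (M : R) v :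
  (forall x, nm (phi x) <= M * hnorm x) -> fin_net (fun x => phi x *: v).
Proof.
move=> bphi e e0; have v1 : 0 < hnorm v + 1 by rewrite ltr_wpDl ?hnorm_ge0.
have [s sP] := disc_net `|M| (divr_gt0 e0 v1).
exists [seq w *: v | w <- s] => x x1.
have [|w ws xw] := sP (phi x).
  apply: le_trans (bphi x) _; apply: (@le_trans _ _ (`|M| * hnorm x)).
    by rewrite ler_wpM2r ?hnorm_ge0// ler_norm.
  by rewrite ler_piMr.
exists (w *: v); first exact: map_f.
rewrite -scalerBl hnormZ; rewrite ler_pdivlMr// in xw; apply: le_trans xw.
by rewrite ler_wpM2l ?nm_ge0// lerDl.
Qed.

(** Schauder's theorem for Hilbert spaces: |L x|^2 = <K L x, x>, so a net for K L at scale e^2/4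
    yields one for L at scale e. Differences of unit vectors have norm at most 2, and 2 * (e^2/2) =
    e^2. *)
Lemma fin_net_adjoint (M : R) K L : linear K -> fin_net K -> linear L -> bop M L ->
  (forall x y, hip (K x) y = hip x (L y)) -> fin_net L.
Proof.
move=> lK nK lL bL adj e e0.
have e1 : 0 < e ^+ 2 / 4 by rewrite divr_gt0// exprn_gt0.
have nKL := fin_net_compr lK bL nK.
have [s sP] := nKL _ e1.
pose near_to y x := hnorm x <= 1 /\ hnorm (K (L x) - y) <= e ^+ 2 / 4.
(* A centre y need not be an image under K L, so every ball that is met gets a representative from
   the unit ball. *)
have /choice[rep repP] : forall y, exists x, (exists u, near_to y u) -> near_to y x.
  move=> y; have [[u yu]|nu] := pselect (exists u, near_to y u); first by exists u.
  by exists 0.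
exists [seq L (rep y) | y <- s] => x x1.
have [y ys xy] := sP x x1; exists (L (rep y)); first exact: map_f.
have [r1 r2] : near_to y (rep y) by apply: repP; exists x.
rewrite -lin_B// -ler_sqr ?nnegrE ?hnorm_ge0 ?(ltW e0)//.
have -> : hnorm (L (x - rep y)) ^+ 2 = nm (hip (K (L (x - rep y))) (x - rep y)).
  by rewrite adj hip_self nm_real ger0_norm ?sqr_ge0.
apply: le_trans (nm_hip _ _) _.
have d1 : hnorm (x - rep y) <= 2.
  by apply: le_trans (hnormB _ _) _; rewrite (_ : 2 = 1 + 1) ?lerD//; ring.
have d2 : hnorm (K (L (x - rep y))) <= e ^+ 2 / 2.
  rewrite !lin_B//; apply: le_trans (hnorm_triangle _ _ y) _.
  rewrite [hnorm (y - _)]hnormBC; apply: le_trans (lerD xy r2) _.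
  by lra.
have := hnorm_ge0 (x - rep y); have := hnorm_ge0 (K (L (x - rep y))).
by nra.
Qed.

Lemma vanishing_shift (a : nat -> R) (m : int) : vanishing a -> vanishing (fun n => a (absz (n%:Z + m)%R)).
Proof.
move=> va e /va[N NP]; exists (N + absz m)%N => n Nn; apply: NP.
by move: Nn; lia.
Qed.

Lemma vanishing_inner_tpol f s : L2 f -> vanishing (fun n => nm ⟪f, chi R n%:Z * tpol s⟫).
Proof.
move=> lf; elim: s => [|p s ih] e e0.
  by exists 0%N => n _; rewrite /tpol big_nil mulr0 inner0r nm0 ltW.
have e2 : 0 < e / 2 by rewrite divr_gt0.
have c1 : 0 < nm p.1 + 1 by rewrite ltr_wpDl ?nm_ge0.
have [N1 N1P] := vanishing_shift p.2 (fcoef_cvg0 lf) (divr_gt0 e2 c1).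
have [N2 N2P] := ih _ e2.
(* The third bound keeps n + p.2 nonnegative, where it agrees with its absolute value. *)
exists (maxn (maxn N1 N2) `|p.2|) => n; rewrite !geq_max => /andP[/andP[n1 n2] n3].
rewrite /tpol big_cons mulrDr innerDr//; last 2 first.
- by rewrite L0_scaleAr chiM; exact/L2_Z/L2_chi.
- by rewrite mulrC; apply: L2_mulchi; exact: L2_tpol.
apply: le_trans (nmD _ _) _; rewrite [e]splitr lerD//; last exact: N2P.
rewrite L0_scaleAr chiM innerZr//; last exact: L2_chi.
rewrite nmM nm_conj; have := N1P _ n1.
have -> : (absz (n%:Z + p.2)%R)%:Z = n%:Z + p.2 by move: n3; lia.
rewrite ler_pdivlMr// => h; apply: le_trans h.
by rewrite mulrC ler_wpM2l ?nm_ge0// lerDl.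
Qed.

Lemma hardy_chi_tpol s : exists N, forall n, (N <= n)%N -> Hardy 2%:E (chi R n%:Z * tpol s).
Proof.
exists (\sum_(p <- s) `|p.2|)%N => n Nn; apply: Hinf_hardy.
have -> : chi R n%:Z * tpol s = tpol [seq (p.1, n%:Z + p.2) | p <- s].
  rewrite /tpol big_distrr big_map /=; apply: eq_bigr => p _.
  by rewrite L0_scaleAr chiM.
apply: Hinf_tpol => q /mapP[p ps ->] /=; rewrite ltNge; case/negP.
have : (`|p.2| <= n)%N.
  apply: leq_trans Nn; elim: (s) ps => // p' s' ih; rewrite inE big_cons => /orP[/eqP <-|/ih h].
    exact: leq_addr.
  exact: leq_trans h (leq_addl _ _).
by move: (p.2 : int) => j; lia.
Qed.

(** The vectors chi_n p tend weakly to 0. A finite net for the image of the unit ball makes this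
    uniform in x, which amounts to K* (chi_n p) tending to 0 without an adjoint being
    constructed. *)
Lemma fin_net_weak K s (e : R) : linear K -> fin_net K -> 0 < e ->
  exists N, forall n, (N <= n)%N -> forall x, nm ⟪H2val (K x), chi R n%:Z * tpol s⟫ <= e * hnorm x.
Proof.
move=> lK nK e0; pose P := L2norm (tpol s) + 1.
have P0 : 0 < P by rewrite ltr_wpDl ?L2norm_ge0.
have lz n : L2 (chi R n%:Z * tpol s) by rewrite mulrC; apply: L2_mulchi; exact: L2_tpol.
have nz n : L2norm (chi R n%:Z * tpol s) <= P.
  by rewrite mulrC L2norm_mulchi ?lerDl//; exact: L2_tpol.
have e2 : 0 < e / 2 by rewrite divr_gt0.
have [t tP] := nK _ (divr_gt0 e2 P0).
have [N NP] : exists N, forall n, (N <= n)%N -> forall y, y \in t ->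
    nm ⟪H2val y, chi R n%:Z * tpol s⟫ <= e / 2.
  elim: (t) => [|y t' [N NP]]; first by exists 0%N.
  have [M MP] := vanishing_inner_tpol s (L2_H2 y) e2.
  exists (maxn N M) => n; rewrite geq_max => /andP[nN nM] u; rewrite inE => /orP[/eqP ->|ut'].
    exact: MP.
  exact: NP.
exists N => n Nn; pose p (x : H2 R) := nm ⟪H2val x, chi R n%:Z * tpol s⟫.
apply: (lin_homogeneous (p := p) lK) => [c x|x x1].
  by rewrite /p H2valZ innerZl ?nmM//; exact: L2_H2.
have [y yt xy] := tP x x1; rewrite /p -(subrK y (K x)) H2valD innerDl//; [|exact: L2_H2|exact: L2_H2].
apply: le_trans (nmD _ _) _; rewrite [e]splitr lerD//; last exact: NP.
apply: le_trans (nm_inner (L2_H2 _) (lz n)) _.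
rewrite ler_pdivlMr// in xy; apply: le_trans xy.
by rewrite ler_wpM2l ?hnorm_ge0.
Qed.

End compact_operators.

(** * Upper and lower bounds for the symbol of T_f + K *)

Section symbol_bounds.
Variable R : realType.
Local Notation mu := (circle_measure R).
Local Notation T := (measurableTypeR R).
Local Notation "⟪ f , g ⟫" := (L2inner f g) (format "⟪ f ,  g ⟫").
Implicit Types (f g h : L0 R) (x y u v : H2 R) (z w c : R[i]) (A B K : H2 R -> H2 R).

Lemma inner_chi_tpol f m s : ⟪f * (chi R m * tpol s), chi R m * tpol s⟫ = ⟪f * tpol s, tpol s⟫.
Proof.
rewrite !innerE L0conjM chi_conj; congr (I _).
transitivity ((chi R m * chi R (- m)) * (f * tpol s * L0conj (tpol s))); first by ring.
by rewrite chiK mul1r.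
Qed.

Lemma L2norm_chi_tpol f m s : L2 f -> L2norm (f * (chi R m * tpol s)) = L2norm (f * tpol s).
Proof.
by move=> lf; rewrite mulrCA mulrC L2norm_mulchi//; exact: L2_tpolM.
Qed.

(** The rotations 1, -1, i, -i bound the real and imaginary parts by M. The lost factor 2 is
    harmless, as only convergence of symbols depends on it. *)
Lemma bnd_of_re (M : R) f : (forall c, nm c = 1 -> {ae mu, forall t : T, 0 <= Re (M%:C - c * f t)}) ->
  bnd (2 * M) f.
Proof.
move=> fM.
have n1 : nm (1 : R[i]) = 1 by rewrite /nm normr1.
have ni : nm ('i : R[i]) = 1 by rewrite /nm normc_def /= expr0n/= add0r expr1n sqrtr1.
apply: filterS (filterI (filterI (fM 1 n1) (fM (-1) (etrans (nmN _) n1)))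
  (filterI (fM 'i ni) (fM (- 'i) (etrans (nmN _) ni)))) => t [[h1 h2] [h3 h4]].
move: h1 h2 h3 h4; rewrite !Re_D !Re_N !Re_M !Re_N !Im_N /= => h1 h2 h3 h4.
apply: le_trans (nm_le_ReIm _) _; rewrite mulr_natl mulr2n; move: (Re _) (Im _) h1 h2 h3 h4 => a b h1 h2 h3 h4.
by rewrite lerD// ler_norml; apply/andP; split; lra.
Qed.

(* Translating a trigonometric polynomial by [chi n] pushes it into H^2 and,
   as n grows, out of reach of the compact operator [K]. *)
Lemma symbol_bnd (M C : R) f K : bnd C f -> linear K -> fin_net K ->
  bop M (fun x => toeplitz f x + K x) -> bnd (2 * M) f.
Proof.
move=> bf lK nK bM.
have key s : nm ⟪f * tpol s, tpol s⟫ <= M * L2norm (tpol s) ^+ 2.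
  apply/ler_addgt0Pr => e e0; pose P := L2norm (tpol s) + 1.
  have P0 : 0 < P by rewrite ltr_wpDl ?L2norm_ge0.
  have [N1 N1P] := fin_net_weak s lK nK (divr_gt0 e0 P0).
  have [N2 N2P] := hardy_chi_tpol s.
  pose n := maxn N1 N2; pose x := toH2 (N2P n (leq_maxr _ _)).
  have nx : hnorm x = L2norm (tpol s).
    by rewrite /hnorm /= mulrC L2norm_mulchi//; exact: L2_tpol.
  have -> : ⟪f * tpol s, tpol s⟫ = hip (toeplitz f x + K x) x - hip (K x) x.
    by rewrite hipDl addrK (hip_toeplitz bf) /= inner_chi_tpol.
  apply: le_trans (nmD _ _) _; rewrite nmN; apply: lerD.
    by apply: le_trans (nm_hip _ _) _; rewrite -nx expr2 mulrA ler_wpM2r ?hnorm_ge0.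
  apply: le_trans (N1P n (leq_maxl _ _) x) _; rewrite nx mulrAC ler_pdivrMr//.
  by rewrite ler_pM2l// lerDl.
apply: bnd_of_re => c c1; have lf := L2_bnd bf.
have l1 : L2 (M%:C *: (1 : L0 R) - c *: f).
  by apply: L2_B; apply: L2_Z => //; exact: L2_1.
have pos s : 0 <= Re ⟪(M%:C *: (1 : L0 R) - c *: f) * tpol s, tpol s⟫.
  have lt := L2_tpol s.
  rewrite mulrBl !L0_scaleAl mul1r innerBl//; [|exact: L2_Z|exact/L2_Z/L2_tpolM].
  rewrite !innerZl//; last exact: L2_tpolM.
  rewrite inner_self// -rmorphM Re_D Re_N /= subr_ge0.
  apply: le_trans (ler_norm _) _; apply: le_trans (Re_le_nm _) _.
  by rewrite nmM c1 mul1r.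
apply: filterS2 (ae_Re_ge0_tpol l1 pos) (filterI (L0_1E R) (filterI (L0_scaleE (M%:C) 1) (filterI (L0_scaleE c f)
  (L0_subE (M%:C *: (1 : L0 R)) (c *: f))))).
by move=> t h [e1 [e2 [e3 e4]]]; move: h; rewrite e4 e2 e3 e1 mulr1.
Qed.

(** With w the unit vector along v, the pairings of x + w and x - w with v differ by 2|v|, so one of
    them has modulus at least |v|. *)
Lemma sign_step x v : exists2 y, hnorm (y - x) <= 1 & hnorm v <= nm (hip y v).
Proof.
have [v0|v0] := eqVneq (hnorm v) 0.
  by exists x; [rewrite subrr hnorm0|rewrite v0 nm_ge0].
have vp : 0 < hnorm v by rewrite lt_def v0 hnorm_ge0.
pose w := ((hnorm v)^-1)%:C *: v.
have w1 : hnorm w = 1.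
  by rewrite hnormZ nm_real ger0_norm ?invr_ge0 ?(ltW vp)// mulVf.
have wv : hip w v = (hnorm v)%:C.
  by rewrite hipZl hip_self -rmorphM; congr (_%:C); rewrite expr2 mulKf.
have := nmD (hip (x + w) v) (- hip (x - w) v).
have -> : hip (x + w) v - hip (x - w) v = (2 * hnorm v)%:C.
  by rewrite hipDl hipBl wv rmorphM rmorph_nat; ring.
rewrite nmN nm_real ger0_norm ?mulr_ge0 ?hnorm_ge0// => h.
have [h1|h1] := leP (hnorm v) (nm (hip (x + w) v)).
  by exists (x + w) => //; rewrite addrAC subrr add0r w1.
exists (x - w); first by rewrite addrAC subrr add0r hnormN w1.
by move: h h1; move: (nm _) (nm _) (hnorm v) => a b d; lra.
Qed.

Lemma scaled_sign_step x v (r : R) : 0 < r ->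
  exists2 y, hnorm (y - x) <= r & r * hnorm v <= nm (hip y v).
Proof.
move=> r0; have [y yx yv] := sign_step (r^-1%:C *: x) v.
have rr : r%:C * r^-1%:C = 1 :> R[i] by rewrite -rmorphM mulfV ?gt_eqF// rmorph1.
exists (r%:C *: y); last by rewrite hipZl nmM nm_real (ger0_norm (ltW r0)) ler_pM2l.
rewrite -[x]scale1r -rr -scalerA -scalerBr hnormZ nm_real (ger0_norm (ltW r0)).
by rewrite ler_piMr// ltW.
Qed.

(* Sokal's gliding hump: if [v n] in [Z] has norm at least [n 4^n], successive
   steps of length [4^-n] lead to a point where [Z] is unbounded. *)
Lemma uniform_boundedness (Z : set (H2 R)) :
  (forall u, exists C : R, forall v, Z v -> nm (hip u v) <= C) ->
  exists M : R, forall v, Z v -> hnorm v <= M.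
Proof.
move=> ptw; apply: contrapT => /forallNP unb.
have /choice[v vP] : forall n : nat, exists v, Z v /\ n%:R * 4 ^+ n <= hnorm v.
  move=> n; have /existsNP[v /not_implyP[Zv /negP]] := unb (n%:R * 4 ^+ n).
  by rewrite -ltNge => /ltW; exists v.
have r0 n : 0 < 4 ^- n :> R by rewrite invr_gt0 exprn_gt0.
have /choice[G GP] : forall p : nat * H2 R, exists y, hnorm (y - p.2) <= 4 ^- p.1 /\
    4 ^- p.1 * hnorm (v p.1) <= nm (hip y (v p.1)).
  by move=> p; have [y h1 h2] := scaled_sign_step p.2 (v p.1) (r0 p.1); exists y.
pose X := fix X (n : nat) : H2 R := if n is m.+1 then G (m, X m) else 0.
have step n : hnorm (X n.+1 - X n) <= 4 ^- n by have [] := GP (n, X n).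
have hit n : 4 ^- n * hnorm (v n) <= nm (hip (X n.+1) (v n)) by have [] := GP (n, X n).
have tail n m : hnorm (X (n + m)%N - X n) <= 4 / 3 * (4 ^- n - 4 ^- (n + m)%N).
  elim: m => [|m ih]; first by rewrite addn0 !subrr hnorm0 mulr0.
  rewrite addnS; apply: le_trans (hnorm_triangle _ _ (X (n + m)%N)) _.
  apply: le_trans (lerD (step _) ih) _; rewrite exprS invfM.
  by move: (4 ^- _) (4 ^- n) => a b; lra.
have va : vanishing (fun n => 4 / 3 * 4 ^- n : R).
  move=> e e0; have [N NP] := vanishing_geo (ler0n R 2) e0; exists N => n Nn.
  apply: le_trans (NP n Nn); apply: (@le_trans _ _ (2 * 4 ^- n)).
    by rewrite ler_pM2r ?r0//; lra.
  rewrite ler_pM2l// lef_pV2 ?posrE ?exprn_gt0// lerXn2r ?nnegrE//.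
  by rewrite ler_nat.
have cX k m : (k <= m)%N -> hnorm (X m - X k) <= 4 / 3 * 4 ^- k.
  move=> /subnKC <-; apply: le_trans (tail _ _) _.
  by have := r0 (k + (m - k))%N; move: (4 ^- _) (4 ^- k) => a b; lra.
have [x xP] := H2_complete va cX.
have [C CP] := ptw x.
(* The steps after n + 1 move the point by at most 4^-n / 3, so the pairing of x with [v n] keeps
   two thirds of 4^-n |v n|, at least 2n/3 > C. *)
pose n := (Num.truncn (3 / 2 * C)).+1.
have := CP _ (vP n).1; apply/negP; rewrite -ltNge.
have h0 : 3 / 2 * C < n%:R by exact: truncnS_gt.
have h1 := hit n.
have := nmD (hip x (v n)) (hip (X n.+1 - x) (v n)).
rewrite -hipDl addrC subrK => h2.
have h3 := nm_hip (X n.+1 - x) (v n).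
have h4 := xP n.+1; rewrite hnormBC exprS invfM in h4.
have h5 : hnorm (X n.+1 - x) * hnorm (v n) <= 4 ^- n / 3 * hnorm (v n).
  by rewrite ler_wpM2r ?hnorm_ge0//; move: h4; move: (4 ^- n) (hnorm _) => a b; lra.
have h6 : n%:R <= 4 ^- n * hnorm (v n).
  by rewrite mulrC ler_pdivlMr ?exprn_gt0//; exact: (vP n).2.
move: h0 h1 h2 h3 h5 h6; move: (nm _) (nm _) (nm _) (hnorm _) (hnorm _) (4 ^- n) (n%:R) => a b d e p q r.
by lra.
Qed.

(** For d = 1 the admissible v form a set that is bounded at each u = A y + sum c_i e_i, hence
    bounded in norm by uniform boundedness; scaling gives the general d. This stands in for a lower
    bound on the adjoint modulo finitely many constraints. *)
Lemma finite_codim_lower A m (e : 'I_m -> H2 R) : linear A ->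
  (forall x, exists (w : H2 R) (c : 'I_m -> R[i]), range A w /\ x = w + \sum_i c i *: e i) ->
  exists2 M : R, 0 <= M & forall v (d : R), 0 < d ->
    (forall x, nm (hip (A x) v) <= d * hnorm x) -> (forall i, nm (hip (e i) v) <= d) ->
    hnorm v <= M * d.
Proof.
move=> lA cod.
pose Z := [set v | (forall x, nm (hip (A x) v) <= hnorm x) /\ forall i, nm (hip (e i) v) <= 1].
have [u|M MP] := uniform_boundedness (Z := Z).
  have [w [c [[y _ <-] ->]]] := cod u.
  exists (hnorm y + \sum_i nm (c i)) => v [h1 h2].
  rewrite hipDl; apply: le_trans (nmD _ _) _; rewrite lerD//.
  elim/big_ind2: _ => [|a b a' b' h h'|i _]; first by rewrite hip0l nm0.
    by rewrite hipDl; apply: le_trans (nmD _ _) _; exact: lerD.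
  by rewrite hipZl nmM ler_piMr ?nm_ge0.
exists `|M| => // v d d0 h1 h2.
have dn (b k : R) : b <= d * k -> d^-1 * b <= k by move=> h; rewrite ler_pdivrMl.
have ni : nm (conjc ((d^-1)%:C)) = d^-1.
  by rewrite nm_conj nm_real ger0_norm// invr_ge0 ltW.
have := MP ((d^-1)%:C *: v); rewrite hnormZ nm_real (ger0_norm (_ : 0 <= d^-1)) ?invr_ge0 ?(ltW d0)//.
rewrite ler_pdivrMl// => h; rewrite mulrC; apply: le_trans (h _) _.
  split=> [x|i]; rewrite hipZr nmM ni; apply: dn => //.
  by rewrite mulr1.
by rewrite ler_pM2l// ler_norm.
Qed.

(** Test vectors v = chi_n p with n large pair negligibly with the range of K and with the e_i,
    while |<T_f x, v>| <= |x| |(conj f) p|. Hence |p| <= M |(conj f) p| for all p, and positivity of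
    the associated form bounds |f| below. *)
Lemma fredholm_symbol (C : R) f K : bnd C f -> linear K -> fin_net K ->
  finite_codimensional (range (toeplitz f \+ K)) ->
  exists2 d : R, 0 < d & {ae mu, forall t : T, d <= nm (f t)}.
Proof.
move=> bf lK nK [m [e cod]]; set A := toeplitz f \+ K in cod.
have lA : linear A.
  move=> c x y; rewrite /A /= (toeplitz_lin bf) lK.
  by rewrite scalerDr addrACA.
have [M M0 MP] := finite_codim_lower lA cod.
have lf := L2_bnd bf; have lcf := L2_conj lf; have bcf := bnd_conj bf.
have key s : L2norm (tpol s) <= M * L2norm (L0conj f * tpol s).
  have lt := L2_tpol s.
  apply/ler_addgt0Pr => r r0.
  have r1 : 0 < r / (M + 1) by rewrite divr_gt0// ltr_wpDl.
  have [N1 N1P] := fin_net_weak s lK nK r1.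
  have [N2 N2P] := hardy_chi_tpol s.
  have [N3 N3P] : exists N, forall n, (N <= n)%N -> forall i : 'I_m,
      nm ⟪H2val (e i), chi R n%:Z * tpol s⟫ <= r / (M + 1).
    have /choice[N NP] : forall i : 'I_m, exists N, forall n, (N <= n)%N ->
        nm ⟪H2val (e i), chi R n%:Z * tpol s⟫ <= r / (M + 1).
      by move=> i; exact: vanishing_inner_tpol (L2_H2 _) _ r1.
    exists (\max_i N i) => n Nn i; apply: NP; apply: leq_trans Nn.
    exact: leq_bigmax.
  pose n := maxn N1 (maxn N2 N3).
  have n2 : (N2 <= n)%N by rewrite /n !leq_max leqnn !orbT.
  have n3 : (N3 <= n)%N by rewrite /n !leq_max leqnn !orbT.
  pose v := toH2 (N2P n n2).
  have nv : hnorm v = L2norm (tpol s) by rewrite /hnorm /= mulrC L2norm_mulchi.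
  (* The term r / (M + 1) absorbs K and the e_i and makes the argument positive; after
     multiplication by M it costs at most r. *)
  have := MP v (L2norm (L0conj f * tpol s) + r / (M + 1)).
  rewrite nv => h; apply: le_trans (h _ _ _) _.
  - by rewrite ltr_wpDl ?L2norm_ge0.
  - move=> x; rewrite hipDl mulrDl; apply: le_trans (nmD _ _) _; rewrite lerD//; last first.
      exact: N1P (leq_maxl _ _) x.
    rewrite (hip_toeplitz bf) inner_mull [leRHS]mulrC -(L2norm_chi_tpol n%:Z s lcf).
    by apply: nm_inner; [exact: L2_H2|have [] := L2_bndM bcf (L2_H2 v)].
  - move=> i; apply: le_trans (N3P n n3 i) _.
    by rewrite lerDr L2norm_ge0.
  rewrite mulrDr lerD2l mulrA ler_pdivrMr ?ltr_wpDl// mulrC ler_pM2l//.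
  by rewrite lerDl.
have M1 : 0 < M + 1 by rewrite ltr_wpDl.
(* M itself may be 0. *)
exists (M + 1)^-1; first by rewrite invr_gt0.
pose q := (M + 1) ^+ 2.
have bq : L2 (q%:C *: (f * L0conj f) - 1).
  by apply: L2_B; [exact/L2_Z/(L2_bnd (bndM bf bcf))|exact: L2_1].
have pos s : 0 <= Re ⟪(q%:C *: (f * L0conj f) - 1) * tpol s, tpol s⟫.
  have lt := L2_tpol s.
  have l1 := L2_tpolM s lcf.
  rewrite mulrBl L0_scaleAl mul1r innerBl//; last first.
    by apply: L2_Z; apply: L2_tpolM; exact: L2_bnd (bndM bf bcf).
  rewrite innerZl//; last by apply: L2_tpolM; exact: L2_bnd (bndM bf bcf).
  rewrite -mulrA inner_mull !inner_self// -rmorphM -rmorphB /= subr_ge0 /q -exprMn.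
  rewrite lerXn2r ?nnegrE ?mulr_ge0 ?L2norm_ge0 ?(ltW M1)//.
  apply: le_trans (key s) _; rewrite ler_wpM2r ?L2norm_ge0//.
  by rewrite lerDl.
apply: filterS2 (ae_Re_ge0_tpol bq pos) (filterI (filterI (L0_1E R) (L0_scaleE q%:C (f * L0conj f)))
  (filterI (filterI (L0_mulE f (L0conj f)) (L0conjE f)) (L0_subE (q%:C *: (f * L0conj f)) 1))).
move=> t h [[e1 e2] [[e3 e4] e5]]; move: h; rewrite e5 e2 e3 e4 e1 mul_conj -rmorphM.
rewrite -(rmorph1 (real_complex R)) -rmorphB /= subr_ge0 /q -exprMn => h.
have h1 : 1 <= (M + 1) * nm (f t).
  rewrite -(@ler_pXn2r _ 2) ?nnegrE ?mulr_ge0 ?nm_ge0 ?(ltW M1)//.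
  by rewrite expr1n.
by rewrite -[X in X <= _]mulr1 ler_pdivrMl.
Qed.

End symbol_bounds.

(** * Semicommutators and the C*-algebra of the operators T_f + K *)

Section toeplitz_plus_compact.
Variable R : realType.
Local Notation twopi := (pi *+ 2 : R).
Implicit Types (f g h : L0 R) (x y u v : H2 R) (z w c : R[i]) (A B K L : H2 R -> H2 R).

Lemma linear_comb c A B : linear A -> linear B -> linear (fun x => c *: A x + B x).
Proof.
move=> lA lB d x y; rewrite lA lB !scalerDr addrACA !scalerA.
by rewrite [c * d]mulrC.
Qed.

Lemma linear_add A B : linear A -> linear B -> linear (fun x => A x + B x).
Proof. by move=> lA lB d x y; rewrite lA lB scalerDr addrACA. Qed.

Lemma linear_sub A B : linear A -> linear B -> linear (fun x => A x - B x).
Proof. by move=> lA lB d x y; rewrite lA lB scalerBr opprD addrACA. Qed.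

Lemma linear_comp A B : linear A -> linear B -> linear (A \o B).
Proof. by move=> lA lB d x y; rewrite /= lB lA. Qed.

Lemma linear_0 : linear (fun _ : H2 R => 0 : H2 R).
Proof. by move=> c x y; rewrite scaler0 addr0. Qed.

Lemma fin_net_add A B : fin_net A -> fin_net B -> fin_net (fun x => A x + B x).
Proof.
move=> nA nB; rewrite (_ : (fun x => _) = fun x => 1 *: A x + B x); first exact: fin_net_lin.
by apply/funext => x; rewrite scale1r.
Qed.

Lemma hardy_chi (k : nat) : Hardy 2%:E (chi R k%:Z).
Proof. exact/Hinf_hardy/Hinf_chi. Qed.

Definition hchi (k : nat) : H2 R := toH2 (hardy_chi k).

Definition coef (k : nat) x : R[i] := hip x (hchi k) * (twopi^-1)%:C.
Definition hsum (N : nat) x : H2 R := \sum_(0 <= k < N) coef k x *: hchi k.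

Lemma coef_lin k c x y : coef k (c *: x + y) = c * coef k x + coef k y.
Proof. by rewrite /coef hipDl hipZl mulrDl mulrA. Qed.

Lemma nm_coef k : exists M : R, forall x, nm (coef k x) <= M * hnorm x.
Proof.
exists (hnorm (hchi k) * `|twopi^-1|) => x; rewrite /coef nmM nm_real mulrAC ler_wpM2r//.
by rewrite mulrC; exact: nm_hip.
Qed.

Lemma H2val_sum J (r : seq J) (F : J -> H2 R) :
  H2val (\sum_(j <- r) F j) = \sum_(j <- r) H2val (F j).
Proof. exact: (big_morph _ (@H2valD R) (H2val0 R)). Qed.

Lemma H2val_hsum N x : H2val (hsum N x) = fsum (H2val x) N.
Proof. by rewrite /hsum H2val_sum; apply: eq_bigr => k _; rewrite H2valZ. Qed.

Lemma hsum_lin N : linear (hsum N).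
Proof.
move=> c x y; rewrite /hsum scaler_sumr -big_split /=; apply: eq_bigr => k _.
by rewrite coef_lin scalerDl scalerA.
Qed.

Lemma fin_net_rank (N : nat) (phi : nat -> H2 R -> R[i]) (V : nat -> H2 R) :
  (forall k, exists M : R, forall x, nm (phi k x) <= M * hnorm x) ->
  fin_net (fun x => \sum_(0 <= k < N) phi k x *: V k).
Proof.
move=> bphi; elim: N => [|N ih].
  rewrite (_ : (fun x => _) = fun _ => 0); first exact: fin_net_0.
  by apply/funext => x; rewrite big_geq.
have [M MP] := bphi N.
rewrite (_ : (fun x => _) = fun x => 1 *: (\sum_(0 <= k < N) phi k x *: V k) + phi N x *: V N).
  by apply: fin_net_lin => //; exact: fin_net_rank1 MP.
by apply/funext => x; rewrite big_nat_recr//= scale1r.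
Qed.

Definition semicomm f g x : H2 R := toeplitz f (toeplitz g x) - toeplitz (f * g) x.

Lemma semicomm_lin M N f g : bnd M f -> bnd N g -> linear (semicomm f g).
Proof.
move=> bf bg c x y; rewrite /semicomm (toeplitz_lin bg) (toeplitz_lin bf) (toeplitz_lin (bndM bf bg)).
by rewrite scalerBr opprD addrACA.
Qed.

Lemma semicomm_linr M N1 N2 f g h c : bnd M f -> bnd N1 g -> bnd N2 h ->
  semicomm f (c *: g + h) = fun x => c *: semicomm f g x + semicomm f h x.
Proof.
move=> bf bg bh; apply/funext => x; rewrite /semicomm.
rewrite (toeplitzD x (bndZ c bg) bh) (toeplitzZ c x bg) (toeplitz_lin bf).
rewrite mulrDr L0_scaleAr (toeplitzD x (bndZ c (bndM bf bg)) (bndM bf bh)) (toeplitzZ c x (bndM bf bg)).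
by rewrite scalerBr opprD addrACA.
Qed.

Lemma semicomm_bop M N f g : bnd M f -> bnd N g -> bop (2 * (M * N)) (semicomm f g).
Proof.
move=> bf bg x; apply: le_trans (hnormB _ _) _; rewrite mulr_natl mulr2n mulrDl lerD//.
  apply: le_trans (hnorm_toeplitz bf _) _; rewrite -mulrA ler_wpM2l ?(bnd_ge0 bf)//.
  exact: hnorm_toeplitz.
exact: (hnorm_toeplitz (bndM bf bg)).
Qed.

(** When g x already lies in H^2, the inner projection does nothing. The compactness of
    semicommutators starts from this. *)
Lemma semicomm_eq0 f g x : Hardy 2%:E (g * H2val x) -> semicomm f g x = 0.
Proof.
move=> hg; rewrite /semicomm {2}/toeplitz -[g * _]/(H2val (toH2 hg)) H2proj_id.
by rewrite /toeplitz mulrA subrr.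
Qed.

Lemma hardy_tail N x : Hardy 2%:E (chi R (- N%:Z) * H2val (x - hsum N x)).
Proof.
apply/hardyP; split; first by rewrite mulrC; apply: L2_mulchi; exact: L2_H2.
move=> m m0; rewrite mulrC inner_mulchi opprK H2valB H2val_hsum innerBl; last 3 first.
- exact: L2_H2.
- exact: L2_fsum.
- exact: L2_chi.
rewrite inner_fsum; case: ifP => [_|]; first by rewrite subrr.
rewrite gtrDr m0 andbT => /negbT; rewrite -ltNge => h.
by rewrite subr0; have [_] := (hardyP _).1 (H2valP x); apply.
Qed.

(** [Negz n] is -(n+1): once its first n+1 coefficients are removed, x stays in H^2 after this
    shift, so only those coefficients contribute. *)
Lemma semicomm_chiN M f n x : bnd M f -> semicomm f (chi R (Negz n)) x =
  \sum_(0 <= k < n.+1) coef k x *: semicomm f (chi R (Negz n)) (hchi k).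
Proof.
move=> bf; have ls := semicomm_lin bf (bnd_chi R (Negz n)).
rewrite -{1}(subrK (hsum n.+1 x) x) (lin_D ls).
rewrite semicomm_eq0 ?add0r; last by rewrite NegzE; exact: hardy_tail.
by rewrite /hsum (lin_sum ls); apply: eq_bigr => k _; rewrite (lin_Z ls).
Qed.

Lemma fin_net_semicomm_chi M f m : bnd M f -> fin_net (semicomm f (chi R m)).
Proof.
move=> bf; case: m => n.
  rewrite (_ : semicomm _ _ = fun _ => 0); first exact: fin_net_0.
  apply/funext => x; apply: semicomm_eq0; apply: Hinf_hardyM; last exact: H2valP.
  exact: Hinf_chi.
rewrite (_ : semicomm f _ = fun x => \sum_(0 <= k < n.+1) coef k x *: semicomm f (chi R (Negz n)) (hchi k)).
  by apply: fin_net_rank => k; exact: nm_coef.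
by apply/funext => x; exact: semicomm_chiN bf.
Qed.

Lemma fin_net_semicomm_tpol M f s : bnd M f -> fin_net (semicomm f (tpol s)).
Proof.
move=> bf; elim: s => [|p s ih].
  rewrite (_ : semicomm _ _ = fun _ => 0); first exact: fin_net_0.
  by apply/funext => x; rewrite /tpol big_nil /semicomm mulr0 !toeplitz0 subr0 (lin_0 (toeplitz_lin bf)).
rewrite /tpol big_cons; have [N bN] := bnd_tpol s.
rewrite -/(tpol s); have -> := semicomm_linr p.1 bf (bnd_chi R p.2) bN.
exact: fin_net_lin (fin_net_semicomm_chi _ bf) ih.
Qed.

Lemma fin_net_semicomm M f g : bnd M f -> HinfC g -> fin_net (semicomm f g).
Proof.
move=> bf [h hh [d cd <-]].
have [[N1 b1] _] := (HinfP h).1 hh; have [N2 N20 b2] := CT_bnd cd.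
rewrite -[h]scale1r (semicomm_linr _ bf b1 b2).
apply: fin_net_lin.
  rewrite (_ : semicomm _ _ = fun _ => 0); first exact: fin_net_0.
  by apply/funext => x; apply: semicomm_eq0; apply: Hinf_hardyM => //; exact: H2valP.
apply: fin_net_limit => e e0; have M0 := bnd_ge0 bf.
have M1 : 0 < 2 * M + 1 by rewrite ltr_wpDl// mulr_ge0.
have [s sP] := CT_approx cd (divr_gt0 e0 M1).
exists (semicomm f (tpol s)); first exact: fin_net_semicomm_tpol bf.
have [N3 b3] := bnd_tpol s.
have -> : (fun x => semicomm f d x - semicomm f (tpol s) x) = semicomm f (d - tpol s).
  rewrite addrC -scaleN1r (semicomm_linr _ bf b3 b2); apply/funext => x.
  by rewrite scaleN1r addrC.
apply: bop_mono (semicomm_bop bf sP).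
by rewrite mulrA mulrCA ler_piMr ?(ltW e0)// ler_pdivrMr// mul1r lerDl.
Qed.

Definition toeplitz_compact : set (H2 R -> H2 R) :=
  [set A | exists f K, [/\ QC f, linear K, fin_net K & A = toeplitz f \+ K]].

Lemma toeplitz_compact_bounded A : toeplitz_compact A -> bounded_operator A.
Proof.
move=> [f [K [qf lK nK ->]]]; have [M M0 bM] := QC_bnd qf; have [N N0 bN] := fin_net_bop lK nK.
apply/bounded_operatorP; split.
  exact: linear_add (toeplitz_lin bM) lK.
exists (M + N); first exact: addr_ge0.
by move=> x; apply: le_trans (hnormD _ _) _; rewrite mulrDl lerD//; exact: hnorm_toeplitz.
Qed.

Lemma toeplitz_compact_lin c A B : toeplitz_compact A -> toeplitz_compact B ->
  toeplitz_compact (fun x => c *: A x + B x).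
Proof.
move=> [f [K [qf lK nK ->]]] [g [L [qg lL nL ->]]].
have [M M0 bM] := QC_bnd qf; have [N N0 bN] := QC_bnd qg.
exists (c *: f + g), (fun x => c *: K x + L x); split.
- exact: QC_lin.
- exact: linear_comb.
- exact: fin_net_lin.
apply/funext => x /=; rewrite (toeplitzD x (bndZ c bM) bN) (toeplitzZ c x bM).
by rewrite scalerDr addrACA.
Qed.

Lemma toeplitz_compact_comp A B : toeplitz_compact A -> toeplitz_compact B ->
  toeplitz_compact (A \o B).
Proof.
move=> [f [K [qf lK nK ->]]] /[dup] tB [g [L [qg lL nL BE]]].
have [lB [Q Q0 bQ]] := (bounded_operatorP _).1 (toeplitz_compact_bounded tB).
have [M M0 bM] := QC_bnd qf; have [N N0 bN] := QC_bnd qg.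
have lf := toeplitz_lin bM; have ls := semicomm_lin bM bN.
have ns : fin_net (semicomm f g) by apply: fin_net_semicomm bM _; have [] := (QCP g).1 qg.
have n1 : fin_net (toeplitz f \o L).
  exact: fin_net_compl lf (hnorm_toeplitz bM) nL.
have n2 : fin_net (K \o B) by exact: fin_net_compr lK bQ nK.
exists (f * g), (fun x => semicomm f g x + (toeplitz f (L x) + K (B x))); split.
- exact: QC_mul.
- by apply: linear_add ls _; apply: linear_add; [exact: linear_comp lf lL|exact: linear_comp].
- by apply: fin_net_add => //; exact: fin_net_add.
apply/funext => x; rewrite /= {1}BE /= (lin_D lf) /semicomm.
by rewrite [RHS]addrA [toeplitz (f * g) x + (_ - _)]addrC subrK addrA.
Qed.

(** The symbol of the adjoint is conj f, and the remainder B - T_(conj f) is the adjoint of K. *)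
Lemma toeplitz_compact_adj A B : toeplitz_compact A -> bounded_operator B ->
  adjoint_operators A B -> toeplitz_compact B.
Proof.
move=> [f [K [qf lK nK ->]]] /bounded_operatorP[lB [M M0 bB]] adj.
have [N N0 bN] := QC_bnd qf; have bcN := bnd_conj bN.
pose L x := B x - toeplitz (L0conj f) x.
have lL : linear L by exact: linear_sub lB (toeplitz_lin bcN).
exists (L0conj f), L; split => //; first exact: QC_conj.
- apply: (@fin_net_adjoint _ (M + N) K) => // [x|x y].
    by apply: le_trans (hnormB _ _) _; rewrite mulrDl lerD//; exact: hnorm_toeplitz.
  rewrite /L hipBr -(toeplitz_adj bN) -[hip x (B y)](adj x y).
  by rewrite -/(hip _ _) /= hipDl addrC addKr.
by apply/funext => x; rewrite /L /= addrC subrK.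
Qed.

(** The summands T_f and K of an approximating sequence are not controlled separately by the
    operator norm; [symbol_bnd] applied to differences makes the symbols Cauchy. The compact part is
    then recovered as A - T_f. *)
Lemma toeplitz_compact_closed A : operator_closure toeplitz_compact A -> toeplitz_compact A.
Proof.
move=> [/bounded_operatorP[lA [M M0 bA]] clA].
have r0 n : 0 < 2 ^- n :> R by rewrite invr_gt0 exprn_gt0.
have /choice[F FP] : forall n : nat, exists p : L0 R * (H2 R -> H2 R), [/\ QC p.1, linear p.2, fin_net p.2 &
    bop (2 ^- n) (fun x => A x - (toeplitz p.1 x + p.2 x))].
  move=> n; have [|B [f [K [qf lK nK ->]]] BP] := clA (2 ^- n)%:C; first by rewrite ltcR.
  by exists (f, K); split => // x; have := BP x; rewrite !H2normE -rmorphM lecR.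
have qF n : QC (F n).1 by have [] := FP n.
have lF n : linear (F n).2 by have [] := FP n.
have nF n : fin_net (F n).2 by have [] := FP n.
have bF n : bop (2 ^- n) (fun x => A x - (toeplitz (F n).1 x + (F n).2 x)) by have [] := FP n.
have cF k m : (k <= m)%N -> bnd (4 * 2 ^- k) ((F m).1 - (F k).1).
  move=> km; have [M1 _ b1] := QC_bnd (qF m); have [M2 _ b2] := QC_bnd (qF k).
  (* One factor 2 comes from [symbol_bnd], the other from two operators each within 2^-k of A. *)
  apply: (@bnd_mono _ (2 * (2 * 2 ^- k))); first by rewrite mulrA -natrM.
  apply: (@symbol_bnd _ _ _ _ (fun x => (-1) *: (F k).2 x + (F m).2 x) (bndB b1 b2)).
  - exact: linear_comb.
  - exact: fin_net_lin.
  move=> x; rewrite (toeplitzB x b1 b2) scaleN1r.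
  have -> : toeplitz (F m).1 x - toeplitz (F k).1 x + (- (F k).2 x + (F m).2 x) =
      (A x - (toeplitz (F k).1 x + (F k).2 x)) - (A x - (toeplitz (F m).1 x + (F m).2 x)).
    apply: (@H2val_inj R); rewrite !(H2valD, H2valB, H2valN).
    by move: (H2val _) (H2val _) (H2val _) (H2val _) (H2val _) => a1 a2 a3 a4 a5; ring.
  apply: le_trans (hnormB _ _) _; apply: le_trans (lerD (bF k x) (bF m x)) _.
  rewrite -mulrDl ler_wpM2r ?hnorm_ge0//.
  have : 2 ^- m <= 2 ^- k :> R by rewrite lef_pV2 ?posrE ?exprn_gt0// ler_eXn2l// ltr1n.
  by move: (2 ^- m) (2 ^- k) => a b; lra.
have [f fP] := Linf_complete (vanishing_geo (ler0n R 4)) cF.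
have qf : QC f.
  apply: QC_closed => e e0; have [N NP] := vanishing_geo (ler0n R 4) e0.
  by exists (F N).1 => //; exact: bnd_mono (NP N (leqnn N)) (fP N).
have [C C0 bC] := QC_bnd qf.
exists f, (fun x => A x - toeplitz f x); split => //.
- exact: linear_sub lA (toeplitz_lin bC).
(* 5 = 1 + 4: the error of the approximating operator plus that of its symbol. *)
- apply: fin_net_limit => e e0; have [N NP] := vanishing_geo (ler0n R 5) e0.
  exists (F N).2 => // x; have [M1 _ b1] := QC_bnd (qF N).
  have -> : A x - toeplitz f x - (F N).2 x =
      (A x - (toeplitz (F N).1 x + (F N).2 x)) - (toeplitz f x - toeplitz (F N).1 x).
    apply: (@H2val_inj R); rewrite !(H2valD, H2valB, H2valN).
    by move: (H2val _) (H2val _) (H2val _) (H2val _) => a1 a2 a3 a4; ring.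
  rewrite -(toeplitzB x bC b1); apply: le_trans (hnormB _ _) _.
  apply: le_trans (lerD (bF N x) (hnorm_toeplitz (fP N) x)) _.
  rewrite -mulrDl ler_wpM2r ?hnorm_ge0//; apply: le_trans (NP N (leqnn N)).
  by move: (2 ^- N) => a; lra.
by apply/funext => x /=; rewrite addrC subrK.
Qed.

Lemma toeplitz_compact_cstar : cstar_algebra toeplitz_compact.
Proof.
split.
- exact: toeplitz_compact_bounded.
- split; last exact: toeplitz_compact_lin.
  exists 0, (fun _ => 0); split; [exact: QC_0|exact: linear_0|exact: fin_net_0|].
  by apply/funext => x /=; rewrite toeplitz0 addr0.
- exact: toeplitz_compact_comp.
- exact: toeplitz_compact_adj.
- exact: toeplitz_compact_closed.
Qed.

Lemma toeplitzQC_algebraE : @toeplitzQC_algebra R `<=` toeplitz_compact.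
Proof.
move=> A; apply; split; first exact: toeplitz_compact_cstar.
move=> _ [f qf <-]; exists f, (fun _ => 0); split => //.
- exact: linear_0.
- exact: fin_net_0.
by apply/funext => x /=; rewrite addr0.
Qed.

End toeplitz_plus_compact.

(** * Fredholm operators *)

Section fredholm_theory.
Variable R : realType.
Implicit Types (f g h : L0 R) (x y u v : H2 R) (z w c : R[i]) (A B K L : H2 R -> H2 R).
Implicit Types X Y : set (H2 R).

Lemma hnorm_hsum N x : hnorm (hsum N x) <= hnorm x.
Proof.
rewrite -ler_sqr ?nnegrE ?hnorm_ge0// /hnorm H2val_hsum /fsum L2norm_lincomb ?iota_uniq//.
exact: bessel (L2_H2 x).
Qed.

Lemma hsum_cvg x : vanishing (fun N => hnorm (x - hsum N x)).
Proof.
move=> e /(hardy_fsum (H2valP x))[N NP]; exists N => n /NP.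
by rewrite /hnorm H2valB H2val_hsum.
Qed.

(** The partial-sum projections contract and converge strongly, hence uniformly on a totally bounded
    set: K is a norm limit of finite rank operators. *)
Lemma fin_net_hsum K (e : R) : fin_net K -> linear K -> 0 < e ->
  exists N0, forall N, (N0 <= N)%N -> bop e (fun x => K x - hsum N (K x)).
Proof.
move=> nK lK e0; have e3 : 0 < e / 3 by rewrite divr_gt0.
have [s sP] := nK _ e3.
have [N0 N0P] : exists N0, forall N, (N0 <= N)%N -> forall y, y \in s -> hnorm (y - hsum N y) <= e / 3.
  elim: (s) => [|y t [N1 N1P]]; first by exists 0%N.
  have [N2 N2P] := hsum_cvg y e3; exists (maxn N1 N2) => N; rewrite geq_max => /andP[h1 h2] u.
  by rewrite inE => /orP[/eqP ->|ut]; [exact: N2P|exact: N1P].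
exists N0 => N NN; have lD := linear_sub (fun c x y => erefl (c *: x + y)) (@hsum_lin R N).
pose p u := hnorm (u - hsum N u).
apply: (lin_homogeneous (p := p) lK) => [c x|x x1]; first by rewrite /p (lin_Z lD) hnormZ.
have [y ys xy] := sP x x1.
have -> : p (K x) = hnorm ((y - hsum N y) + ((K x - y) - hsum N (K x - y))).
  rewrite /p; congr hnorm; rewrite -(lin_D lD y (K x - y)).
  by rewrite [y + (K x - y)]addrC subrK.
have -> : e = e / 3 + (e / 3 + e / 3) by field.
apply: le_trans (hnormD _ _) _; apply: lerD; first exact: N0P NN _ ys.
apply: le_trans (hnormB _ _) _; apply: lerD => //.
exact: le_trans (hnorm_hsum _ _) _.
Qed.

Lemma half_bop_lower A x : bop 2^-1 A -> hnorm x <= 2 * hnorm (x + A x).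
Proof.
move=> bA; have := hnormB (x + A x) (A x); rewrite addrK => h.
by have := bA x; move: h; move: (hnorm _) (hnorm _) (hnorm _) => a b d; lra.
Qed.

(** The solution of x + A x = y is the limit of the iteration x -> y - A x. Uniqueness of solutions
    makes the inverse linear and two-sided. *)
Lemma neumann A : linear A -> bop 2^-1 A -> exists B, [/\ linear B,
  forall y, B y + A (B y) = y & forall x, B (x + A x) = x].
Proof.
move=> lA bA.
have inj x y : x + A x = y + A y -> x = y.
  move=> xy; apply/eqP; rewrite -subr_eq0; apply/eqP/hnorm_eq0/eqP.
  rewrite eq_le hnorm_ge0 andbT; apply: le_trans (half_bop_lower (x - y) bA) _.
  by rewrite (lin_B lA) addrACA -opprD xy subrr hnorm0 mulr0.
have /choice[B BP] : forall y, exists x, x + A x = y.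
  move=> y; pose X (n : nat) : H2 R := iter n (fun x => y - A x) 0.
  have XS n : X n.+1 = y - A (X n) by [].
  have step n : hnorm (X n.+1 - X n) <= 2 ^- n * hnorm y.
    elim: n => [|n ih]; first by rewrite /X /= (lin_0 lA) !subr0 expr0 invr1 mul1r.
    have -> : X n.+2 - X n.+1 = - A (X n.+1 - X n).
      by rewrite (XS n.+1) (lin_B lA) {2}(XS n) opprB addrC addrA subrK opprB.
    rewrite hnormN; have := bA (X n.+1 - X n); rewrite exprS invfM -mulrA => /le_trans; apply.
    by rewrite ler_pM2l ?invr_gt0.
  have va : vanishing (fun n => 2 * hnorm y * 2 ^- n).
    by apply: vanishing_geo; rewrite mulr_ge0 ?hnorm_ge0.
  have tail k m : hnorm (X (k + m)%N - X k) <= 2 * (2 ^- k - 2 ^- (k + m)%N) * hnorm y.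
    elim: m => [|m ih]; first by rewrite addn0 !subrr hnorm0 mulr0 mul0r.
    rewrite addnS; apply: le_trans (hnorm_triangle _ _ (X (k + m)%N)) _.
    apply: le_trans (lerD (step _) ih) _; rewrite -mulrDl ler_wpM2r ?hnorm_ge0//.
    by rewrite exprS invfM; move: (2 ^- _) (2 ^- k) => a b; lra.
  have cX k m : (k <= m)%N -> hnorm (X m - X k) <= 2 * hnorm y * 2 ^- k.
    move=> /subnKC <-; apply: le_trans (tail _ _) _; rewrite mulrAC ler_wpM2l//.
      by rewrite mulr_ge0 ?hnorm_ge0.
    by rewrite gerBl invr_ge0 exprn_ge0.
  have [x xP] := H2_complete va cX; exists x.
  apply/eqP; rewrite -subr_eq0; apply/eqP/hnorm_eq0/eqP.
  rewrite eq_le hnorm_ge0 andbT.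
  have vb : vanishing (fun n => 4 * hnorm y * 2 ^- n).
    by apply: vanishing_geo; rewrite mulr_ge0 ?hnorm_ge0.
  apply: (vanishing_le0 vb) => n.
  have -> : x + A x - y = (x - X n.+1) + A (x - X n).
    by rewrite XS (lin_B lA) opprB addrACA [A (X n) - y]addrC addrK.
  apply: le_trans (hnormD _ _) _; apply: le_trans (lerD (xP n.+1) (le_trans (bA _) _)) _.
    by exact: (ler_wpM2l _ (xP n)).
  rewrite exprS invfM; have := hnorm_ge0 y; have : 0 < 2 ^- n :> R by rewrite invr_gt0 exprn_gt0.
  by move: (2 ^- n) (hnorm y) => a b; nra.
exists B; split => // [c x y|x]; apply: inj; rewrite BP//.
by rewrite lA addrACA -scalerDr !BP.
Qed.

Definition hclosed X := forall x, (forall e : R, 0 < e -> exists2 y, X y & hnorm (x - y) < e) -> X x.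
Definition subspace X := X 0 /\ forall c x y, X x -> X y -> X (c *: x + y).

Lemma image_subspace A X : linear A -> subspace X -> subspace (A @` X).
Proof.
move=> lA [X0 lX]; split; first by exists 0; rewrite ?(lin_0 lA).
by move=> c _ _ [x Xx <-] [y Xy <-]; exists (c *: x + y); [exact: lX|rewrite lA].
Qed.

(** If v is outside X, its distance d to X is positive, and |c| d <= |y + c v| for y in X. The
    coefficients along v of a convergent sequence are therefore Cauchy. *)
Lemma hclosed_line X v : subspace X -> hclosed X ->
  hclosed [set x | exists2 y, X y & exists c, x = y + c *: v].
Proof.
move=> [X0 lX] cX z clz.
have [Xv|nXv] := pselect (X v).
  exists z; last by exists 0; rewrite scale0r addr0.
  apply: cX => e /clz[_ [y Xy [c ->]] zy]; exists (c *: v + y); first exact: lX.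
  by rewrite [c *: v + y]addrC.
have [d d0 dP] : exists2 d : R, 0 < d & forall y, X y -> d <= hnorm (v - y).
  apply: contrapT => h; apply: nXv; apply: cX => e e0; apply: contrapT => h'; apply: h.
  exists e => // y Xy; rewrite leNgt; apply/negP => h2; apply: h'; exists y => //.
have low c y : X y -> nm c * d <= hnorm (y + c *: v).
  have [->|c0] := eqVneq c 0; first by rewrite nm0 mul0r hnorm_ge0.
  move=> Xy; have -> : y + c *: v = c *: (v - (- c^-1 *: y + 0)).
    by rewrite addr0 scaleNr opprK scalerDr scalerA mulfV// scale1r addrC.
  by rewrite hnormZ ler_wpM2l ?nm_ge0// dP//; exact: lX.
have r0 n : 0 < 2 ^- n :> R by rewrite invr_gt0 exprn_gt0.
have /choice[p pP] : forall n : nat, exists p : H2 R * R[i], X p.1 /\ hnorm (z - (p.1 + p.2 *: v)) < 2 ^- n.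
  by move=> n; have [_ [y Xy [c ->]] h] := clz _ (r0 n); exists (y, c).
have va : vanishing (fun n => 2 / d * 2 ^- n).
  by apply: vanishing_geo; rewrite divr_ge0// ltW.
have ca (k m : nat) : (k <= m)%N -> nm ((p m).2 - (p k).2) <= 2 / d * 2 ^- k.
  move=> km; rewrite mulrAC ler_pdivlMr//.
  apply: le_trans (low _ ((-1) *: (p k).1 + (p m).1) _) _; first by apply: lX; [exact: (pP k).1|exact: (pP m).1].
  rewrite scaleN1r scalerBl [- (p k).1 + _]addrC addrACA -opprD.
  apply: le_trans (hnorm_triangle _ _ z) _; rewrite hnormBC mulr_natl mulr2n lerD//; last exact: ltW (pP k).2.
  apply: le_trans (ltW (pP m).2) _.
  by rewrite lef_pV2 ?posrE ?exprn_gt0// ler_eXn2l// ltr1n.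
have [c cP] := complex_cauchy_cvg va ca.
exists (z - c *: v); last by exists c; rewrite subrK.
apply: cX => e e0.
have vb : vanishing (fun n => (1 + 2 / d * hnorm v) * 2 ^- n).
  by apply: vanishing_geo; rewrite addr_ge0// mulr_ge0 ?hnorm_ge0// divr_ge0// ltW.
have [n nP] := vb _ (divr_gt0 e0 (ltr0Sn R 1)).
exists (p n).1; first exact: (pP n).1.
have -> : z - c *: v - (p n).1 = (z - ((p n).1 + (p n).2 *: v)) - (c - (p n).2) *: v.
  rewrite scalerBl opprB opprD !addrA subrK.
  by rewrite addrAC.
apply: le_lt_trans (hnormB _ _) _; rewrite hnormZ.
have h1 := ler_wpM2r (hnorm_ge0 v) (cP n).
apply: le_lt_trans (lerD (ltW (pP n).2) h1) _.
apply: le_lt_trans (_ : e / 2 < e); last by rewrite ltr_pdivrMr// ltr_pMr// ltr1n.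
by apply: le_trans (nP n (leqnn n)); rewrite [leRHS]mulrDl mul1r lerD2l mulrAC.
Qed.

Lemma hclosed_image_lower A X (M C : R) : linear A -> bop M A -> subspace X -> hclosed X ->
  (forall x, X x -> hnorm x <= C * hnorm (A x)) -> hclosed (A @` X).
Proof.
move=> lA bA [X0 lX] cX lowA z clz.
have r0 n : 0 < 2 ^- n :> R by rewrite invr_gt0 exprn_gt0.
have /choice[p pP] : forall n : nat, exists x, X x /\ hnorm (z - A x) < 2 ^- n.
  by move=> n; have [_ [x Xx <-] h] := clz _ (r0 n); exists x.
have va : vanishing (fun n => (2 * `|C|) * 2 ^- n) by apply: vanishing_geo; rewrite mulr_ge0.
have cp (k m : nat) : (k <= m)%N -> hnorm (p m - p k) <= (2 * `|C|) * 2 ^- k.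
  move=> km; rewrite [p m - _]addrC -scaleN1r.
  apply: le_trans (lowA _ (lX _ _ _ (pP k).1 (pP m).1)) _.
  apply: (@le_trans _ _ (`|C| * hnorm (A (-1 *: p k + p m)))).
    by rewrite ler_wpM2r ?hnorm_ge0// ler_norm.
  rewrite mulrAC [leRHS]mulrC ler_wpM2l// lA scaleN1r addrC.
  apply: le_trans (hnorm_triangle _ _ z) _; rewrite hnormBC mulr_natl mulr2n lerD//; last exact: ltW (pP k).2.
  apply: le_trans (ltW (pP m).2) _.
  by rewrite lef_pV2 ?posrE ?exprn_gt0// ler_eXn2l// ltr1n.
have [x xP] := H2_complete va cp; exists x.
  apply: cX => e e0; have [n nP] := va _ (divr_gt0 e0 (ltr0Sn R 1)).
  exists (p n); first exact: (pP n).1.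
  apply: le_lt_trans (xP n) _; apply: le_lt_trans (nP n (leqnn n)) _.
  by rewrite ltr_pdivrMr// ltr_pMr// ltr1n.
apply/esym/eqP; rewrite -subr_eq0; apply/eqP/hnorm_eq0/eqP; rewrite eq_le hnorm_ge0 andbT.
have vb : vanishing (fun n => (1 + `|M| * (2 * `|C|)) * 2 ^- n).
  by apply: vanishing_geo; rewrite addr_ge0// !mulr_ge0.
apply: (vanishing_le0 vb) => n.
apply: le_trans (hnorm_triangle _ _ (A (p n))) _; rewrite mulrDl mul1r lerD ?(ltW (pP n).2)//.
rewrite -(lin_B lA); apply: le_trans (bA _) _.
apply: (@le_trans _ _ (`|M| * hnorm (p n - x))); first by rewrite ler_wpM2r ?hnorm_ge0// ler_norm.
by rewrite -mulrA ler_wpM2l// hnormBC.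
Qed.

Lemma hclosed_ker X (phi : H2 R -> R[i]) (M : R) : hclosed X ->
  (forall c x y, phi (c *: x + y) = c * phi x + phi y) -> (forall x, nm (phi x) <= M * hnorm x) ->
  hclosed (X `&` [set x | phi x = 0]).
Proof.
move=> cX lphi bphi x clx; split.
  by apply: cX => e /clx[y [Xy _] xy]; exists y.
apply/nm_eq0/eqP; rewrite eq_le nm_ge0 andbT; apply/ler_addgt0Pr => e e0; rewrite add0r.
have M1 : 0 < `|M| + 1 by rewrite ltr_wpDl.
have [y [_ /= y0] xy] := clx _ (divr_gt0 e0 M1).
have -> : phi x = phi (x - y).
  by rewrite addrC -scaleN1r lphi y0 mulr0 add0r.
apply: le_trans (bphi _) _; apply: (@le_trans _ _ ((`|M| + 1) * hnorm (x - y))).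
  by rewrite ler_wpM2r ?hnorm_ge0// (le_trans (ler_norm M))// lerDl.
by rewrite mulrC -ler_pdivlMr// ltW.
Qed.

(* Each functional cuts [X] down by at most one dimension, so [A X] is obtained
   from a closed subspace by adding finitely many lines. *)
Lemma hclosed_image A (M C : R) (phi : nat -> H2 R -> R[i]) N : linear A -> bop M A ->
  (forall k c x y, phi k (c *: x + y) = c * phi k x + phi k y) ->
  (forall k, exists Q : R, forall x, nm (phi k x) <= Q * hnorm x) ->
  forall X, subspace X -> hclosed X ->
  (forall x, X x -> (forall k, (k < N)%N -> phi k x = 0) -> hnorm x <= C * hnorm (A x)) ->
  hclosed (A @` X).
Proof.
move=> lA bA lphi bphi; elim: N => [|N ih] X sX cX lowA.
  by apply: hclosed_image_lower lA bA sX cX _ => x Xx; exact: lowA.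
have [X0 lX] := sX; pose Y := X `&` [set x | phi N x = 0].
have phi0 : phi N 0 = 0 by have := lphi N (-1) 0 0; rewrite scaler0 addr0 mulN1r addNr.
have sY : subspace Y.
  split => // c x y [Xx x0] [Xy y0]; split; first exact: lX.
  by rewrite /= lphi x0 y0 mulr0 addr0.
have cY : hclosed Y by have [Q QP] := bphi N; exact: hclosed_ker cX (lphi N) QP.
have cAY : hclosed (A @` Y).
  apply: ih => // x [Xx x0] xk; apply: lowA => // k; rewrite ltnS leq_eqVlt => /orP[/eqP -> //|]; exact: xk.
have [[v Xv v0]|h] := pselect (exists2 v, X v & phi N v != 0); last first.
  rewrite (_ : A @` X = A @` Y)//; congr image; apply/seteqP; split => x; last by case.
  by move=> Xx; split => //=; apply: contrapT => /eqP x0; apply: h; exists x.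
rewrite (_ : A @` X = [set x | exists2 y, (A @` Y) y & exists c, x = y + c *: A v]).
  by apply: hclosed_line => //; exact: image_subspace.
apply/seteqP; split => [_ [x Xx <-]|_ [_ [y [Xy _] <-] [c ->]]]; last first.
  by exists (c *: v + y); [exact: lX|rewrite lA addrC].
pose c := phi N x / phi N v.
exists (A (- c *: v + x)); last by exists c; rewrite lA scaleNr [RHS]addrC addrA subrr add0r.
exists (- c *: v + x) => //; split; first exact: lX.
by rewrite /= lphi mulNr divfK// addNr.
Qed.

(** Riesz's decomposition: 1 + K is an invertible operator plus the finite rank operator
    [hsum N \o K], since K minus that operator has norm at most 1/2. *)
Lemma riesz_split K : linear K -> fin_net K -> exists N B, [/\ linear B,
  forall y, B y + (K (B y) - hsum N (K (B y))) = y,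
  forall x, B (x + (K x - hsum N (K x))) = x &
  forall x, hnorm x <= 2 * hnorm (x + (K x - hsum N (K x)))].
Proof.
move=> lK nK; have e0 : 0 < 2^-1 :> R by rewrite invr_gt0.
have [N NP] := fin_net_hsum nK lK e0; have bN := NP N (leqnn N).
have lE : linear (fun x => K x - hsum N (K x)).
  exact: linear_sub lK (linear_comp (@hsum_lin R N) lK).
have [B [lB B1 B2]] := neumann lE bN.
by exists N, B; split => // x; exact: half_bop_lower bN.
Qed.

Lemma toeplitz_left_inverse M N f g K : bnd M f -> bnd N g -> g * f = 1 ->
  forall x, toeplitz g (toeplitz f x + K x) = x + (semicomm g f x + toeplitz g (K x)).
Proof.
move=> bf bg gf x; rewrite (lin_D (toeplitz_lin bg)) /semicomm gf toeplitz1 addrA.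
by congr (_ + _); rewrite addrC subrK.
Qed.

Lemma toeplitz_right_inverse f g K : f * g = 1 ->
  forall x, toeplitz f (toeplitz g x) + K (toeplitz g x) = x + (semicomm f g x + K (toeplitz g x)).
Proof. by move=> fg x; rewrite /semicomm fg toeplitz1 addrA; congr (_ + _); rewrite addrC subrK. Qed.

Lemma invertible_fredholm f K : invertibleQC f -> linear K -> fin_net K ->
  fredholm (toeplitz f \+ K).
Proof.
move=> [qf [g qg fg]] lK nK; set A := toeplitz f \+ K.
have [M M0 bf] := QC_bnd qf; have [N N0 bg] := QC_bnd qg.
have [lf lg] := (toeplitz_lin bf, toeplitz_lin bg).
have bA : bounded_operator A by apply: toeplitz_compact_bounded; exists f, K.
have [lA [Q Q0 bQ]] := (bounded_operatorP A).1 bA.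
pose K1 x := semicomm g f x + toeplitz g (K x).
pose K2 x := semicomm f g x + K (toeplitz g x).
have lK1 : linear K1.
  by apply: linear_add (semicomm_lin bg bf) _; exact: linear_comp lg lK.
have nK1 : fin_net K1.
  apply: fin_net_add; first by apply: fin_net_semicomm bg _; have [] := (QCP f).1 qf.
  exact: fin_net_compl lg (hnorm_toeplitz bg) nK.
have lK2 : linear K2.
  by apply: linear_add (semicomm_lin bf bg) _; exact: linear_comp lK lg.
have nK2 : fin_net K2.
  apply: fin_net_add; first by apply: fin_net_semicomm bf _; have [] := (QCP g).1 qg.
  exact: fin_net_compr lK (hnorm_toeplitz bg) nK.
have gf : g * f = 1 by rewrite mulrC.
have BA x : toeplitz g (A x) = x + K1 x by exact: toeplitz_left_inverse bf bg gf x.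
have AB x : A (toeplitz g x) = x + K2 x by exact: toeplitz_right_inverse fg x.
have [N1 [S1 [lS1 S1r S1l low1]]] := riesz_split lK1 nK1.
have [N2 [S2 [lS2 S2r S2l low2]]] := riesz_split lK2 nK2.
have lcoef N' L x : linear L -> hsum N' (L x) = \sum_(k < N') coef k (L x) *: hchi R k.
  by rewrite /hsum big_mkord.
split => //.
(* On the kernel x + K1 x = 0, so x is the image under S1 of the finite rank part. *)
- exists N1, (fun k => S1 (hchi R k)) => x /= Ax0.
  exists (fun k : 'I_N1 => - coef k (K1 x)).
  have h : x + (K1 x - hsum N1 (K1 x)) = - hsum N1 (K1 x).
    by rewrite addrA -BA Ax0 (lin_0 lg) add0r.
  rewrite -[LHS]S1l h (lin_N lS1) (lcoef _ K1 x lK1) (lin_sum lS1) -sumrN.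
  by apply: eq_bigr => k _; rewrite (lin_Z lS1) scaleNr.
(* Where the N1 functionals [coef k (K1 x)] vanish, T_g A x is the invertible part applied to x,
   which gives |x| <= 2 |T_g A x| <= 2 N |A x|. *)
- move=> z /closure_hnormP clz.
  apply: (@hclosed_image A Q (2 * N) (fun k x => coef k (K1 x)) N1 lA bQ _ _ setT) => //.
  + by move=> k c x y; rewrite lK1 coef_lin.
  + move=> k; have [P PP] := @nm_coef R k; have [P' P'0 P'P] := fin_net_bop lK1 nK1.
    exists (`|P| * P') => x; apply: le_trans (PP _) _.
    apply: (@le_trans _ _ (`|P| * hnorm (K1 x))); first by rewrite ler_wpM2r ?hnorm_ge0// ler_norm.
    by rewrite -mulrA ler_wpM2l.
  + move=> x _ xk; apply: le_trans (low1 x) _.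
    rewrite (lcoef _ K1 x lK1) big1 ?subr0; last by move=> k _; rewrite xk ?scale0r.
    by rewrite -BA -mulrA ler_wpM2l//; exact: hnorm_toeplitz.
(* With x = S2 y, the vector A (T_g x) = x + K2 x differs from y only by the finite rank part of
   K2. *)
- exists N2, (fun k => hchi R k) => y.
  exists (A (toeplitz g (S2 y))), (fun k : 'I_N2 => - coef k (K2 (S2 y))).
  split; first by exists (toeplitz g (S2 y)).
  rewrite AB -[LHS]S2r (lcoef _ K2 _ lK2) addrA -sumrN; congr (_ + _).
  by apply: eq_bigr => k _; rewrite scaleNr.
Qed.

End fredholm_theory.

(** * Compact operators as elements of the Toeplitz algebra *)

Section compact_in_algebra.
Variable R : realType.
Local Notation twopi := (pi *+ 2 : R).
Implicit Types (f g h : L0 R) (x y u v : H2 R) (z w c : R[i]) (A B K L : H2 R -> H2 R).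

Lemma nondecreasing_tail (s : nat -> R) (B : R) : (forall i j, (i <= j)%N -> s i <= s j) ->
  (forall k, s k <= B) -> forall e : R, 0 < e -> exists N, forall k, (N <= k)%N -> s k - s N <= e.
Proof.
move=> smono sB e e0.
have [l lP] : exists l : R, s @ \oo --> l.
  apply/cvg_ex; apply: nondecreasing_is_cvgn => //.
  by exists B => _ [k _ <-].
have /cvgrPdist_le /(_ _ (divr_gt0 e0 (ltr0Sn R 1))) [N _ NP] := lP.
exists N => k Nk; apply: le_trans (ler_norm _) _; apply: le_trans (ler_distD l _ _) _.
by rewrite [e]splitr distrC lerD//; apply: NP => //=.
Qed.

(* The tail is estimated by Cauchy-Schwarz against the partial sums of the
   Riesz representative of [phi]. *)
Lemma functional_tail (phi : H2 R -> R[i]) (C e : R) :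
  (forall c x y, phi (c *: x + y) = c * phi x + phi y) -> (forall x, nm (phi x) <= C * hnorm x) ->
  0 < e -> exists N, forall x, nm (phi (x - hsum N x)) <= e * hnorm x.
Proof.
move=> lphi bphi e0; have tp0 := twopi_gt0 R.
have phi0 : phi 0 = 0 by have := lphi (-1) 0 0; rewrite scaler0 addr0 mulN1r addNr.
have phiZ c x : phi (c *: x) = c * phi x by rewrite -[c *: x]addr0 lphi phi0 addr0.
have phiD x y : phi (x + y) = phi x + phi y by rewrite -[x in LHS]scale1r lphi mul1r.
have phiB x y : phi (x - y) = phi x - phi y by rewrite phiD -scaleN1r phiZ mulN1r.
(* The Fourier coefficients of the vector that would represent [phi]. *)
pose b k := conjc (phi (hchi R k)) * (twopi^-1)%:C.
pose V M N : H2 R := \sum_(M <= k < N) b k *: hchi R k.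
have hipV M N x : (M <= N)%N -> hip x (V M N) = phi (hsum N x - hsum M x).
  move=> MN; rewrite /hsum (big_cat_nat (leq0n M) MN)/= addrAC subrr add0r.
  rewrite (big_morph phi phiD phi0) /V.
  rewrite (big_morph (hip x) (fun y u => hipDr y u x) (hip0r x)); apply: eq_bigr => k _.
  have cM (a a' : R[i]) : conjc (a * a') = conjc a * conjc a' by exact: rmorphM.
  by rewrite hipZr phiZ /b cM conjcK conjc_real /coef; ring.
pose s N := hnorm (V 0%N N) ^+ 2.
have nV M N : hnorm (V M N) ^+ 2 = \sum_(M <= k < N) nm (b k) ^+ 2 * twopi.
  by rewrite /hnorm /V H2val_sum L2norm_lincomb ?iota_uniq.
have smono i j : (i <= j)%N -> s i <= s j.
  move=> ij; rewrite /s !nV (big_cat_nat (leq0n i) ij)/= lerDl sumr_ge0// => k _.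
  by rewrite mulr_ge0 ?sqr_ge0// ltW.
(* Evaluating [phi] at the partial sum V itself gives |V|^2 <= |C| |V|. *)
have sB k : s k <= `|C| ^+ 2.
  rewrite /s lerXn2r ?nnegrE ?hnorm_ge0//.
  have [->//|n0] := eqVneq (hnorm (V 0%N k)) 0.
  have np : 0 < hnorm (V 0%N k) by rewrite lt_def n0 hnorm_ge0.
  rewrite -(ler_pM2r np) -expr2.
  have -> : hnorm (V 0%N k) ^+ 2 = nm (hip (V 0%N k) (V 0%N k)).
    by rewrite hip_self nm_real ger0_norm ?sqr_ge0.
  rewrite hipV// [hsum 0 _]/hsum big_geq// subr0; apply: le_trans (bphi _) _.
  apply: (@le_trans _ _ (`|C| * hnorm (hsum k (V 0%N k)))).
    by rewrite ler_wpM2r ?hnorm_ge0// ler_norm.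
  by rewrite ler_wpM2l// hnorm_hsum.
have [N NP] := nondecreasing_tail smono sB (exprn_gt0 2 e0).
exists N => x; apply/ler_addgt0Pr => d d0.
have C1 : 0 < `|C| + 1 by rewrite ltr_wpDl.
have [M MP] := hsum_cvg x (divr_gt0 d0 C1).
pose k := maxn N M; have Nk : (N <= k)%N by exact: leq_maxl.
have -> : x - hsum N x = (hsum k x - hsum N x) + (x - hsum k x).
  by rewrite [RHS]addrC subrKA.
rewrite phiD; apply: le_trans (nmD _ _) _; apply: lerD.
  rewrite -hipV//; apply: le_trans (nm_hip _ _) _; rewrite mulrC ler_wpM2r ?hnorm_ge0//.
  rewrite -ler_sqr ?nnegrE ?hnorm_ge0 ?(ltW e0)//; apply: le_trans (NP k Nk).
  by rewrite /s !nV (big_cat_nat (leq0n N) Nk)/= addrAC subrr add0r.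
apply: le_trans (bphi _) _; apply: (@le_trans _ _ ((`|C| + 1) * hnorm (x - hsum k x))).
  by rewrite ler_wpM2r ?hnorm_ge0// (le_trans (ler_norm C))// lerDl.
by rewrite mulrC -ler_pdivlMr//; apply: MP; exact: leq_maxr.
Qed.

(** T_(chi_1) is the unilateral shift S, and 1 - S S* is the projection on the constants. It is the
    semicommutator of chi_1 and chi_(-1) up to sign, and [semicomm_chiN] with n = 0 leaves a single
    term. *)
Lemma defect_chi1 y : y - toeplitz (chi R 1) (toeplitz (chi R (-1)) y) = coef 0%N y *: hchi R 0%N.
Proof.
have b1 := bnd_chi R 1.
have := semicomm_chiN 0%N y b1; rewrite big_nat1 NegzE /semicomm chiM subrr chi0 !toeplitz1.
have -> : toeplitz (chi R (-1)) (hchi R 0%N) = 0.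
  apply: hip_ext => u; rewrite (hip_toeplitz (bnd_chi R _)) hip0l /= chiM addr0.
  rewrite (inner_conj (L2_H2 u) (L2_chi R _)).
  by have [_ ->] := (hardyP _).1 (H2valP u); rewrite ?rmorph0.
rewrite (lin_0 (toeplitz_lin b1)) sub0r scalerN => /eqP; rewrite -opprB eqr_opp => /eqP ->.
by [].
Qed.

Lemma rank1_toeplitz (i j : nat) x : coef j x *: hchi R i =
  toeplitz (chi R i%:Z) (toeplitz (chi R (- j%:Z)) x -
    toeplitz (chi R 1) (toeplitz (chi R (-1)) (toeplitz (chi R (- j%:Z)) x))).
Proof.
rewrite defect_chi1 (lin_Z (toeplitz_lin (bnd_chi R _))); congr (_ *: _).
  rewrite /coef (hip_toeplitz (bnd_chi R _)) mulrC [chi R _ * _]mulrC inner_mulchi opprK add0r.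
  by rewrite mulrC.
by rewrite /toeplitz /= chiM addr0 -[chi R _]/(H2val (hchi R i)) H2proj_id.
Qed.

Section members.
Variable S : set (H2 R -> H2 R).
Hypothesis (cS : cstar_algebra S) (tS : @toeplitz R @` @QC R `<=` S).

Let S0 : S (fun _ => 0). Proof. by have [_ []] := cS. Qed.
Let Slin c A B : S A -> S B -> S (fun x => c *: A x + B x).
Proof. by have [_ [_ h] _ _ _] := cS; exact: h. Qed.
Let Scomp A B : S A -> S B -> S (A \o B).
Proof. by have [_ _ h _ _] := cS; exact: h. Qed.

Lemma mem_toeplitz_chi m : S (toeplitz (chi R m)).
Proof. by apply: tS; exists (chi R m) => //; exact: QC_chi. Qed.

Lemma mem_scale c A : S A -> S (fun x => c *: A x).
Proof.
move=> SA; rewrite (_ : (fun x => _) = fun x => c *: A x + 0); first exact: Slin.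
by apply/funext => x; rewrite addr0.
Qed.

Lemma mem_sum (F : nat -> H2 R -> H2 R) N : (forall k, S (F k)) -> S (fun x => \sum_(0 <= k < N) F k x).
Proof.
move=> SF; elim: N => [|N ih].
  by rewrite (_ : (fun x => _) = fun _ => 0)//; apply/funext => x; rewrite big_geq.
rewrite (_ : (fun x => _) = fun x => 1 *: F N x + \sum_(0 <= k < N) F k x); first exact: Slin.
by apply/funext => x; rewrite big_nat_recr//= scale1r addrC.
Qed.

Lemma mem_limit A (M : R) : linear A -> bop M A ->
  (forall e : R, 0 < e -> exists2 B, S B & bop e (fun x => A x - B x)) -> S A.
Proof.
move=> lA bA lim; have [_ _ _ _ h] := cS; apply: h; split.
  apply/bounded_operatorP; split => //; exists `|M| => //.
  exact: bop_mono (ler_norm M) bA.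
(* The tolerances of [operator_closure] live in [R[i]]; positivity forces them to be real. *)
move=> e; rewrite ltcE => /andP[/eqP ie re].
have [B SB BP] := lim _ re; exists B => // x.
have -> : e = (Re e)%:C by case: e ie {re BP lim} => a b /= ->.
by rewrite !H2normE -rmorphM lecR; exact: BP.
Qed.

Lemma mem_rank1 (i j : nat) : S (fun x => coef j x *: hchi R i).
Proof.
rewrite (_ : (fun x => _) = toeplitz (chi R i%:Z) \o
  ((fun x => (-1) *: (toeplitz (chi R 1) \o toeplitz (chi R (-1))) x + toeplitz (chi R 0) x)
    \o toeplitz (chi R (- j%:Z)))).
  apply: Scomp; first exact: mem_toeplitz_chi.
  apply: Scomp; last exact: mem_toeplitz_chi.
  apply: Slin; last exact: mem_toeplitz_chi.
  by apply: Scomp; exact: mem_toeplitz_chi.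
apply/funext => x; rewrite rank1_toeplitz /=; congr toeplitz.
by rewrite chi0 toeplitz1 scaleN1r addrC.
Qed.

(** Truncating a compact K produces the functionals [coef k (K x)], which are not coefficients of x.
    By [functional_tail] they are norm limits of finite combinations of coefficients, for which
    [mem_rank1] applies. *)
Lemma mem_functional (phi : H2 R -> R[i]) (C : R) (i : nat) :
  (forall c x y, phi (c *: x + y) = c * phi x + phi y) -> (forall x, nm (phi x) <= C * hnorm x) ->
  S (fun x => phi x *: hchi R i).
Proof.
move=> lphi bphi.
have phi0 : phi 0 = 0 by have := lphi (-1) 0 0; rewrite scaler0 addr0 mulN1r addNr.
apply: (@mem_limit _ (C * hnorm (hchi R i))).
- by move=> c x y; rewrite lphi scalerDl scalerA.
- by move=> x; rewrite hnormZ mulrAC ler_wpM2r ?hnorm_ge0.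
move=> e e0; have h1 : 0 < hnorm (hchi R i) + 1 by rewrite ltr_wpDl ?hnorm_ge0.
have [N NP] := functional_tail lphi bphi (divr_gt0 e0 h1).
exists (fun x => \sum_(0 <= k < N) phi (hchi R k) *: (coef k x *: hchi R i)).
  by apply: (mem_sum (F := fun k x => phi (hchi R k) *: (coef k x *: hchi R i))) => k; apply: mem_scale; exact: mem_rank1.
move=> x; have -> : \sum_(0 <= k < N) phi (hchi R k) *: (coef k x *: hchi R i) = phi (hsum N x) *: hchi R i.
  rewrite /hsum; elim: (N) => [|n ih]; first by rewrite !big_geq// phi0 scale0r.
  by rewrite !big_nat_recr//= ih [LHS]addrC scalerA -scalerDl [in RHS]addrC lphi mulrC.
rewrite -scalerBl hnormZ.
have -> : phi x - phi (hsum N x) = phi (x - hsum N x).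
  by rewrite [x - _]addrC -[- hsum N x]scaleN1r lphi mulN1r addrC.
apply: (@le_trans _ _ (nm (phi (x - hsum N x)) * (hnorm (hchi R i) + 1))).
  by rewrite ler_wpM2l ?nm_ge0// lerDl.
by rewrite -ler_pdivlMr// mulrAC.
Qed.

(** K is the norm limit of [hsum N (K x)], a finite sum of operators covered by [mem_functional]. *)
Lemma mem_compact K : linear K -> fin_net K -> S K.
Proof.
move=> lK nK; have [M M0 bM] := fin_net_bop lK nK.
apply: (mem_limit lK bM) => e e0.
have [N NP] := fin_net_hsum nK lK e0.
exists (fun x => hsum N (K x)); last exact: NP.
apply: (mem_sum (F := fun k x => coef k (K x) *: hchi R k)) => k.
have [P PP] := @nm_coef R k; apply: (@mem_functional _ (`|P| * M)) => [c x y|x].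
  by rewrite lK coef_lin.
apply: le_trans (PP _) _; apply: (@le_trans _ _ (`|P| * hnorm (K x))).
  by rewrite ler_wpM2r ?hnorm_ge0// ler_norm.
by rewrite -mulrA ler_wpM2l.
Qed.

Lemma mem_toeplitz_compact f K : QC f -> linear K -> fin_net K -> S (toeplitz f \+ K).
Proof.
move=> qf lK nK; rewrite (_ : _ \+ _ = fun x => 1 *: toeplitz f x + K x).
  by apply: Slin; [apply: tS; exists f|exact: mem_compact].
by apply/funext => x; rewrite scale1r.
Qed.

End members.

End compact_in_algebra.

Theorem theorem10p3 (R : realType) :
  [set A : H2 R -> H2 R | fredholm A] `&` @toeplitzQC_algebra R =
  [set (toeplitz f \+ K : H2 R -> H2 R)
     | f in @invertibleQC R & K in [set K : H2 R -> H2 R | compact_operator K]].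
Proof.
apply/seteqP; split => [A [/= fA /toeplitzQC_algebraE[f [K [qf lK nK AE]]]]|].
  exists f; last by exists K => //; apply/compactP.
  have [M _ bf] := QC_bnd qf; have [_ _ _ cA] := fA.
  rewrite AE in cA; have [d d0 df] := fredholm_symbol bf lK nK cA.
  by split => //; exact: QC_inverse qf d0 df.
move=> _ [f If [K /compactP[lK nK] <-]]; split; first exact: invertible_fredholm.
(* Membership in the smallest C*-algebra means membership in every C*-algebra S that contains the
   operators T_f with f in QC. *)
by move=> S [cS tS]; apply: mem_toeplitz_compact => //; case: If.
Qed.
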